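(* All conformal geodesics of the Fubini–Study metric $g_{\mathbb{CP}^2}$ on $\mathbb{CP}^2$ are of the form $\rho\circ\Gamma$, where $\rho$ is an isometry of the Fubini–Study metric and $\Gamma$ is some conformal geodesic on a surface $r=\mathrm{const}$ of one of the following two types: (i) $\Gamma$ is a trajectory of the Killing vector $\partial/\partial\psi$; (ii) $\Gamma$ is of the form $$\chi=\operatorname{arccot}\Big(\frac{\kappa\,(c_2\cos(\kappa s)-\sin(\kappa s))}{Q\,(c_3+c_2\sin(\kappa s)+\cos(\kappa s))}\Big),\quad \theta=\operatorname{arccot}\Big(\frac{Q-\dot\chi}{P\sin\chi}\Big),\quad \phi=P\int\frac{\sin\chi}{\sin\theta}\,ds,$$ where $$Q=\frac{2\gamma}{r}-\gamma r,\qquad P=\frac{2\sqrt{(1+r^2)(1-\gamma^2)}}{r},\qquad \kappa=\sqrt{P^2+Q^2},$$ $\chi=\psi-3\gamma r s+c_1$, and $r,\gamma,c_1,c_2,c_3$ are constants with $-1<\gamma<1$.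
   Context: The Fubini–Study metric on $\mathbb{CP}^2$ (normalised to have Ricci scalar $24$) is, in local form, $$g_{\mathbb{CP}^2}=\frac{dr^2}{(1+r^2)^2}+\frac14\frac{r^2\sigma_3^2}{(1+r^2)^2}+\frac14\frac{r^2}{1+r^2}(\sigma_1^2+\sigma_2^2),$$ where $\sigma_1+i\sigma_2=e^{-i\psi}(d\theta+i\sin\theta\,d\phi)$ and $\sigma_3=d\psi+\cos\theta\,d\phi$ are the left-invariant one-forms on $SU(2)$ in Euler angles $(\theta,\phi,\psi)$. The metric is regular everywhere on $\mathbb{CP}^2$, including at $r=0$ and on the $\mathbb{CP}^1$ at $r=\infty$. Here $s$ is the arc-length parameter along $\Gamma$ and a dot denotes $d/ds$. Conformal geodesics: on an $n$-dimensional Riemannian manifold ($n>2$), a curve parametrised by arc-length, with unit tangent vector $u$ and acceleration $a=\nabla_u u$ ($\nabla$ the Levi-Civita connection of $g$), is a conformal geodesic if $\nabla_u a=-(|a|^2+L(u,u))u+L^\sharp(u)$, where $L=\frac{1}{n-2}\big(R-\frac{1}{2(n-1)}Sg\big)$ is the Schouten tensor ($R$ the Ricci tensor, $S$ the Ricci scalar) and $g(L^\sharp(X),Y)=L(X,Y)$ for all vector fields $X,Y$. Since $g_{\mathbb{CP}^2}$ is Einstein, this reads $\nabla_u a=-|a|^2u$ with $|a|^2=g(a,a)$ constant.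
   Formalization: When Q = 0 (γ = 0 or r² = 2) the quotient inside the first arccot is undefined; it is read as 0, so χ = θ = π/2 (the limit c₃ → ∞). This is needed, e.g. for the curve with g(a,Ju) = 0, |a|² = 1/2 (J the complex structure), which occurs only with Q = 0. *)

(* Defs.v *)
From HB Require Import structures.
From mathcomp Require Import all_boot all_order all_algebra.
From mathcomp Require Import complex generic_quotient.
From mathcomp Require Import all_classical all_reals all_analysis.
From mathcomp Require Import ring.

Set Implicit Arguments.
Unset Strict Implicit.
Unset Printing Implicit Defensive.

Import Order.TTheory GRing.Theory Num.Theory.
Import numFieldNormedType.Exports.

Local Open Scope classical_set_scope.
Local Open Scope ring_scope.
Local Open Scope quotient_scope.

(** Riemannian geometry in a coordinate chart of dimension n + 1.  Tangent
    vectors are row vectors, and a metric is the matrix-valued function of its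
    components. *)
Section CoordinateGeometry.
Context (R : realType) (n : nat).
Local Notation V := 'rV[R]_n.+1.

Definition partial (i : 'I_n.+1) (f : V -> R) (x : V) : R :=
  'D_(delta_mx ord0 i) f x.

Definition pairing (A : 'M[R]_n.+1) (v w : V) : R :=
  (v *m A *m w^T) ord0 ord0.

Variable g : V -> 'M[R]_n.+1.

Definition christoffel (x : V) (k i j : 'I_n.+1) : R :=
  2^-1 * \sum_l invmx (g x) k l *
    (partial i (fun y => g y j l) x + partial j (fun y => g y i l) x
     - partial l (fun y => g y i j) x).

(* R_ij = d_k G^k_ij - d_j G^k_ki + G^k_km G^m_ij - G^k_jm G^m_ki, positive on
   round spheres. *)
Definition ricci (x : V) : 'M[R]_n.+1 :=
  \matrix_(i, j) \sum_k
    (partial k (fun y => christoffel y k i j) x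
     - partial j (fun y => christoffel y k k i) x
     + \sum_m (christoffel x k k m * christoffel x m i j
               - christoffel x k j m * christoffel x m k i)).

Definition ricci_scalar (x : V) : R := \tr (invmx (g x) *m ricci x).

Definition schouten (x : V) : 'M[R]_n.+1 :=
  let d : R := n.+1%:R in
  (d - 2)^-1 *: (ricci x - (ricci_scalar x / (2 * (d - 1))) *: g x).

Definition schouten_sharp (x v : V) : V := v *m schouten x *m invmx (g x).

(* Covariant derivative of the vector field W along the curve x. *)
Definition cov_derive (x W : R -> V) (t : R) : V :=
  derive1 W t + \row_k \sum_i \sum_j
    christoffel (x t) k i j * derive1 x t ord0 i * W t ord0 j.

Definition velocity (x : R -> V) : R -> V := derive1 x.
Definition acceleration (x : R -> V) : R -> V := cov_derive x (velocity x).

Definition conformal_geodesic_eq (x : R -> V) (t : R) : Prop :=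
  let u := velocity x t in
  let a := acceleration x t in
  cov_derive x (acceleration x) t =
    - (pairing (g (x t)) a a + pairing (schouten (x t)) u u) *: u
    + schouten_sharp (x t) u.

End CoordinateGeometry.

Fixpoint Ck_on (R : realType) (n m k : nat) (U : set 'rV[R]_n.+1)
    (f : 'rV[R]_n.+1 -> 'rV[R]_m.+1) : Prop :=
  match k with
  | 0 => forall x, U x -> {for x, continuous f}
  | k'.+1 => (forall x, U x -> differentiable f x) /\
             forall i, Ck_on k' U (fun x => 'D_(delta_mx ord0 i) f x)
  end.

Definition smooth_on (R : realType) (n m : nat) (U : set 'rV[R]_n.+1)
    (f : 'rV[R]_n.+1 -> 'rV[R]_m.+1) : Prop :=
  forall k, Ck_on k U f.

Section ProjectivePlane.
Context (R : realType).
Local Notation C := R[i].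

Definition hvec := {v : 'rV[C]_3 | v != 0}.

Definition collinear (v w : hvec) : bool := (val v == val w)%MS.

Lemma collinear_refl : reflexive collinear.
Proof. by move=> v; rewrite /collinear !submx_refl. Qed.

Lemma collinear_sym : symmetric collinear.
Proof. by move=> v w; rewrite /collinear andbC. Qed.

Lemma collinear_trans : transitive collinear.
Proof.
move=> v u w /andP[uv vu] /andP[vw wv].
by rewrite /collinear (submx_trans uv vw) (submx_trans wv vu).
Qed.

Canonical collinear_equiv :=
  EquivRel collinear collinear_refl collinear_sym collinear_trans.

Definition CP2 := {eq_quot collinear}.

Definition hcoord (p : CP2) : 'rV[C]_3 := val (repr p).

Lemma hvec1_proof : const_mx 1 != 0 :> 'rV[C]_3.
Proof.
by apply/eqP => /matrixP /(_ ord0 ord0) /eqP; rewrite !mxE oner_eq0.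
Qed.

(* [v 0 : v 1 : v 2]; the zero vector is sent to an arbitrary point. *)
Definition hpoint (v : 'rV[C]_3) : CP2 :=
  (\pi_CP2 (insubd (Sub (const_mx 1) hvec1_proof : hvec) v))%qT.

(** The three affine charts Z_j != 0, with coordinates
    (Re w_0, Im w_0, Re w_1, Im w_1), where w_0 and w_1 are the two ratios
    Z_k / Z_j, k != j, in increasing order of k. *)
Definition affine_dom (j : 'I_3) : set CP2 :=
  [set p | hcoord p ord0 j != 0].

Definition affine_coord (j : 'I_3) (p : CP2) : 'rV[R]_4 :=
  \row_(m < 4)
    let w := hcoord p ord0 (lift j (inord m./2 : 'I_2)) / hcoord p ord0 j in
    if odd m then complex.Im w else complex.Re w.

Definition affine_point (j : 'I_3) (x : 'rV[R]_4) : CP2 :=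
  hpoint (\row_(k < 3)
    if unlift j k is Some l
    then Complex (x ord0 (inord l.*2)) (x ord0 (inord l.*2.+1))
    else 1).

(* Multiplication by i on C^2 = R^4. *)
Definition mulI (x : 'rV[R]_4) : 'rV[R]_4 :=
  \row_(m < 4) if odd m then x ord0 (inord m.-1) else - x ord0 (inord m.+1).

(* The Fubini-Study metric |dw|^2/(1+|w|^2) - |<w,dw>|^2/(1+|w|^2)^2, which has
   this same expression in each of the three affine charts; the real and
   imaginary parts of <w,dw> are the pairings of dx with x and i x. *)
Definition fubini_study (x : 'rV[R]_4) : 'M[R]_4 :=
  let N := 1 + \sum_m x ord0 m ^+ 2 in
  N^-1 *: 1%:M - (N ^+ 2)^-1 *: (x^T *m x + (mulI x)^T *m mulI x).

(* Three derivatives give a meaning to the equation, whose solutions are then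
   automatically smooth. *)
Definition conformal_geodesic (I : set R) (c : R -> CP2) : Prop :=
  forall s, I s -> forall j, affine_dom j (c s) ->
    let x := affine_coord j \o c in
    [/\ \forall t \near s, affine_dom j (c t),
        forall k, (k < 3)%N -> derivable (derive1n k x) s 1,
        pairing (fubini_study (x s)) (velocity x s) (velocity x s) = 1 &
        conformal_geodesic_eq fubini_study x s].

Definition smooth_map (F : CP2 -> CP2) : Prop :=
  forall j k,
    let U := [set x | affine_dom k (F (affine_point j x))] in
    open U /\ smooth_on U (affine_coord k \o F \o affine_point j).

Definition preserves_metric (F : CP2 -> CP2) : Prop :=
  forall j k x, affine_dom k (F (affine_point j x)) ->
    let f := affine_coord k \o F \o affine_point j in
    forall v w, pairing (fubini_study (f x)) ('D_v f x) ('D_w f x) =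
                pairing (fubini_study x) v w.

Definition fs_isometry (F : CP2 -> CP2) : Prop :=
  preserves_metric F /\ smooth_map F /\
  exists G, [/\ cancel F G, cancel G F & smooth_map G].

(* Coordinates (r, theta, phi, psi): in the chart Z_0 != 0,
     w_0 = r cos (theta/2) e^(i (psi + phi)/2),
     w_1 = r sin (theta/2) e^(i (psi - phi)/2). *)
Definition euler_affine (r theta phi psi : R) : 'rV[R]_4 :=
  let a := (psi + phi) / 2 in
  let b := (psi - phi) / 2 in
  \row_(m < 4) [:: r * cos (theta / 2) * cos a; r * cos (theta / 2) * sin a;
                   r * sin (theta / 2) * cos b; r * sin (theta / 2) * sin b]`_m.

Definition euler_point (r theta phi psi : R) : CP2 :=
  affine_point ord0 (euler_affine r theta phi psi).

(* Principal value, in ]0, pi[. *)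
Definition arccot (x : R) : R := pi / 2 - atan x.

Definition killing_psi_trajectory (r : R) (I : set R) (Gamma : R -> CP2) :
    Prop :=
  exists theta phi psi0 lambda, 0 <= theta <= pi /\
    forall s, I s -> Gamma s = euler_point r theta phi (psi0 + lambda * s).

(* When Q = 0, i.e. gamma = 0 or r ^+ 2 = 2, the quotient under the first arccot
   is 0 by the convention x / 0 = 0, whence chi = pi / 2: this is the limit of
   the formula as c3 -> oo.  The indefinite integral is any antiderivative. *)
Definition explicit_family (r : R) (I : set R) (Gamma : R -> CP2) : Prop :=
  exists gamma c1 c2 c3 : R, -1 < gamma < 1 /\
  exists theta phi psi : R -> R,
    let Q := 2 * gamma / r - gamma * r in
    let P := 2 * Num.sqrt ((1 + r ^+ 2) * (1 - gamma ^+ 2)) / r in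
    let kappa := Num.sqrt (P ^+ 2 + Q ^+ 2) in
    let chi := fun s => psi s - 3 * gamma * r * s + c1 in
    forall s, I s ->
      [/\ Gamma s = euler_point r (theta s) (phi s) (psi s),
          derivable chi s 1,
          chi s = arccot (kappa * (c2 * cos (kappa * s) - sin (kappa * s)) /
                          (Q * (c3 + c2 * sin (kappa * s) + cos (kappa * s)))),
          theta s = arccot ((Q - derive1 chi s) / (P * sin (chi s))) &
          is_derive s 1 phi (P * (sin (chi s) / sin (theta s)))].

Lemma fubini_study_euler_vector (r t p q dr dt dp dq : R) :
  let a := (q + p)/2 in let b := (q - p)/2 in
  let da := (dq + dp)/2 in let db := (dq - dp)/2 in
  let X := euler_affine r t p q in
  let C := cos (t/2) in let S := sin (t/2) in
  let dX : 'rV[R]_4 := \row_(m < 4) [:: dr * C * cos a - r * S * dt/2 * cos a - r * C * sin a * da;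
      dr * C * sin a - r * S * dt/2 * sin a + r * C * cos a * da;
      dr * S * cos b + r * C * dt/2 * cos b - r * S * sin b * db;
      dr * S * sin b + r * C * dt/2 * sin b + r * S * cos b * db]`_m in
  let s1 := cos q * dt + sin q * sin t * dp in
  let s2 := - sin q * dt + cos q * sin t * dp in
  let s3 := dq + cos t * dp in
  pairing (fubini_study X) dX dX =
   dr ^+ 2 / (1 + r^+2)^+2 + 4^-1 * (r^+2 * s3^+2) / (1 + r^+2)^+2
   + 4^-1 * (r^+2 / (1 + r^+2)) * (s1^+2 + s2^+2).
Proof.
move=> a b da db X C S dX s1 s2 s3.
have hab (u : R) : cos u ^+ 2 + sin u ^+ 2 = 1 by exact: cos2Dsin2.
have hC : C^+2 + S^+2 = 1 by exact: hab.
have ht : t = t/2 + t/2 by field.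
have es : s1^+2+s2^+2 = dt^+2 + (2 * S * C)^+2 * dp^+2.
  have -> : 2 * S * C = sin t by rewrite [in RHS]ht sinD -/C -/S; ring.
  have := hab q; rewrite /s1 /s2; move=> h.
  transitivity ((cos q ^+2 + sin q^+2) * (dt^+2 + sin t^+2 * dp^+2)); first by ring.
  by rewrite h mul1r.
have e3 : s3 = dq + (C^+2 - S^+2) * dp.
  by rewrite /s3 [in LHS]ht cosD -/C -/S; ring.
rewrite es e3.
pose x m := X ord0 m; pose d m := dX ord0 m.
pose N := 1 + \sum_m x m ^+ 2.
have NE : N = 1 + r^+2.
  rewrite /N /x !big_ord_recl big_ord0 !mxE /= -/C -/S -/a -/b.
  have h1 := hab a; have h2 := hab b.
  transitivity (1 + r^+2 * (C^+2 * (cos a^+2 + sin a^+2) + S^+2 * (cos b^+2+ sin b^+2))); first by ring.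
  by rewrite h1 h2 !mulr1 hC mulr1.
have E : pairing (fubini_study X) dX dX =
   N^-1 * (\sum_m d m ^+ 2) - (N^+2)^-1 * ((\sum_m x m * d m)^+2 + (\sum_m mulI X ord0 m * d m)^+2).
  rewrite /pairing /fubini_study -/N mulmxBr mulmxBl -!scalemxAr -!scalemxAl mulmx1 mulmxDr mulmxDl.
  have sq (y : 'rV[R]_4) : (dX *m (y^T *m y) *m dX^T) ord0 ord0 = (\sum_m y ord0 m * d m)^+2.
    rewrite mulmxA -mulmxA mxE big_ord1 expr2.
    have -> : (dX *m y^T) ord0 ord0 = \sum_m y ord0 m * d m.
      by rewrite mxE; apply: eq_bigr => m _; rewrite [y^T _ _]mxE mulrC.
    have -> // : (y *m dX^T) ord0 ord0 = \sum_m y ord0 m * d m.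
      by rewrite mxE; apply: eq_bigr => m _; rewrite [dX^T _ _]mxE.
  have ss : (dX *m dX^T) ord0 ord0 = \sum_m d m ^+2.
    by rewrite mxE; apply: eq_bigr => m _; rewrite [dX^T _ _]mxE expr2.
  have lin (A B D : 'M[R]_1) k l : (k *: A - l *: (B + D)) ord0 ord0 = k * A ord0 ord0 - l * (B ord0 ord0 + D ord0 ord0) by rewrite !mxE.
  by rewrite lin !sq ss.
have ed : \sum_m d m ^+2 = dr^+2 + r^+2 * (dt^+2/4 + C^+2*da^+2 + S^+2 * db^+2).
  rewrite /d !big_ord_recl big_ord0 !mxE /=.
  have h1 := hab a; have h2 := hab b.
  transitivity ((cos a^+2 + sin a^+2) * ((dr*C - r*S*dt/2)^+2 + r^+2*C^+2*da^+2)
   + (cos b^+2+ sin b^+2) * ((dr*S + r*C*dt/2)^+2 + r^+2*S^+2*db^+2)); first by field.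
  rewrite h1 h2.
  transitivity ((C^+2+S^+2) * (dr^+2 + r^+2*dt^+2/4) + r^+2 * (C^+2*da^+2 + S^+2*db^+2)); first by field.
  by rewrite hC; field.
have ex : \sum_m x m * d m = r * dr.
  rewrite /d /x !big_ord_recl big_ord0 !mxE /=.
  have h1 := hab a; have h2 := hab b.
  transitivity (r * ((cos a^+2 + sin a^+2) * C * (dr*C - r*S*dt/2)
   + (cos b^+2+ sin b^+2) * S * (dr*S + r*C*dt/2))); first by rewrite /a /b /C /S; field.
  rewrite h1 h2.
  transitivity (r * dr * (C^+2 + S^+2)); first by field.
  by rewrite hC mulr1.
have ei : \sum_m mulI X ord0 m * d m = r^+2 * (C^+2 * da + S^+2 * db).
  rewrite /d !big_ord_recl big_ord0 /mulI !mxE /= !inordK //=.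
  have h1 := hab a; have h2 := hab b.
  transitivity (r^+2 * ((cos a^+2 + sin a^+2) * C^+2*da
   + (cos b^+2+ sin b^+2) * S^+2*db)); first by rewrite /a /b /C /S; field.
  by rewrite h1 h2 !mul1r.
have n0 : 1 + r^+2 != 0 by apply: lt0r_neq0; rewrite ltr_pwDl // sqr_ge0.
rewrite E ed ex ei NE /da /db.
have -> : C^+2 = 1 - S^+2 by rewrite -hC; ring.
have -> : (2*S*C)^+2 = 4 * S^+2 * (1-S^+2).
  have -> : 1 - S^+2 = C^+2 by rewrite -hC; ring.
  ring.
by field.
Qed.

(* The metric along a curve in Euler coordinates is
     dr^2/(1+r^2)^2 + r^2 s3^2/(4 (1+r^2)^2) + r^2 (s1^2 + s2^2)/(4 (1+r^2))
   with s1 + i s2 = e^(-i psi) (dtheta + i sin theta dphi) and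
   s3 = dpsi + cos theta dphi. *)
Lemma fubini_study_euler (r t p q : R -> R) (s dr dt dp dq : R) :
  is_derive s 1 r dr -> is_derive s 1 t dt -> is_derive s 1 p dp -> is_derive s 1 q dq ->
  let x := fun s => euler_affine (r s) (t s) (p s) (q s) in
  let s1 := cos (q s) * dt + sin (q s) * sin (t s) * dp in
  let s2 := - sin (q s) * dt + cos (q s) * sin (t s) * dp in
  let s3 := dq + cos (t s) * dp in
  pairing (fubini_study (x s)) (derive1 x s) (derive1 x s) =
   dr ^+ 2 / (1 + r s^+2)^+2 + 4^-1 * (r s^+2 * s3^+2) / (1 + r s^+2)^+2
   + 4^-1 * (r s^+2 / (1 + r s^+2)) * (s1^+2 + s2^+2).
Proof.
move=> hr ht hp hq x s1 s2 s3.
have H (u v : R -> R) (w : R -> R) (du dv dw : R) :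
  is_derive s 1 u du -> is_derive s 1 v dv -> is_derive s 1 w dw ->
  [/\ is_derive s 1 (fun s => r s * cos (u s / 2) * cos (w s / 2)) (dr * cos (u s/2) * cos (w s / 2) - r s * sin (u s/2) * du/2 * cos (w s/2) - r s * cos (u s/2) * sin (w s/2) * (dw/2)),
   is_derive s 1 (fun s => r s * cos (u s / 2) * sin (w s / 2)) (dr * cos (u s/2) * sin (w s / 2) - r s * sin (u s/2) * du/2 * sin (w s/2) + r s * cos (u s/2) * cos (w s/2) * (dw/2)),
   is_derive s 1 (fun s => r s * sin (u s / 2) * cos (w s / 2)) (dr * sin (u s/2) * cos (w s / 2) + r s * cos (u s/2) * du/2 * cos (w s/2) - r s * sin (u s/2) * sin (w s/2) * (dw/2)) &
   is_derive s 1 (fun s => r s * sin (u s / 2) * sin (w s / 2)) (dr * sin (u s/2) * sin (w s / 2) + r s * cos (u s/2) * du/2 * sin (w s/2) + r s * sin (u s/2) * cos (w s/2) * (dw/2))].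
  move=> hu hv hw.
  have h2 (f : R -> R) (df : R) : is_derive s 1 f df -> is_derive s 1 (fun s => f s / 2) (df / 2).
    move=> hf; have -> : (fun s => f s / 2) = 2^-1 \*: f by apply/funext => z /=; rewrite /GRing.scale /= mulrC.
    by apply: is_derive_eq; rewrite /GRing.scale /= mulrC.
  have hc (f : R -> R) (df : R) : is_derive s 1 f df -> is_derive s 1 (fun s => cos (f s / 2)) (- sin (f s/2) * (df / 2)).
    by move=> /h2 hf; apply: (is_derive1_comp (f := cos)).
  have hs (f : R -> R) (df : R) : is_derive s 1 f df -> is_derive s 1 (fun s => sin (f s / 2)) (cos (f s/2) * (df / 2)).
    by move=> /h2 hf; apply: (is_derive1_comp (f := sin)).
  have m3 (f g h : R -> R) (df dg dh : R) : is_derive s 1 f df -> is_derive s 1 g dg -> is_derive s 1 h dh ->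
     is_derive s 1 (fun s => f s * g s * h s) (df * g s * h s + f s * dg * h s + f s * g s * dh).
    move=> hf hg hh.
    apply: (is_derive_eq (is_deriveM (is_deriveM hf hg) hh)).
    rewrite -![_ *: _]/(_ * _) -[(f * g) s]/(f s * g s). ring.
  split.
  - by apply: (is_derive_eq (m3 _ _ _ _ _ _ hr (hc _ _ hu) (hc _ _ hw))); field.
  - by apply: (is_derive_eq (m3 _ _ _ _ _ _ hr (hc _ _ hu) (hs _ _ hw))); field.
  - by apply: (is_derive_eq (m3 _ _ _ _ _ _ hr (hs _ _ hu) (hc _ _ hw))); field.
  - by apply: (is_derive_eq (m3 _ _ _ _ _ _ hr (hs _ _ hu) (hs _ _ hw))); field.
have hqp : is_derive s 1 (fun s => q s + p s) (dq + dp) by exact: is_deriveD.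
have hqm : is_derive s 1 (fun s => q s - p s) (dq - dp) by exact: is_deriveB.
have [d0 d1 _ _] := H _ _ _ _ _ _ ht hp hqp.
have [_ _ d2 d3] := H _ _ _ _ _ _ ht hp hqm.
have xE m : (fun s => x s ord0 m) = (fun s => [:: r s * cos (t s / 2) * cos ((q s + p s) / 2);
   r s * cos (t s / 2) * sin ((q s + p s) / 2); r s * sin (t s / 2) * cos ((q s - p s) / 2);
   r s * sin (t s / 2) * sin ((q s - p s) / 2)]`_m).
  by apply/funext => z; rewrite mxE.
have dx : derivable x s 1.
  apply/derivable_mxP => i m; rewrite ord1 xE.
  by case: m => [[|[|[|[|//]]]] hm] /=; [case: d0|case: d1|case: d2|case: d3].
rewrite -(fubini_study_euler_vector (r s) (t s) (p s) (q s) dr dt dp dq).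
suff -> : derive1 x s = \row_(m < 4) [:: dr * cos (t s/2) * cos ((q s + p s) / 2) - r s * sin (t s/2) * dt/2 * cos ((q s + p s) / 2) - r s * cos (t s/2) * sin ((q s + p s) / 2) * ((dq+dp)/2);
  dr * cos (t s/2) * sin ((q s + p s) / 2) - r s * sin (t s/2) * dt/2 * sin ((q s + p s) / 2) + r s * cos (t s/2) * cos ((q s + p s) / 2) * ((dq+dp)/2);
  dr * sin (t s/2) * cos ((q s - p s) / 2) + r s * cos (t s/2) * dt/2 * cos ((q s - p s) / 2) - r s * sin (t s/2) * sin ((q s - p s) / 2) * ((dq-dp)/2);
  dr * sin (t s/2) * sin ((q s - p s) / 2) + r s * cos (t s/2) * dt/2 * sin ((q s - p s) / 2) + r s * sin (t s/2) * cos ((q s - p s) / 2) * ((dq-dp)/2)]`_m by [].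
rewrite derive1E derive_mx //; apply/rowP => m; rewrite !mxE xE.
by case: m => [[|[|[|[|//]]]] hm] /=; apply: derive_val.
Qed.

End ProjectivePlane.

(* Main.v *)
(* A curve in CP^2 lifts to C^3 as Z' = k Z + U, U' = k U + A - Z, where U and A
   are the horizontal lifts of its unit velocity and of its acceleration and k
   is the connection form.  As the metric is Einstein, the conformal geodesic
   equation says exactly that A' = k A - |A|^2 U - <A, U> Z (for |Z| = 1); this
   is covariant under Z -> nu Z W with nu a nonvanishing function and W unitary.
   Consequently the traceless skew-Hermitian matrix
     K = z^* u - u^* z + u^* a - a^* u - i alpha (1 - z^* z),   i alpha = <a, u>,
   which does not depend on the lift, is constant along a conformal geodesic,
   and the projector P on the line of the curve solves P' = [P, K]: the curve is
   an orbit of a one-parameter group.  Up to the unitary group the pair (P, K)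
   at one point is determined by the two numbers alpha and |a|^2.

   The curves of the two families are orbits of the same kind, with
     alpha = gamma (1 + r^2 - 2 gamma^2 r^2) / r,
     |a|^2 = 1 / r^2 - 2 gamma^2 + gamma^2 r^2,
   where gamma = 1 for the trajectories of d/dpsi.  Every pair (alpha, |a|^2)
   with alpha^2 <= |a|^2 is reached, gamma = 1 being used when equality holds,
   so that each conformal geodesic is unitarily congruent to a member of the
   families; c2 = 0 and c3 = 2 suffice, and make the formulas regular for all
   s. *)
From HB Require Import structures.
From mathcomp Require Import all_boot all_order all_algebra.
From mathcomp Require Import complex generic_quotient.
From mathcomp Require Import all_classical all_reals all_analysis.
From mathcomp Require Import ring lra.
Require Import Defs.

Set Implicit Arguments.
Unset Strict Implicit.
Unset Printing Implicit Defensive.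

Import Order.TTheory GRing.Theory Num.Theory.
Import numFieldNormedType.Exports.

Local Open Scope classical_set_scope.
Local Open Scope ring_scope.

(** * The Christoffel symbols and the Ricci tensor of the Fubini-Study metric *)

(** The frame [U], [A], [k] exists only chart by chart, while the conclusion concerns a whole
    interval. Lift-independence of the generator does the gluing: near each time it is the generator
    of one frame, so its derivative vanishes there, and the interval makes it constant. No
    exponential of [K] is formed. The given curve and the transported model solve the same equation
    P' = [P, K] and agree at one time; their difference D is Hermitian and tr(D^2) is conserved,
    hence D = 0. The model curves are never shown to be conformal geodesics by computing their
    acceleration in a chart: once congruent to the given curve, a model is its image under the
    inverse unitary map and inherits the equation. Only first-order kinematics of the models enter:
    r constant, sigma_1 + i sigma_2 = 2 p e^(-i x), sigma_3 = 2 gamma (1 + r^2) / r. A unitary frame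
    built from the Euler angles then moves with constant coefficients. The rate x' = 3 gamma r is
    three times the connection form gamma r (up to i), which is what makes the generator traceless.
    Finding r and gamma for a given pair of invariants amounts to a root of a cubic, located by the
    intermediate value theorem. *)

Section RealDerivatives.
Context (R : realType) (V : normedModType R).
Implicit Types (f g : V -> R) (x v : V).

Lemma is_derive_add f g x v df dg : is_derive x v f df -> is_derive x v g dg ->
  is_derive x v (fun y => f y + g y) (df + dg).
Proof. by move=> hf hg; exact: is_deriveD. Qed.

Lemma is_derive_opp f x v df : is_derive x v f df ->
  is_derive x v (fun y => - f y) (- df).
Proof. by move=> hf; exact: is_deriveN. Qed.

Lemma is_derive_mul f g x v df dg : is_derive x v f df -> is_derive x v g dg ->
  is_derive x v (fun y => f y * g y) (df * g x + f x * dg).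
Proof.
move=> hf hg; apply: (is_derive_eq (is_deriveM hf hg)).
by rewrite /GRing.scale /= addrC mulrC.
Qed.

Lemma is_derive_inv f x v df : f x != 0 -> is_derive x v f df ->
  is_derive x v (fun y => (f y)^-1) (- (df / f x ^+ 2)).
Proof.
move=> fx0 hf; apply: DeriveDef; first by apply: derivableV.
by rewrite deriveV // derive_val /GRing.scale /= mulNr mulrC.
Qed.

Lemma is_derive_const (c : R) x v : is_derive x v (fun _ : V => c) 0.
Proof. exact: is_derive_cst. Qed.

Lemma is_derive_bigsum n (f : 'I_n -> V -> R) x v df :
  (forall i, is_derive x v (f i) (df i)) ->
  is_derive x v (fun y => \sum_i f i y) (\sum_i df i).
Proof.
move=> hf; have -> : (fun y => \sum_i f i y) = \sum_i f i.
  by apply/funext => y; rewrite fct_sumE.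
exact: is_derive_sum.
Qed.

End RealDerivatives.

Section FubiniStudy.
Context (R : realType).
Local Notation V := 'rV[R]_4.
Implicit Types x v : V.

Lemma is_derive_entry n (x v : 'rV[R]_n.+1) (i : 'I_n.+1) :
  is_derive x v (fun y : 'rV[R]_n.+1 => y ord0 i) (v ord0 i).
Proof.
have dx : derivable (@idfun 'rV[R]_n.+1) x v by exact: derivable_id.
have d : derivable (fun y : 'rV[R]_n.+1 => y ord0 i) x v.
  by move/derivable_mxP: dx; apply.
apply: DeriveDef => //.
have := derive_mx dx; rewrite derive_id => /rowP /(_ i); rewrite mxE => ->.
by [].
Qed.

Lemma is_derive_mulI x v (i : 'I_4) :
  is_derive x v (fun y => mulI y ord0 i) (mulI v ord0 i).
Proof.
rewrite mxE; under eq_fun do rewrite mxE.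
case: ifP => _; first exact: is_derive_entry.
exact/is_derive_opp/is_derive_entry.
Qed.

Definition fsN x : R := 1 + \sum_m x ord0 m ^+ 2.

Lemma fsN_gt0 x : 0 < fsN x.
Proof. by rewrite ltr_pwDl // sumr_ge0 // => i _; rewrite sqr_ge0. Qed.

Lemma fsN_neq0 x : fsN x != 0. Proof. by rewrite gt_eqF ?fsN_gt0. Qed.

Lemma is_derive_fsN x v :
  is_derive x v fsN (2 * \sum_m x ord0 m * v ord0 m).
Proof.
rewrite /fsN; apply: is_derive_eq.
  apply: is_derive_add.
  apply: is_derive_bigsum => i.
  apply: (is_derive_mul (is_derive_entry _ _ _) (is_derive_entry _ _ _)).
rewrite add0r mulr_sumr; apply: eq_bigr => i _; ring.
Qed.

Definition fs_deriv x v (j l : 'I_4) : R :=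
  let s := 2 * \sum_m x ord0 m * v ord0 m in
  let y := mulI x in let w := mulI v in
  - (s / fsN x ^+ 2 * (j == l)%:R)
  + 2 * s / fsN x ^+ 3 * (x ord0 j * x ord0 l + y ord0 j * y ord0 l)
  - (v ord0 j * x ord0 l + x ord0 j * v ord0 l
     + w ord0 j * y ord0 l + y ord0 j * w ord0 l) / fsN x ^+ 2.

Lemma is_derive_fubini_study x v j l :
  is_derive x v (fun y => fubini_study y j l) (fs_deriv x v j l).
Proof.
have -> : (fun y => fubini_study y j l) = fun y =>
   (fsN y)^-1 * (j == l)%:R - (fsN y * fsN y)^-1 *
     (y ord0 j * y ord0 l + mulI y ord0 j * mulI y ord0 l).
  apply/funext => y; rewrite /fubini_study -/(fsN y) 3!mxE.
  rewrite [X in _ + X = _]mxE [X in - X]mxE [X in _ - _ * X]mxE.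
  by rewrite !mxE !big_ord1 !mxE expr2.
have N0 := fsN_neq0 x.
apply: is_derive_eq.
  apply: is_derive_add; last apply: is_derive_opp.
    apply: is_derive_mul.
    by apply: is_derive_inv => //; exact: is_derive_fsN.
  apply: is_derive_mul.
    apply: is_derive_inv; first by rewrite mulf_neq0.
    by apply: is_derive_mul; exact: is_derive_fsN.
  by apply: is_derive_add; apply: is_derive_mul;
    (exact: is_derive_entry || exact: is_derive_mulI).
rewrite /fs_deriv; move: (\sum_m _) => s; field.
by rewrite N0.
Qed.


(** Naming the four entries of a point turns each tensor identity below into finitely many rational
    identities, one for each choice of indices, that [field] can settle. *)
Definition row4 (a b c d : R) : V := \row_(m < 4) [:: a; b; c; d]`_m.

Lemma row4E x : x = row4 (x ord0 (inord 0)) (x ord0 (inord 1))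
  (x ord0 (inord 2)) (x ord0 (inord 3)).
Proof.
apply/rowP => -[[|[|[|[|//]]]] h]; rewrite mxE /=; congr (x _ _);
  by apply/val_inj; rewrite /= inordK.
Qed.

Lemma mulI_row4 a b c d : mulI (row4 a b c d) = row4 (- b) a (- d) c.
Proof.
by apply/rowP => -[[|[|[|[|//]]]] h]; rewrite !mxE /= ?inordK.
Qed.

Lemma fsN_row4 a b c d :
  fsN (row4 a b c d) = 1 + (a ^+ 2 + b ^+ 2 + c ^+ 2 + d ^+ 2).
Proof. by rewrite /fsN !big_ord_recl big_ord0 !mxE /= !addrA addr0. Qed.

(** An entry of x^T x + (i x)^T (i x), the part of the metric and of its inverse that is not a
    multiple of the identity. *)
Definition quad (a b c d : R) (i j : 'I_4) : R :=
  [:: a; b; c; d]`_i * [:: a; b; c; d]`_j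
  + [:: - b; a; - d; c]`_i * [:: - b; a; - d; c]`_j.

(** The vectors x and i x are orthogonal of squared length N - 1. The metric is therefore N^-2 on
    the plane that they span and N^-1 on its complement, and the inverse is N (1 + (N - 1)) on the
    plane and N on the complement. *)
Definition fs_inv x : 'M[R]_4 :=
  fsN x *: (1%:M + (x^T *m x + (mulI x)^T *m mulI x)).

Lemma fubini_study_row4 a b c d i j :
  fubini_study (row4 a b c d) i j =
  (fsN (row4 a b c d))^-1 * (i == j)%:R
  - (fsN (row4 a b c d) ^+ 2)^-1 * quad a b c d i j.
Proof.
rewrite /fubini_study -/(fsN _) mulI_row4 !mxE.
by rewrite !big_ord1 !mxE.
Qed.

Lemma fs_inv_row4 a b c d i j :
  fs_inv (row4 a b c d) i j =
  fsN (row4 a b c d) * ((i == j)%:R + quad a b c d i j).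
Proof. by rewrite /fs_inv mulI_row4 !mxE !big_ord1 !mxE. Qed.

Lemma fubini_study_mulV x : fubini_study x *m fs_inv x = 1%:M.
Proof.
rewrite (row4E x); move: (x _ _) (x _ _) (x _ _) (x _ _) => d c b a.
apply/matrixP => i j; rewrite !mxE !big_ord_recl big_ord0.
rewrite !fubini_study_row4 !fs_inv_row4.
have := fsN_neq0 (row4 a b c d); rewrite fsN_row4 => N0.
rewrite /quad /=; move: i j => -[[|[|[|[|//]]]] hi] -[[|[|[|[|//]]]] hj] /=;
by field.
Qed.

Lemma invmx_fubini_study x : invmx (fubini_study x) = fs_inv x.
Proof.
have [gu _] := mulmx1_unit (fubini_study_mulV x).
by rewrite -[LHS]mulmx1 -(fubini_study_mulV x) mulmxA mulVmx // mul1mx.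
Qed.

Definition cplx_str (i j : 'I_4) : R :=
  (nth [::] [:: [:: 0; 1; 0; 0]; [:: -1; 0; 0; 0];
                [:: 0; 0; 0; 1]; [:: 0; 0; -1; 0]] i)`_j.

Lemma mulI_delta i j : mulI (delta_mx ord0 i) ord0 j = cplx_str i j.
Proof.
rewrite /mulI /cplx_str !mxE; case: i j => -[|[|[|[|//]]]] hi;
  by case=> -[|[|[|[|//]]]] hj; rewrite /= -?val_eqE /= ?inordK ?oppr0.
Qed.

(** Contracted with u and v this is the connection - (<u, x> v + <v, x> u) / N of a Kähler metric:
    the real parts of the Hermitian products give the terms in x, the imaginary parts those in
    [mulI x]. *)
Definition fs_christoffel x k i j : R :=
  let y := mulI x in
  - (x ord0 i * (j == k)%:R + x ord0 j * (i == k)%:R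
     + y ord0 i * cplx_str j k + y ord0 j * cplx_str i k) / fsN x.

Lemma christoffel_fubini_study x k i j :
  christoffel (@fubini_study R) x k i j = fs_christoffel x k i j.
Proof.
pose low l i j := 2^-1 * (fs_deriv x (delta_mx ord0 i) j l
  + fs_deriv x (delta_mx ord0 j) i l - fs_deriv x (delta_mx ord0 l) i j).
(* The closed form is compared with the symbols of the first kind, so that only the metric and not
   its inverse enters the case analysis; invertibility then raises the index. *)
have lowE l : \sum_k fubini_study x l k * fs_christoffel x k i j = low l i j.
  rewrite /low /fs_deriv /fs_christoffel !mulI_delta.
  have del (a b : 'I_4) : (delta_mx ord0 a : V) ord0 b = (b == a)%:R.
    by rewrite mxE.
  have sumd (a : 'I_4) :
      \sum_m x ord0 m * (delta_mx ord0 a : V) ord0 m = x ord0 a.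
    rewrite (bigD1 a) //= big1 ?addr0 ?del ?eqxx ?mulr1 // => m /negPf ma.
    by rewrite del ma mulr0.
  rewrite !sumd !del.
  rewrite (row4E x); move: (x _ _) (x _ _) (x _ _) (x _ _) => d c b a.
  rewrite mulI_row4 !big_ord_recl big_ord0 !fubini_study_row4.
  have := fsN_neq0 (row4 a b c d); rewrite fsN_row4 => N0.
  rewrite /quad /cplx_str !mxE /=.
  move: i j l => [[|[|[|[|//]]]] hi] [[|[|[|[|//]]]] hj] [[|[|[|[|//]]]] hl] /=;
  by field.
have -> : christoffel (@fubini_study R) x k i j =
    \sum_l invmx (fubini_study x) k l * low l i j.
  rewrite /christoffel mulr_sumr; apply: eq_bigr => l _.
  rewrite /low /partial mulrCA; congr (_ * (_ * _)).
  by do !congr (_ + _); rewrite ?[in LHS](@derive_val _ _ _ _ _ _ _ (is_derive_fubini_study _ _ _ _)).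
pose M : 'cV[R]_4 := \col_k fs_christoffel x k i j.
have LM : \col_l low l i j = fubini_study x *m M.
  by apply/colP => l; rewrite !mxE -lowE; apply: eq_bigr => m _; rewrite !mxE.
have [gu _] := mulmx1_unit (fubini_study_mulV x).
transitivity ((invmx (fubini_study x) *m (fubini_study x *m M)) k ord0).
  by rewrite -LM mxE; apply: eq_bigr => m _; rewrite !mxE.
by rewrite mulKmx // mxE.
Qed.

Definition fs_christoffel_num x k i j : R :=
  x ord0 i * (j == k)%:R + x ord0 j * (i == k)%:R
  + mulI x ord0 i * cplx_str j k + mulI x ord0 j * cplx_str i k.

Definition fs_christoffel_num_deriv a k i j : R :=
  (i == a)%:R * (j == k)%:R + (j == a)%:R * (i == k)%:R
  + cplx_str a i * cplx_str j k + cplx_str a j * cplx_str i k.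

Lemma partial_christoffel x a k i j :
  partial a (fun y => christoffel (@fubini_study R) y k i j) x =
  - fs_christoffel_num_deriv a k i j / fsN x
  + 2 * x ord0 a * fs_christoffel_num x k i j / fsN x ^+ 2.
Proof.
have -> : (fun y => christoffel (@fubini_study R) y k i j) =
    fun y => - (fs_christoffel_num y k i j * (fsN y)^-1).
  by apply/funext => y; rewrite christoffel_fubini_study /fs_christoffel mulNr.
pose u := delta_mx ord0 a : V.
have sumd : \sum_m x ord0 m * u ord0 m = x ord0 a.
  rewrite (bigD1 a) //= big1 ?addr0 ?mxE ?eqxx ?mulr1 // => m /negPf ma.
  by rewrite mxE ma mulr0.
have num : is_derive x u (fun y => fs_christoffel_num y k i j)
    (fs_christoffel_num_deriv a k i j).
  apply: is_derive_eq.
    apply: is_derive_add; first apply: is_derive_add; first apply: is_derive_add;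
      apply: is_derive_mul;
      (exact: is_derive_entry || exact: is_derive_mulI || exact: is_derive_const).
  by rewrite /fs_christoffel_num_deriv !mulr0 !addr0 !mulI_delta !mxE /=.
have den : is_derive x u (fun y => (fsN y)^-1) (- (2 * x ord0 a / fsN x ^+ 2)).
  by rewrite -sumd; exact: is_derive_inv (fsN_neq0 x) (is_derive_fsN x u).
rewrite /partial; apply: (@derive_val).
have := is_derive_opp (is_derive_mul num den) => /is_derive_eq; apply.
by ring.
Qed.

(** The Einstein constant 6 is the Ricci scalar 24 divided by the real dimension 4. *)
Lemma ricci_fubini_study x : ricci (@fubini_study R) x = 6 *: fubini_study x.
Proof.
apply/matrixP => i j; rewrite [LHS]mxE [RHS]mxE.
under eq_bigr => k _.
  rewrite !partial_christoffel.
  under eq_bigr => m _ do rewrite !christoffel_fubini_study.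
  over.
rewrite (row4E x); move: (x _ _) (x _ _) (x _ _) (x _ _) => d c b a.
rewrite /fs_christoffel /fs_christoffel_num /fs_christoffel_num_deriv.
rewrite !big_ord_recl !big_ord0 fubini_study_row4 mulI_row4.
have := fsN_neq0 (row4 a b c d); rewrite fsN_row4 => N0.
rewrite /quad /cplx_str !mxE.
by move: i j => [[|[|[|[|//]]]] hi] [[|[|[|[|//]]]] hj] /=; field.
Qed.

Lemma schouten_fubini_study x :
  exists mu, schouten (@fubini_study R) x = mu *: fubini_study x.
Proof.
rewrite /schouten ricci_fubini_study -scalerBl scalerA; eexists; reflexivity.
Qed.

(** For a Schouten tensor mu g and unit speed, - L(u, u) u = - mu u cancels against the sharp term
    mu u, whatever mu is. *)
Lemma conformal_geodesic_eq_fubini_study (c : R -> V) s :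
  pairing (fubini_study (c s)) (velocity c s) (velocity c s) = 1 ->
  let a := acceleration (@fubini_study R) c in
  conformal_geodesic_eq (@fubini_study R) c s <->
  cov_derive (@fubini_study R) c a s =
    - pairing (fubini_study (c s)) (a s) (a s) *: velocity c s.
Proof.
move=> unit a; rewrite /conformal_geodesic_eq /schouten_sharp.
have [mu ->] := schouten_fubini_study (c s).
set u := velocity c s in unit *.
have -> : pairing (mu *: fubini_study (c s)) u u = mu.
  by rewrite /pairing -scalemxAr -scalemxAl mxE [X in _ * X]unit mulr1.
rewrite -scalemxAr -scalemxAl -mulmxA invmx_fubini_study fubini_study_mulV mulmx1.
by rewrite -/a opprD scalerDl -addrA -scalerDl addNr scale0r addr0.
Qed.

End FubiniStudy.

Arguments cplx_str {R}.

(** * Complex-valued maps and adjoint matrices *)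

Lemma derive0_constant (R : realType) (I : set R) (f : R -> R) (s t : R) :
  is_interval I -> (forall x, I x -> is_derive x 1 f 0) ->
  I s -> I t -> f s = f t.
Proof.
move=> itv f0; wlog st : s t / s <= t => [H Is It|Is It].
  by case: (leP s t) => [/H|/ltW /H] e; [exact: e|exact/esym/e].
have Ix x : x \in `[s, t]%R -> I x by rewrite in_itv /=; exact: itv.
have fx x : x \in `]s, t[%R -> is_derive x 1 f 0.
  by move=> xst; apply/f0/Ix; exact: subset_itv_oo_cc.
have [|x _] := MVT_segment st fx.
  apply: derivable_within_continuous => x /Ix /f0 h; exact: ex_derive.
by rewrite mul0r => /eqP; rewrite subr_eq0 => /eqP ->.
Qed.

(* [R[i]] carries no normed module structure over [R], so complex-valued maps
   are differentiated through their real and imaginary parts. *)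
Section ComplexDerivatives.
Context (R : realType) (V : normedModType R).
Local Notation C := R[i].
Implicit Types (x v : V) (f g : V -> C) (d e : C).

Definition cderiv f x v d : Prop :=
  is_derive x v (fun y => complex.Re (f y)) (complex.Re d) /\
  is_derive x v (fun y => complex.Im (f y)) (complex.Im d).

Lemma cderiv_eq f x v d e : cderiv f x v d -> d = e -> cderiv f x v e.
Proof. by move=> ? <-. Qed.

Lemma cderiv_uniq f x v d e : cderiv f x v d -> cderiv f x v e -> d = e.
Proof.
move=> [h1 h2] [h3 h4]; apply/eqP; rewrite eq_complex.
by rewrite -(@derive_val _ _ _ _ _ _ _ h1) -(@derive_val _ _ _ _ _ _ _ h2)
  -(@derive_val _ _ _ _ _ _ _ h3) -(@derive_val _ _ _ _ _ _ _ h4) !eqxx.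
Qed.

Lemma cderiv_near f g x v d : (\near x, f x = g x) ->
  cderiv f x v d -> cderiv g x v d.
Proof.
move=> fg [h1 h2]; split.
  by apply: near_eq_is_derive h1; near do congr complex.Re.
by apply: near_eq_is_derive h2; near do congr complex.Im.
Unshelve. all: by end_near. Qed.

Lemma cderiv_const c x v : cderiv (fun=> c) x v 0.
Proof. by split; exact: is_derive_const. Qed.

Lemma cderivD f g x v d e : cderiv f x v d -> cderiv g x v e ->
  cderiv (fun y => f y + g y) x v (d + e).
Proof.
have Rd (a b : C) : complex.Re (a + b) = complex.Re a + complex.Re b.
  by case: a b => ? ? [].
have Id (a b : C) : complex.Im (a + b) = complex.Im a + complex.Im b.
  by case: a b => ? ? [].
move=> [h1 h2] [h3 h4]; split; rewrite ?(Rd, Id);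
  [under eq_fun do rewrite Rd|under eq_fun do rewrite Id];
  exact: is_derive_add.
Qed.

Lemma cderivM f g x v d e : cderiv f x v d -> cderiv g x v e ->
  cderiv (fun y => f y * g y) x v (d * g x + f x * e).
Proof.
have Rm (a b : C) : complex.Re (a * b) =
    complex.Re a * complex.Re b + - (complex.Im a * complex.Im b).
  by case: a b => ? ? [].
have Im (a b : C) : complex.Im (a * b) =
    complex.Re a * complex.Im b + complex.Im a * complex.Re b.
  by case: a b => ? ? [].
move=> [h1 h2] [h3 h4]; split.
  under eq_fun do rewrite Rm.
  apply: (is_derive_eq (is_derive_add (is_derive_mul h1 h3)
    (is_derive_opp (is_derive_mul h2 h4)))).
  by case: d (f x) (g x) e {h1 h2 h3 h4} => ? ? [? ?] [? ?] [? ?] /=; ring.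
under eq_fun do rewrite Im.
apply: (is_derive_eq (is_derive_add (is_derive_mul h1 h4) (is_derive_mul h2 h3))).
by case: d (f x) (g x) e {h1 h2 h3 h4} => ? ? [? ?] [? ?] [? ?] /=; ring.
Qed.

Lemma cderivN f x v d : cderiv f x v d -> cderiv (fun y => - f y) x v (- d).
Proof.
move=> h; have := cderivM (cderiv_const (-1) x v) h.
rewrite mul0r add0r mulN1r.
by under [X in cderiv X]eq_fun do rewrite mulN1r.
Qed.

Lemma cderivB f g x v d e : cderiv f x v d -> cderiv g x v e ->
  cderiv (fun y => f y - g y) x v (d - e).
Proof. by move=> h /cderivN; exact: cderivD. Qed.

Lemma cderiv_conj f x v d : cderiv f x v d ->
  cderiv (fun y => conjc (f y)) x v (conjc d).
Proof.
have Rd (a : C) : complex.Re (conjc a) = complex.Re a by case: a.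
have Id (a : C) : complex.Im (conjc a) = - complex.Im a by case: a.
move=> [h1 h2]; split; rewrite ?(Rd, Id).
  by under eq_fun do rewrite Rd.
by under eq_fun do rewrite Id; exact: is_derive_opp.
Qed.

Lemma cderivV f x v d : f x != 0 -> cderiv f x v d ->
  cderiv (fun y => (f y)^-1) x v (- (d / f x ^+ 2)).
Proof.
move=> fx0 h; have [h1 h2] := h.
pose n (z : C) := complex.Re z * complex.Re z + complex.Im z * complex.Im z.
have n0 : n (f x) != 0.
  rewrite /n -!expr2 paddr_eq0 ?sqr_ge0 // !expf_eq0 /=.
  by move: fx0; rewrite eq_complex.
have dn : is_derive x v (fun y => (n (f y))^-1) (- (2 * (complex.Re (f x) * complex.Re d
     + complex.Im (f x) * complex.Im d) / n (f x) ^+ 2)).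
  have dn := is_derive_add (is_derive_mul h1 h1) (is_derive_mul h2 h2).
  apply: (is_derive_eq (is_derive_inv (f := fun y => n (f y)) n0 dn)).
  by congr (- (_ / _)); ring.
have Rv (z : C) : complex.Re z^-1 = complex.Re z * (n z)^-1 by case: z.
have Iv (z : C) : complex.Im z^-1 = - complex.Im z * (n z)^-1.
  by case: z => a b; rewrite /= mulNr.
(* Existence comes from the real formulas for the inverse; the value is found afterwards by
   differentiating f f^-1 f = f. *)
have [e he] : exists e, cderiv (fun y => (f y)^-1) x v e.
  eexists (Complex _ _); split.
    by under eq_fun do rewrite Rv; exact: (is_derive_mul h1 dn).
  by under eq_fun do rewrite Iv; exact: (is_derive_mul (is_derive_opp h2) dn).
apply: (cderiv_eq he).
have fe : cderiv (fun y => f y * (f y)^-1 * f y) x v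
   ((d * (f x)^-1 + f x * e) * f x + f x * (f x)^-1 * d).
  by apply: cderivM => //; apply: cderivM.
(* With the convention 0^-1 = 0 this holds also at the zeros of [f], so no neighbourhood where [f]
   is nonzero has to be chosen. *)
have E : (fun y => f y * (f y)^-1 * f y) = f.
  apply/funext => y; have [->|fy] := eqVneq (f y) 0; first by rewrite mulr0.
  by rewrite divff ?mul1r.
rewrite E in fe; have := cderiv_uniq fe h => /(canRL (addrK _)).
rewrite divff // mul1r subrr => /eqP; rewrite mulf_eq0 (negPf fx0) orbF.
rewrite addrC addr_eq0 => /eqP {}E.
by apply: (mulfI fx0); rewrite E; field.
Qed.

Lemma cderiv_sum n (f : 'I_n -> V -> C) x v (d : 'I_n -> C) :
  (forall i, cderiv (f i) x v (d i)) ->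
  cderiv (fun y => \sum_i f i y) x v (\sum_i d i).
Proof.
move=> h.
elim: n => [|n IH] in f d h *.
  rewrite big_ord0; under [X in cderiv X]eq_fun do rewrite big_ord0.
  exact: cderiv_const.
rewrite big_ord_recl; under [X in cderiv X]eq_fun do rewrite big_ord_recl.
by apply: cderivD => //; apply: IH.
Qed.

Section Matrices.
Implicit Types m n p : nat.

Definition mxderiv m n (M : V -> 'M[C]_(m, n)) x v (D : 'M[C]_(m, n)) : Prop :=
  forall i j, cderiv (fun y => M y i j) x v (D i j).

Lemma mxderiv_eq m n (M : V -> 'M[C]_(m, n)) x v D E :
  mxderiv M x v D -> D = E -> mxderiv M x v E.
Proof. by move=> ? <-. Qed.

Lemma mxderiv_uniq m n (M : V -> 'M[C]_(m, n)) x v D E :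
  mxderiv M x v D -> mxderiv M x v E -> D = E.
Proof. by move=> h1 h2; apply/matrixP => i j; exact: cderiv_uniq. Qed.

Lemma mxderiv_near m n (M N : V -> 'M[C]_(m, n)) x v D :
  (\near x, M x = N x) -> mxderiv M x v D -> mxderiv N x v D.
Proof.
move=> MN h i j; apply: cderiv_near (h i j).
by apply: filterS MN => y ->.
Qed.

Lemma mxderiv_const m n (M : 'M[C]_(m, n)) x v : mxderiv (fun=> M) x v 0.
Proof. by move=> i j; rewrite mxE; exact: cderiv_const. Qed.

Lemma mxderivD m n (M N : V -> 'M[C]_(m, n)) x v D E :
  mxderiv M x v D -> mxderiv N x v E ->
  mxderiv (fun y => M y + N y) x v (D + E).
Proof.
move=> h k i j; rewrite mxE.
by under [X in cderiv X]eq_fun do rewrite mxE; exact: cderivD.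
Qed.

Lemma mxderivN m n (M : V -> 'M[C]_(m, n)) x v D :
  mxderiv M x v D -> mxderiv (fun y => - M y) x v (- D).
Proof.
move=> h i j; rewrite mxE.
by under [X in cderiv X]eq_fun do rewrite mxE; exact: cderivN.
Qed.

Lemma mxderivB m n (M N : V -> 'M[C]_(m, n)) x v D E :
  mxderiv M x v D -> mxderiv N x v E ->
  mxderiv (fun y => M y - N y) x v (D - E).
Proof. by move=> h /mxderivN; exact: mxderivD. Qed.

Lemma mxderivZ m n (a : V -> C) (M : V -> 'M[C]_(m, n)) x v d D :
  cderiv a x v d -> mxderiv M x v D ->
  mxderiv (fun y => a y *: M y) x v (d *: M x + a x *: D).
Proof.
move=> h k i j; rewrite !mxE.
by under [X in cderiv X]eq_fun do rewrite mxE; exact: cderivM.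
Qed.

Lemma mxderivM m n p (M : V -> 'M[C]_(m, n)) (N : V -> 'M[C]_(n, p)) x v D E :
  mxderiv M x v D -> mxderiv N x v E ->
  mxderiv (fun y => M y *m N y) x v (D *m N x + M x *m E).
Proof.
move=> h k i j; rewrite !mxE -big_split.
under [X in cderiv X]eq_fun do rewrite mxE.
by apply: cderiv_sum => l; exact: cderivM.
Qed.

End Matrices.

End ComplexDerivatives.

(** * Adjoint matrices and the Hermitian product, linear in its first argument *)

Section Adjoint.
Context (R : realType).
Local Notation C := R[i].

Definition adj m n (M : 'M[C]_(m, n)) : 'M[C]_(n, m) := (map_mx conjc M)^T.

Lemma adjE m n (M : 'M[C]_(m, n)) i j : adj M i j = conjc (M j i).
Proof. by rewrite !mxE. Qed.

Lemma adjK m n (M : 'M[C]_(m, n)) : adj (adj M) = M.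
Proof. by apply/matrixP => i j; rewrite !adjE conjcK. Qed.

Lemma adjM m n p (M : 'M[C]_(m, n)) (N : 'M[C]_(n, p)) :
  adj (M *m N) = adj N *m adj M.
Proof. by rewrite /adj map_mxM trmx_mul. Qed.

Lemma adjD m n (M N : 'M[C]_(m, n)) : adj (M + N) = adj M + adj N.
Proof. by rewrite /adj map_mxD linearD. Qed.

Lemma adjN m n (M : 'M[C]_(m, n)) : adj (- M) = - adj M.
Proof. by rewrite /adj map_mxN linearN. Qed.

Lemma adjB m n (M N : 'M[C]_(m, n)) : adj (M - N) = adj M - adj N.
Proof. by rewrite adjD adjN. Qed.

Lemma adjZ m n a (M : 'M[C]_(m, n)) : adj (a *: M) = conjc a *: adj M.
Proof. by rewrite /adj map_mxZ linearZ. Qed.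

Lemma adj1 n : adj (1%:M : 'M[C]_n) = 1%:M.
Proof. by rewrite /adj map_mx1 trmx1. Qed.

Lemma mxderiv_adj (V : normedModType R) m n (M : V -> 'M[C]_(m, n)) x v D :
  mxderiv M x v D -> mxderiv (fun y => adj (M y)) x v (adj D).
Proof.
move=> h i j; rewrite adjE.
by under [X in cderiv X]eq_fun do rewrite adjE; exact: cderiv_conj.
Qed.

Definition herm n (v w : 'rV[C]_n) : C := (v *m adj w) ord0 ord0.

Lemma mul_adj n (v w : 'rV[C]_n) : v *m adj w = (herm v w)%:M.
Proof. exact: mx11_scalar. Qed.

Lemma hermE n (v w : 'rV[C]_n) :
  herm v w = \sum_i v ord0 i * conjc (w ord0 i).
Proof. by rewrite /herm mxE; apply: eq_bigr => i _; rewrite adjE. Qed.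

Lemma hermC n (v w : 'rV[C]_n) : herm v w = conjc (herm w v).
Proof. by rewrite /herm -[v in LHS]adjK -adjM adjE. Qed.

Lemma hermDl n (v w u : 'rV[C]_n) : herm (v + w) u = herm v u + herm w u.
Proof. by rewrite /herm mulmxDl mxE. Qed.

Lemma hermZl n a (v u : 'rV[C]_n) : herm (a *: v) u = a * herm v u.
Proof. by rewrite /herm -scalemxAl mxE. Qed.

Lemma hermNl n (v u : 'rV[C]_n) : herm (- v) u = - herm v u.
Proof. by rewrite /herm mulNmx mxE. Qed.

Lemma hermDr n (v w u : 'rV[C]_n) : herm u (v + w) = herm u v + herm u w.
Proof. by rewrite /herm adjD mulmxDr mxE. Qed.

Lemma hermZr n a (v u : 'rV[C]_n) : herm u (a *: v) = conjc a * herm u v.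
Proof. by rewrite /herm adjZ -scalemxAr mxE. Qed.

Lemma hermNr n (v u : 'rV[C]_n) : herm u (- v) = - herm u v.
Proof. by rewrite /herm adjN mulmxN mxE. Qed.

Lemma herm_mulmx n (U : 'M[C]_n) (v w : 'rV[C]_n) :
  U *m adj U = 1%:M -> herm (v *m U) (w *m U) = herm v w.
Proof. by move=> UU; rewrite /herm adjM mulmxA -(mulmxA v) UU mulmx1. Qed.

Definition norm2 n (v : 'rV[C]_n) : R := complex.Re (herm v v).

Lemma herm_norm2 n (v : 'rV[C]_n) : herm v v = (norm2 v)%:C%C.
Proof.
rewrite /norm2; have := hermC v v; case: (herm v v) => a b /= [].
by move=> /eqP; rewrite -addr_eq0 -mulr2n mulrn_eq0 /= => /eqP ->.
Qed.

Lemma norm2E n (v : 'rV[C]_n) : norm2 v =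
  \sum_i (complex.Re (v ord0 i) ^+ 2 + complex.Im (v ord0 i) ^+ 2).
Proof.
apply: (@complexI R); rewrite -herm_norm2 hermE rmorph_sum.
apply: eq_bigr => i _; case: (v _ _) => a b.
by apply/eqP; rewrite eq_complex /=; apply/andP; split; apply/eqP; ring.
Qed.

Lemma norm2_eq0 n (v : 'rV[C]_n) : (norm2 v == 0) = (v == 0).
Proof.
apply/idP/eqP => [|->]; last by rewrite /norm2 /herm mul0mx mxE.
rewrite norm2E psumr_eq0 => [/allP h|i _]; last by rewrite addr_ge0 ?sqr_ge0.
apply/rowP => i; have := h i (mem_index_enum _); rewrite mxE /=.
rewrite paddr_eq0 ?sqr_ge0 // !expf_eq0 /= => /andP[/eqP h1 /eqP h2].
by apply/eqP; rewrite eq_complex h1 h2 !eqxx.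
Qed.

Lemma norm2_ge0 n (v : 'rV[C]_n) : 0 <= norm2 v.
Proof. by rewrite norm2E sumr_ge0 // => i _; rewrite addr_ge0 ?sqr_ge0. Qed.

Lemma herm_neq0 n (v : 'rV[C]_n) : v != 0 -> herm v v != 0.
Proof. by rewrite -norm2_eq0 herm_norm2 eq_complex /= eqxx andbT. Qed.

End Adjoint.

Lemma cderiv_herm (R : realType) (V : normedModType R) n
    (f g : V -> 'rV[R[i]]_n) x v d e :
  mxderiv f x v d -> mxderiv g x v e ->
  cderiv (fun y => herm (f y) (g y)) x v (herm d (g x) + herm (f x) e).
Proof.
by move=> h k; have := mxderivM h (mxderiv_adj k) => /(_ ord0 ord0); rewrite mxE.
Qed.

Lemma mxderiv0_constant (R : realType) m n (I : set R) (M : R -> 'M[R[i]]_(m, n))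
    (s t : R) :
  is_interval I -> (forall x, I x -> mxderiv M x 1 0) ->
  I s -> I t -> M s = M t.
Proof.
move=> itv M0 Is It; apply/matrixP => i j; apply/eqP.
by rewrite eq_complex; apply/andP; split; apply/eqP;
  [apply: (derive0_constant (f := fun t => complex.Re (M t i j)) itv _ Is It)
  |apply: (derive0_constant (f := fun t => complex.Im (M t i j)) itv _ Is It)];
  move=> x /M0 /(_ i j) []; rewrite mxE.
Qed.

(** * Lifts to C^3 *)

Section AffineLift.
Context (R : realType) (j : 'I_3).
Local Notation C := R[i].
Local Notation V := 'rV[R]_4.
Implicit Types (x v w : V).

(** The linear part of the section [affine_lift] of chart [j]: a curve x in the chart lifts to Z
    with Z' = T x'. It is injective and complex linear for [mulI], so equations between real tangent
    vectors may be checked on their images. *)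
Definition affine_lin v : 'rV[C]_3 := \row_(k < 3)
  if unlift j k is Some l
  then Complex (v ord0 (inord l.*2)) (v ord0 (inord l.*2.+1)) else 0.

Definition affine_lift v : 'rV[C]_3 := \row_(k < 3)
  if unlift j k is Some l
  then Complex (v ord0 (inord l.*2)) (v ord0 (inord l.*2.+1)) else 1.

Local Notation T := affine_lin.
Local Notation Z := affine_lift.

Lemma affine_liftE x : Z x = delta_mx ord0 j + T x.
Proof.
apply/rowP => k; rewrite !mxE /=; case: unliftP => [l ->|->].
  by rewrite eq_sym (negPf (neq_lift _ _)) add0r.
by rewrite eqxx addr0.
Qed.

Lemma affine_lin_j v : T v ord0 j = 0. Proof. by rewrite mxE unlift_none. Qed.
Lemma affine_lift_j v : Z v ord0 j = 1. Proof. by rewrite mxE unlift_none. Qed.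

Lemma affine_lin_lift v (l : 'I_2) : T v ord0 (lift j l) =
  Complex (v ord0 (inord l.*2)) (v ord0 (inord l.*2.+1)).
Proof. by rewrite mxE liftK. Qed.

Lemma affine_linD v w : T (v + w) = T v + T w.
Proof.
by apply/rowP => k; rewrite !mxE; case: unlift => [l|]; rewrite ?addr0 ?mxE.
Qed.

Lemma affine_linZ a v : T (a *: v) = a%:C%C *: T v.
Proof.
apply/rowP => k; rewrite !mxE; case: unlift => [l|]; rewrite ?mulr0 ?mxE //.
by apply/eqP; rewrite eq_complex /=; apply/andP; split; apply/eqP; ring.
Qed.

Lemma affine_lin_mulI v : T (mulI v) = 'i%C *: T v.
Proof.
apply/rowP => k; rewrite !mxE; case: unlift => [l|]; rewrite ?mulr0 //.
have hl : (l.*2.+1 < 4)%N by rewrite -[4%N]/(2.*2) ltn_Sdouble.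
have hl' : (l.*2 < 4)%N by apply: ltn_trans hl.
rewrite !mxE !inordK //= odd_double /=.
by apply/eqP; rewrite eq_complex /=; apply/andP; split; apply/eqP; ring.
Qed.

Lemma affine_lin_inj : injective T.
Proof.
move=> v w /rowP e; apply/rowP => m.
have hm : (m./2 < 2)%N by rewrite ltn_half_double.
have := e (lift j (Ordinal hm)); rewrite !affine_lin_lift /= => -[].
have em : m = if odd m then inord m./2.*2.+1 else inord m./2.*2.
  apply/val_inj; rewrite /= -[in LHS](odd_double_half m).
  have hl : (m./2.*2.+1 < 4)%N by rewrite -[4%N]/(2.*2) ltn_Sdouble.
  by case: odd; rewrite !inordK // ltnW.
have E (y : V) : y ord0 m = y ord0 (if odd m then inord m./2.*2.+1 else inord m./2.*2).
  by congr (y _ _).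
by rewrite 2!E; case: odd.
Qed.

Definition rdot v w : R := \sum_m v ord0 m * w ord0 m.

Lemma sum4 (F : 'I_4 -> R) : \sum_m F m =
  F (inord 0) + F (inord 1) + (F (inord 2) + F (inord 3)).
Proof.
rewrite !big_ord_recl big_ord0 addr0 !addrA.
by congr (_ + _ + _ + _); congr F; apply/val_inj; rewrite /= inordK.
Qed.

Lemma herm_affine_lin v w :
  herm (T v) (T w) = Complex (rdot v w) (rdot v (mulI w)).
Proof.
rewrite hermE (bigD1_ord j) //= affine_lin_j mul0r add0r.
under eq_bigr do rewrite !affine_lin_lift.
rewrite !big_ord_recl big_ord0 addr0 /rdot !sum4 !mxE !inordK //=.
rewrite ?(lift0, bump0) /=.
by apply/eqP; rewrite eq_complex /=; apply/andP; split; apply/eqP; ring.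
Qed.

Lemma herm_lin_lift v x : herm (T v) (Z x) = herm (T v) (T x).
Proof.
rewrite affine_liftE hermDr [X in X + _](_ : _ = 0) ?add0r //.
rewrite hermE (bigD1 j) //= affine_lin_j mul0r add0r big1 // => i /negPf ij.
by rewrite [delta_mx _ _ _ _]mxE eqxx ij conjc0 mulr0.
Qed.

Lemma herm_lift x : herm (Z x) (Z x) = (fsN x)%:C%C.
Proof.
rewrite [X in herm X _]affine_liftE hermDl herm_lin_lift.
rewrite hermE (bigD1 j) //= big1 => [|i /negPf ij]; last first.
  by rewrite !mxE eqxx ij mul0r.
rewrite addr0 affine_lift_j conjc1 mulr1 mxE !eqxx herm_affine_lin /fsN.
apply/eqP; rewrite eq_complex /=; apply/andP; split; apply/eqP.
  by congr (_ + _); apply: eq_bigr => i _; rewrite expr2.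
by rewrite /rdot !sum4 !mxE !inordK //=; ring.
Qed.

Lemma affine_lift_neq0 x : Z x != 0.
Proof.
apply/eqP => /rowP /(_ j); rewrite affine_lift_j mxE => /eqP.
by rewrite oner_eq0.
Qed.

(* The horizontal lift of the tangent vector v at the point x. *)
Definition hcoef x v : C := herm (T v) (Z x) / herm (Z x) (Z x).
Definition hlift x v : 'rV[C]_3 := T v - hcoef x v *: Z x.

Lemma herm_lift_neq0 x : herm (Z x) (Z x) != 0.
Proof. exact/herm_neq0/affine_lift_neq0. Qed.

Lemma hlift_orth x v : herm (hlift x v) (Z x) = 0.
Proof.
by rewrite /hlift hermDl hermNl hermZl /hcoef divfK ?subrr // herm_lift_neq0.
Qed.

Lemma pairing_bilinE (x v w : V) : pairing (fubini_study x) v w =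
  rdot v w / fsN x
  - (rdot v x * rdot w x + rdot v (mulI x) * rdot w (mulI x)) / fsN x ^+ 2.
Proof.
have mm (y z : V) : (y *m z^T) ord0 ord0 = rdot y z.
  by rewrite mxE; apply: eq_bigr => i _; rewrite mxE.
have sq (y : V) : (v *m (y^T *m y) *m w^T) ord0 ord0 = rdot v y * rdot w y.
  rewrite mulmxA -mulmxA mxE big_ord1 !mm; congr (_ * _).
  by apply: eq_bigr => i _; rewrite mulrC.
rewrite /pairing /fubini_study -/(fsN x) mulmxBr mulmxBl.
rewrite -!scalemxAr -!scalemxAl mulmx1 mulmxDr mulmxDl.
have lin (A B D : 'M[R]_1) k l : (k *: A - l *: (B + D)) ord0 ord0 =
  k * A ord0 ord0 - l * (B ord0 ord0 + D ord0 ord0) by rewrite !mxE.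
by rewrite lin !sq mm; ring.
Qed.

(** The metric is the quotient of the Hermitian metric of C^3: only horizontal parts count, and the
    squared length of the unnormalised lift is divided out. *)
Lemma pairing_hlift (x v w : V) : pairing (fubini_study x) v w =
  complex.Re (herm (hlift x v) (hlift x w)) / fsN x.
Proof.
have N0 := herm_lift_neq0 x.
have -> : herm (hlift x v) (hlift x w) = herm (T v) (T w)
   - herm (T v) (Z x) * conjc (herm (T w) (Z x)) / herm (Z x) (Z x).
  rewrite {2}/hlift hermDr hermNr hermZr hlift_orth mulr0 subr0.
  rewrite /hlift hermDl hermNl hermZl; congr (_ - _).
  by rewrite -hermC /hcoef mulrAC.
rewrite !herm_lin_lift herm_lift !herm_affine_lin pairing_bilinE.
have := fsN_neq0 x; move: (fsN x) => n n0.
move: (rdot v w) (rdot v (mulI w)) (rdot v x) (rdot w x) (rdot v _) (rdot w _).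
by move=> a b c d e f; rewrite -fmorphV /=; field.
Qed.

(** The complex form of the connection: the coefficients <u, Z> / <Z, Z> are those subtracted in
    horizontal lifts, which is why covariant derivatives will become derivatives of the frame. *)
Lemma cov_derive_lin (c W : R -> V) t :
  T (cov_derive (@fubini_study R) c W t) = T (derive1 W t)
   - (hcoef (c t) (derive1 c t) *: T (W t) + hcoef (c t) (W t) *: T (derive1 c t)).
Proof.
rewrite /cov_derive affine_linD; congr (_ + _).
move: (c t) (derive1 c t) (W t) => x u w.
have -> : \row_k (\sum_i \sum_l christoffel (@fubini_study R) x k i l
      * u ord0 i * w ord0 l) =
   - (fsN x)^-1 *: ((rdot u x *: w + rdot u (mulI x) *: mulI w)
                  + (rdot w x *: u + rdot w (mulI x) *: mulI u)).
  have sd (y : V) k : \sum_i y ord0 i * (i == k)%:R = y ord0 k.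
    rewrite (bigD1 k) //= eqxx mulr1 big1 ?addr0 // => i /negPf ->.
    by rewrite mulr0.
  have sJ (y : V) k : \sum_i y ord0 i * cplx_str i k = mulI y ord0 k.
    rewrite sum4 mxE /cplx_str !inordK //=.
    case: k => [[|[|[|[|//]]]] hk] /=; ring.
  apply/rowP => k; rewrite [LHS]mxE.
  transitivity (- (fsN x)^-1 * \sum_i \sum_l
     ((x ord0 i * u ord0 i) * (w ord0 l * (l == k)%:R)
     + (u ord0 i * (i == k)%:R) * (x ord0 l * w ord0 l)
     + (mulI x ord0 i * u ord0 i) * (w ord0 l * cplx_str l k)
     + (u ord0 i * cplx_str i k) * (mulI x ord0 l * w ord0 l))).
    rewrite mulr_sumr; apply: eq_bigr => i _.
    rewrite mulr_sumr; apply: eq_bigr => l _.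
    by rewrite christoffel_fubini_study /fs_christoffel; ring.
  under eq_bigr do rewrite !big_split -!mulr_sumr /=.
  rewrite !big_split -!mulr_suml /= !sd !sJ !mxE.
  have sC (y z : V) : \sum_i y ord0 i * z ord0 i = rdot z y.
    by apply: eq_bigr => i _; rewrite mulrC.
  by rewrite !sC; ring.
rewrite affine_linZ !affine_linD !affine_linZ !affine_lin_mulI.
have -> : (- (fsN x)^-1)%:C%C = - ((fsN x)^-1)%:C%C by exact: rmorphN.
have h (y : V) : hcoef x y =
    ((fsN x)^-1)%:C%C * ((rdot y x)%:C%C + (rdot y (mulI x))%:C%C * 'i%C).
  rewrite /hcoef herm_lin_lift herm_lift herm_affine_lin -fmorphV mulrC.
  congr (_ * _); apply/eqP.
  by rewrite eq_complex /=; apply/andP; split; apply/eqP; ring.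
rewrite !h; move: (T w) (T u) ((fsN x)^-1)%:C%C (rdot u x)%:C%C
  (rdot u (mulI x))%:C%C (rdot w x)%:C%C (rdot w (mulI x))%:C%C 'i%C.
move=> tw tu n a1 a2 a3 a4 i.
by apply/rowP => k; rewrite !mxE; ring.
Qed.

End AffineLift.

Section RowDerivatives.
Context (R : realType) (V : normedModType R) (n : nat).
Implicit Types (f : V -> 'rV[R]_n.+1) (x v : V).

Lemma is_derive_row f x v : derivable f x v ->
  forall m, is_derive x v (fun y => f y ord0 m) ('D_v f x ord0 m).
Proof.
move=> df m; apply: DeriveDef; first by move/derivable_mxP: df; apply.
by rewrite derive_mx // mxE.
Qed.

Lemma row_is_derive f x v (d : 'rV[R]_n.+1) :
  (forall m, is_derive x v (fun y => f y ord0 m) (d ord0 m)) ->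
  derivable f x v /\ 'D_v f x = d.
Proof.
move=> h; have df : derivable f x v.
  apply/derivable_mxP => i m; rewrite ord1.
  by have [] := h m.
split=> //; apply/rowP => m; rewrite derive_mx // mxE.
exact: (@derive_val _ _ _ _ _ _ _ (h m)).
Qed.

End RowDerivatives.

Section AffineLinDerivative.
Context (R : realType) (V : normedModType R) (j : 'I_3).
Local Notation T := (@affine_lin R j).
Implicit Types (f : V -> 'rV[R]_4) (x v : V).

Lemma mxderiv_affine_lin f x v : derivable f x v ->
  mxderiv (fun y => T (f y)) x v (T ('D_v f x)).
Proof.
move=> df i l; rewrite ord1.
have [l' ->|->] := unliftP j l; last first.
  rewrite affine_lin_j.
  under [X in cderiv X]eq_fun do rewrite affine_lin_j.
  exact: cderiv_const.
rewrite affine_lin_lift.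
under [X in cderiv X]eq_fun do rewrite affine_lin_lift.
by split; apply: is_derive_row.
Qed.

Lemma affine_lin_mxderiv f x v D : mxderiv (fun y => T (f y)) x v D ->
  derivable f x v /\ T ('D_v f x) = D.
Proof.
move=> h.
have [df _] : derivable f x v /\ 'D_v f x = \row_m
    if odd m then complex.Im (D ord0 (lift j (inord m./2)))
    else complex.Re (D ord0 (lift j (inord m./2))).
  apply: row_is_derive => m; rewrite mxE.
  have hm : (m./2 < 2)%N by rewrite ltn_half_double.
  have hl : (m./2.*2.+1 < 4)%N by rewrite -[4%N]/(2.*2) ltn_Sdouble.
  have em : m = if odd m then inord m./2.*2.+1 else inord m./2.*2.
    apply/val_inj; rewrite /= -[in LHS](odd_double_half m).
    by case: odd; rewrite !inordK // ltnW.
  have E (y : 'rV[R]_4) : y ord0 m =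
      y ord0 (if odd m then inord m./2.*2.+1 else inord m./2.*2).
    by congr (y _ _).
  under eq_fun do rewrite E.
  have [] := h ord0 (lift j (inord m./2)).
  under eq_fun do rewrite affine_lin_lift /= inordK //.
  move=> h1; under eq_fun do rewrite affine_lin_lift /= inordK //.
  by move=> h2; case: odd.
by split=> //; exact: mxderiv_uniq (mxderiv_affine_lin df) h.
Qed.

End AffineLinDerivative.

(** * Frames along a lifted curve, their gauge covariance, and their equivalence with the chart
    equation *)

Section CircleLift.
Context (R : realType).
Local Notation C := R[i].
Local Notation row := 'rV[C]_3.
Implicit Types (Z U A : R -> row) (k : R -> C) (s t : R).

(* [U] and [A] are the horizontal lifts at [Z] of the velocity and of the
   acceleration, and [k] is the connection form along [Z]. *)
Definition moving_frame Z U A k t : Prop :=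
  [/\ Z t != 0, mxderiv Z t 1 (k t *: Z t + U t),
      mxderiv U t 1 (k t *: U t + A t - Z t),
      herm (U t) (Z t) = 0 /\ herm (A t) (Z t) = 0 &
      herm (U t) (U t) = herm (Z t) (Z t)].

(** The first two orders hold in a neighbourhood so that they can be differentiated at [s]; the
    third-order equation is imposed at [s] alone. The quotients by [herm (Z s) (Z s)] adapt it to
    lifts of any length. *)
Definition circle_frame Z U A k s : Prop :=
  (\near s, moving_frame Z U A k s) /\
  mxderiv A s 1 (k s *: A s
    - (herm (A s) (A s) / herm (Z s) (Z s)) *: U s
    - (herm (A s) (U s) / herm (Z s) (Z s)) *: Z s).

Definition circle_lift Z s : Prop := exists U A k, circle_frame Z U A k s.

(** The logarithmic derivative of nu is isolated because it is what a change of lift adds to the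
    connection form [k]. *)
Lemma mxderiv_gauge (X : R -> row) D t (nu : R -> C) d (W : 'M[C]_3) :
  nu t != 0 -> cderiv nu t 1 d -> mxderiv X t 1 D ->
  mxderiv (fun t => nu t *: (X t *m W)) t 1
    ((d / nu t) *: (nu t *: (X t *m W)) + nu t *: (D *m W)).
Proof.
move=> n0 dn dX; apply: mxderiv_eq.
  exact: mxderivZ dn (mxderivM dX (mxderiv_const W _ _)).
by rewrite mulmx0 addr0 scalerA divfK.
Qed.

Lemma herm_gauge (W : 'M[C]_3) (c : C) (v w : row) : W *m adj W = 1%:M ->
  herm (c *: (v *m W)) (c *: (w *m W)) = c * conjc c * herm v w.
Proof. by move=> WW; rewrite hermZl hermZr herm_mulmx // mulrA. Qed.

Lemma moving_frame_gauge Z U A k s (nu dnu : R -> C) (W : 'M[C]_3) Z' :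
  W *m adj W = 1%:M -> (\near s, nu s != 0 /\ cderiv nu s 1 (dnu s)) ->
  (\near s, Z' s = nu s *: (Z s *m W)) ->
  (\near s, moving_frame Z U A k s) ->
  \near s, moving_frame Z' (fun t => nu t *: (U t *m W))
    (fun t => nu t *: (A t *m W)) (fun t => k t + dnu t / nu t) s.
Proof.
move=> WW nus ZZ fr; near=> t.
have [n0 dn] : nu t != 0 /\ cderiv nu t 1 (dnu t) by near: t.
have Zt : Z' t = nu t *: (Z t *m W) by near: t.
have Zn : \near t, nu t *: (Z t *m W) = Z' t.
  by near: t; apply: filterS (near_join ZZ) => t; apply: filterS => ? ->.
have [Z0 dZ dU [UZ AZ] UU] : moving_frame Z U A k t by near: t.
split.
- rewrite Zt -norm2_eq0 -(inj_eq (@complexI R)) -herm_norm2 herm_gauge //.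
  by rewrite !mulf_neq0 ?conjc_eq0 // herm_neq0.
- apply: (mxderiv_near Zn); apply: mxderiv_eq.
    exact: mxderiv_gauge n0 dn dZ.
  rewrite Zt mulmxDl -scalemxAl /=.
  move: (dnu t / nu t) (Z t *m W) (U t *m W) => p X Y.
  by apply/rowP => i; rewrite !mxE; ring.
- apply: mxderiv_eq; first exact: mxderiv_gauge n0 dn dU.
  rewrite Zt mulmxBl mulmxDl -scalemxAl /=.
  move: (dnu t / nu t) (Z t *m W) (U t *m W) (A t *m W) => p X Y V.
  by apply/rowP => i; rewrite !mxE; ring.
- by rewrite Zt !herm_gauge // UZ AZ !mulr0.
- by rewrite Zt !herm_gauge // UU.
Unshelve. all: by end_near. Qed.

Lemma circle_frame_gauge Z U A k s (nu dnu : R -> C) (W : 'M[C]_3) Z' :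
  W *m adj W = 1%:M -> (\near s, nu s != 0 /\ cderiv nu s 1 (dnu s)) ->
  (\near s, Z' s = nu s *: (Z s *m W)) ->
  circle_frame Z U A k s ->
  circle_frame Z' (fun t => nu t *: (U t *m W)) (fun t => nu t *: (A t *m W))
    (fun t => k t + dnu t / nu t) s.
Proof.
move=> WW nus ZZ [fr dA]; split; first exact: moving_frame_gauge fr.
have [n0 dn] := nbhs_singleton nus.
apply: mxderiv_eq; first exact: mxderiv_gauge n0 dn dA.
have /= -> := nbhs_singleton ZZ; rewrite !herm_gauge //.
have cn0 : nu s * conjc (nu s) != 0 by rewrite mulf_neq0 ?conjc_eq0.
have qE (a b : C) : nu s * conjc (nu s) * a / (nu s * conjc (nu s) * b) = a / b.
  by rewrite -mulf_div divff // mul1r.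
rewrite !qE.
rewrite !mulmxBl -!scalemxAl /=.
move: (dnu s / nu s) (herm _ _ / _) (herm _ _ / _) => p q r.
move: (Z s *m W) (U s *m W) (A s *m W) => X Y V.
by apply/rowP => i; rewrite !mxE; ring.
Qed.

Lemma circle_lift_gauge Z s (nu dnu : R -> C) (W : 'M[C]_3) Z' :
  W *m adj W = 1%:M -> (\near s, nu s != 0 /\ cderiv nu s 1 (dnu s)) ->
  (\near s, Z' s = nu s *: (Z s *m W)) ->
  circle_lift Z s -> circle_lift Z' s.
Proof.
move=> WW nus ZZ [U [A [k fr]]].
have h := circle_frame_gauge WW nus ZZ fr.
by do 3!eexists; exact: h.
Qed.

(* Differentiating the orthogonality [<X, Z> = 0]. *)
Lemma orth_coef Z U (X : R -> row) k t (Y : row) (l : C) :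
  Z t != 0 -> mxderiv Z t 1 (k t *: Z t + U t) ->
  (\near t, herm (X t) (Z t) = 0) ->
  mxderiv X t 1 (k t *: X t + Y + l *: Z t) -> herm Y (Z t) = 0 ->
  l = - (herm (X t) (U t) / herm (Z t) (Z t)).
Proof.
move=> Z0 dZ XZ dX YZ.
have h1 := cderiv_herm dX dZ.
have XZn : \near t, 0 = herm (X t) (Z t) by apply: filterS XZ => ? ->.
have h0 := cderiv_near XZn (cderiv_const 0 t 1).
have := cderiv_uniq h1 h0.
rewrite !hermDl !hermZl hermDr hermZr (nbhs_singleton XZ) YZ !mulr0 !add0r.
move=> /eqP; rewrite addr_eq0 => /eqP e.
by apply: (mulIf (herm_neq0 Z0)); rewrite e mulNr divfK ?herm_neq0.
Qed.

Section Chart.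
Context (j : 'I_3).
Local Notation V := 'rV[R]_4.
Local Notation T := (@affine_lin R j).
Local Notation Zc := (@affine_lift R j).
Implicit Types x : R -> V.

Lemma mxderiv_lin x t : derivable x t 1 ->
  mxderiv (fun s => T (x s)) t 1 (T (derive1 x t)).
Proof. by rewrite derive1E; exact: mxderiv_affine_lin. Qed.

Lemma lin_mxderiv x t D : mxderiv (fun s => T (x s)) t 1 D ->
  derivable x t 1 /\ T (derive1 x t) = D.
Proof. by rewrite derive1E; exact: affine_lin_mxderiv. Qed.

Lemma mxderiv_affine_lift x t : derivable x t 1 ->
  mxderiv (fun s => Zc (x s)) t 1 (T (derive1 x t)).
Proof.
move=> dx; under [X in mxderiv X]eq_fun do rewrite affine_liftE.
rewrite -[T _]add0r; apply: mxderivD; first exact: mxderiv_const.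
exact: mxderiv_lin.
Qed.

Lemma cderiv_ex (f g : R -> C) t d e : cderiv f t 1 d -> cderiv g t 1 e ->
  g t != 0 -> exists d', cderiv (fun s => f s / g s) t 1 d'.
Proof. by move=> h1 h2 g0; eexists; apply: cderivM h1 (cderivV g0 h2). Qed.

Lemma hcoef_cderiv x (W : R -> V) t : derivable x t 1 -> derivable W t 1 ->
  exists d, cderiv (fun s => hcoef j (x s) (W s)) t 1 d.
Proof.
move=> dx dW; have h := mxderiv_affine_lift dx.
exact: cderiv_ex (cderiv_herm (mxderiv_lin dW) h) (cderiv_herm h h)
  (herm_lift_neq0 _ _).
Qed.

Definition unit_speed x t :=
  pairing (fubini_study (x t)) (velocity x t) (velocity x t) = 1.

Lemma unit_speed_herm x t : unit_speed x t <->
  herm (hlift j (x t) (velocity x t)) (hlift j (x t) (velocity x t)) =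
  herm (Zc (x t)) (Zc (x t)).
Proof.
rewrite /unit_speed (pairing_hlift j) herm_lift herm_norm2 /=.
have N0 := fsN_neq0 (x t); split.
  by move=> /(congr1 (fun a => a * fsN (x t))); rewrite divfK // mul1r => ->.
by move=> [->]; rewrite divff.
Qed.

(** The frame consists of the horizontal lifts of x' and of its covariant derivative, with
    connection form [hcoef]. The derivatives of the [hcoef] terms are only known to exist; they
    affect nothing but the coefficient of Z, which [orth_coef] recovers from orthogonality. *)
Lemma chart_circle_frame x s :
  (\near s, [/\ derivable x s 1, derivable (derive1 x) s 1 & unit_speed x s]) ->
  derivable (derive1 (derive1 x)) s 1 ->
  conformal_geodesic_eq (@fubini_study R) x s ->
  circle_lift (Zc \o x) s.
Proof.
move=> reg d3 eqn.
pose u := derive1 x; pose a := acceleration (@fubini_study R) x.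
pose k t := hcoef j (x t) (u t).
pose U t := hlift j (x t) (u t); pose A t := hlift j (x t) (a t).
have Tu t : T (u t) = U t + k t *: Zc (x t) by rewrite /U /hlift subrK.
have Ta t : T (a t) = A t + hcoef j (x t) (a t) *: Zc (x t).
  by rewrite /A /hlift subrK.
have Ta' t : T (a t) = T (derive1 u t) - (k t *: T (u t) + k t *: T (u t)).
  by rewrite /a /acceleration cov_derive_lin.
have dZ t : derivable x t 1 ->
    mxderiv (Zc \o x) t 1 (k t *: (Zc \o x) t + U t).
  by move=> dx; rewrite addrC -Tu; exact: mxderiv_affine_lift.
have lift0 t : herm (U t) (Zc (x t)) = 0 by exact: hlift_orth.
have lift0' t : herm (A t) (Zc (x t)) = 0 by exact: hlift_orth.
have [dxs dus us] := nbhs_singleton reg.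
have fr : \near s, moving_frame (Zc \o x) U A k s.
  apply: filterS reg => t [dx du ut].
  have ut' := (unit_speed_herm x t).1 ut.
  apply: And5.
  - exact: affine_lift_neq0.
  - exact: dZ.
  2: exact: (conj (lift0 t) (lift0' t)).
  2: exact: ut'.
  have [d hd] := hcoef_cderiv dx du.
  have dU : mxderiv U t 1 (k t *: U t + A t
      + (hcoef j (x t) (a t) + k t * k t - d) *: Zc (x t)).
    apply: mxderiv_eq.
      exact: mxderivB (mxderiv_lin du) (mxderivZ hd (mxderiv_affine_lift dx)).
    have -> : T (derive1 u t) = T (a t) + (k t *: T (u t) + k t *: T (u t)).
      by rewrite Ta' subrK.
    rewrite -/u -/(k t) Ta Tu.
    move: (hcoef _ _ _) (k t) (U t) (A t) (Zc _) => p q X Y W.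
    by apply/rowP => i; rewrite !mxE; ring.
  apply: (mxderiv_eq dU).
  have Z0 := affine_lift_neq0 j (x t).
  have UZ : \near t, herm (U t) (Zc (x t)) = 0.
    by apply: filterE => r; exact: lift0.
  rewrite (@orth_coef (Zc \o x) U U k t _ _ Z0 (dZ t dx) UZ dU (lift0' t)) /=.
  by rewrite ut' divff ?herm_lift_neq0 // scaleN1r.
exists U, A, k; split=> //.
have [_ _ _ _ us'] := nbhs_singleton fr.
(* Only the differentiability of the acceleration is extracted here; its derivative is then read off
   the conformal geodesic equation. *)
have [D hD] : exists D, mxderiv (fun t => T (a t)) s 1 D.
  have [d hd] := hcoef_cderiv dxs dus.
  have dkT := mxderivZ hd (mxderiv_lin dus).
  eexists; under [X in mxderiv X]eq_fun do rewrite Ta'.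
  by apply: (mxderivB (mxderiv_lin d3)); exact: (mxderivD dkT dkT).
have [da TD] := lin_mxderiv hD.
have [d hd] := hcoef_cderiv dxs da.
move: eqn => /(conformal_geodesic_eq_fubini_study us).1 eqn.
have := congr1 T eqn.
rewrite cov_derive_lin affine_linZ -/a -/u -/(k s) => eqT.
pose p : C := (- pairing (fubini_study (x s)) (a s) (a s))%:C%C.
have pE : p = - (herm (A s) (A s) / herm (Zc (x s)) (Zc (x s))).
  rewrite /p (pairing_hlift j) -/(A s) herm_lift [in RHS]herm_norm2.
  by rewrite -fmorphV -rmorphM -rmorphN.
have dA : mxderiv A s 1 (k s *: A s + p *: U s
      + (p * k s + k s * hcoef j (x s) (a s) - d) *: Zc (x s)).
  apply: mxderiv_eq.
    exact: mxderivB (mxderiv_lin da) (mxderivZ hd (mxderiv_affine_lift dxs)).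
  have -> : T (derive1 a s) = p *: T (u s) + (k s *: T (a s) + hcoef j (x s) (a s) *: T (u s)).
    by rewrite -eqT subrK.
  rewrite -/u Ta Tu.
  move: (hcoef _ _ _) (k s) (U s) (A s) (Zc _) p {pE} => q r X Y W p.
  by apply/rowP => i; rewrite !mxE; ring.
have pU : herm (p *: U s) (Zc (x s)) = 0 by rewrite hermZl lift0 mulr0.
apply: (mxderiv_eq dA).
have Z0 := affine_lift_neq0 j (x s).
have AZ : \near s, herm (A s) (Zc (x s)) = 0.
  by apply: filterE => r; exact: lift0'.
rewrite (@orth_coef (Zc \o x) U A k s _ _ Z0 (dZ s dxs) AZ dA pU) /=.
rewrite pE [X in _ + X + _]scaleNr [X in _ + _ + X]scaleNr.
reflexivity.
Qed.

(** Entry j of the chart lift is constantly 1, and differentiating it gives k = - U_j. Hence x' and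
    x'' near s are expressed through the differentiable [U], [A], [k], which supplies the three
    derivatives of x as well as the equation. *)
Lemma circle_frame_chart x s : circle_lift (Zc \o x) s ->
  [/\ derivable x s 1, derivable (derive1 x) s 1,
      derivable (derive1 (derive1 x)) s 1, unit_speed x s &
      conformal_geodesic_eq (@fubini_study R) x s].
Proof.
move=> [U [A [k [fr dA]]]].
pose u := derive1 x; pose Z := Zc \o x.
pose Uj t := U t ord0 j; pose Aj t := A t ord0 j.
have Zj t : Z t ord0 j = 1 by exact: affine_lift_j.
have first t : moving_frame Z U A k t ->
    [/\ derivable x t 1, T (u t) = k t *: Z t + U t & k t = - Uj t].
  move=> [Z0 dZ _ _ _].
  have hT : mxderiv (fun s => T (x s)) t 1 (k t *: Z t + U t).
    have := mxderivB dZ (mxderiv_const (delta_mx ord0 j) t 1); rewrite subr0.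
    by under [X in mxderiv X]eq_fun do rewrite /Z /= affine_liftE addrC addKr.
  have [dx e] := lin_mxderiv hT; split=> //.
  have := congr1 (fun v : row => v ord0 j) e.
  rewrite affine_lin_j [X in _ = X]mxE [X in _ = X + _]mxE Zj mulr1 => /esym/eqP.
  by rewrite addr_eq0 => /eqP.
have nk : \near s, - Uj s = k s by apply: filterS fr => t /first [_ _ ->].
have e1 a (X Y W : row) : (a *: X + Y - W) ord0 j =
    a * X ord0 j + Y ord0 j - W ord0 j by rewrite !mxE.
have e2 a b c (X Y W : row) : (a *: X - b *: Y - c *: W) ord0 j =
    a * X ord0 j - b * Y ord0 j - c * W ord0 j by rewrite !mxE.
have entry (X : R -> row) D t : mxderiv X t 1 D ->
  cderiv (fun s => X s ord0 j) t 1 (D ord0 j) by move=> h; exact: h.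
have second t : (\near t, moving_frame Z U A k t) ->
    derivable u t 1 /\ T (derive1 u t) =
      (2 * k t) *: U t + A t + (2 * k t ^+ 2 - Aj t) *: Z t.
  move=> frt; have [_ dZ dU _ _] := nbhs_singleton frt.
  have [_ _ kt] := first _ (nbhs_singleton frt).
  have E : \near t, U t - Uj t *: Z t = T (u t).
    apply: filterS frt => r /first [_ -> ->].
    by rewrite scaleNr addrC.
  have := mxderiv_near E (mxderivB dU (mxderivZ (entry _ _ _ dU) dZ)).
  move=> /lin_mxderiv [du ->]; split=> //.
  rewrite e1 Zj -/(Uj t) -/(Aj t) kt.
  move: (Uj t) (Aj t) (U t) (A t) (Z t) => p q X Y W.
  by apply/rowP => i; rewrite !mxE; ring.
have frs := nbhs_singleton fr.
have [dx Tu ks] := first s frs.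
have [du Tdu] := second s fr.
have nsecond : \near s, derivable u s 1 /\ T (derive1 u s) =
      (2 * k s) *: U s + A s + (2 * k s ^+ 2 - Aj s) *: Z s.
  by apply: filterS (near_join fr) => t; exact: second.
have [Z0 dZ dU [UZ AZ] UU] := frs.
have hk t : moving_frame Z U A k t -> hcoef j (x t) (u t) = k t.
  move=> frt; have [Z0t _ _ [UZt _] _] := frt.
  have [_ Tut _] := first t frt.
  by rewrite /hcoef Tut hermDl hermZl UZt addr0 mulfK // herm_lift_neq0.
pose a := acceleration (@fubini_study R) x.
have na : \near s, A s - Aj s *: Z s = T (a s).
  apply: filterS2 fr nsecond => t frt [_ Tdut].
  rewrite /a /acceleration cov_derive_lin -/u Tdut hk //.
  have [_ -> _] := first t frt.
  move: (k t) (Aj t) (U t) (A t) (Z t) => p q X Y W.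
  by apply/rowP => i; rewrite !mxE; ring.
have dk : cderiv k s 1 (- (k s *: U s + A s - Z s) ord0 j).
  exact: cderiv_near nk (cderivN (entry _ _ _ dU)).
have ddu : derivable (derive1 u) s 1.
  have E : \near s, (2 * k s) *: U s + A s + (2 * (k s * k s) - Aj s) *: Z s = T (derive1 u s).
    by apply: filterS nsecond => t [_ ->]; rewrite expr2.
  have two f e : cderiv f s 1 e -> cderiv (fun t => 2 * f t) s 1 (0 * f s + 2 * e).
    by move=> h; exact: cderivM (cderiv_const 2 s 1) h.
  have := mxderiv_near E (mxderivD (mxderivD (mxderivZ (two _ _ dk) dU) dA)
     (mxderivZ (cderivB (two _ _ (cderivM dk dk)) (entry _ _ _ dA)) dZ)).
  by move=> /lin_mxderiv [].
have Ulift : hlift j (x s) (u s) = U s by rewrite /hlift hk // Tu addrC addKr.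
have us : unit_speed x s by apply/unit_speed_herm; rewrite Ulift UU.
split; [exact: dx|exact: du|exact: ddu|exact: us|].
apply/(conformal_geodesic_eq_fubini_study us).2.
have Ta := nbhs_singleton na.
have ha : hcoef j (x s) (a s) = - Aj s.
  rewrite /hcoef -Ta hermDl hermNl hermZl AZ add0r mulNr mulfK //.
  exact: herm_lift_neq0.
have Alift : hlift j (x s) (a s) = A s.
  by rewrite /hlift ha -Ta scaleNr opprK subrK.
have [da Tda] := lin_mxderiv (mxderiv_near na
   (mxderivB dA (mxderivZ (entry _ _ _ dA) dZ))).
apply: (@affine_lin_inj R j); rewrite cov_derive_lin affine_linZ -/a -/u.
have -> : (- pairing (fubini_study (x s)) (a s) (a s))%:C%C =
    - (herm (A s) (A s) / herm (Z s) (Z s)).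
  rewrite (pairing_hlift j) Alift [in RHS]herm_lift [in RHS]herm_norm2.
  by rewrite -fmorphV -rmorphM -rmorphN.
rewrite Tda (hk s frs) ha -Ta Tu e2 Zj -/(Aj s) -/(Uj s) ks -/Z.
move: (herm (A s) _ / _) (herm (A s) _ / _) => p q.
move: (Uj s) (Aj s) (U s) (A s) (Z s) => b c X Y W.
by apply/rowP => i; rewrite !mxE; ring.
Qed.

End Chart.
End CircleLift.

(** * Homogeneous coordinates *)

Section HomogeneousCoordinates.
Context (R : realType).
Local Notation C := R[i].
Local Notation row := 'rV[C]_3.
Implicit Types (p : CP2 R) (v w : row) (j : 'I_3).

Lemma hcoord_neq0 p : hcoord p != 0. Proof. exact: (valP (repr p)). Qed.

Lemma hcoordK p : hpoint (hcoord p) = p.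
Proof. by rewrite /hpoint /hcoord valKd reprK. Qed.

Lemma hpoint_eqP v w : v != 0 -> w != 0 ->
  hpoint v = hpoint w <-> exists2 a, a != 0 & v = a *: w.
Proof.
move=> v0 w0; rewrite /hpoint.
set x := insubd _ v; set y := insubd _ w.
have xE : val x = v by rewrite val_insubd v0.
have yE : val y = w by rewrite val_insubd w0.
split.
  move=> /eqquotP; rewrite /= /collinear xE yE => /andP[/sub_rVP [a va] _].
  by exists a => //; apply: contraNneq v0 => a0; rewrite va a0 scale0r.
move=> [a a0 va]; apply/eqquotP; rewrite /= /collinear xE yE va.
by apply/andP; split; rewrite ?scalemx_sub // eqmx_scale.
Qed.

Lemma hcoord_hpoint v : v != 0 ->
  exists2 a, a != 0 & hcoord (hpoint v) = a *: v.
Proof. by move=> v0; apply/hpoint_eqP; rewrite ?hcoord_neq0 ?hcoordK. Qed.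

Lemma hpointZ a v : a != 0 -> v != 0 -> hpoint (a *: v) = hpoint v.
Proof.
move=> a0 v0; apply/hpoint_eqP => //; last by exists a.
by rewrite scaler_eq0 negb_or a0.
Qed.

Lemma affine_dom_hpoint j v : v != 0 ->
  affine_dom j (hpoint v) <-> v ord0 j != 0.
Proof.
move=> v0; rewrite /affine_dom /=; have [a a0 ->] := hcoord_hpoint v0.
by rewrite mxE mulf_eq0 (negPf a0).
Qed.

Lemma affine_pointE j (x : 'rV[R]_4) : affine_point j x = hpoint (affine_lift j x).
Proof. by []. Qed.

Lemma affine_lift_coord j v : v ord0 j != 0 ->
  affine_lift j (affine_coord j (hpoint v)) = (v ord0 j)^-1 *: v.
Proof.
move=> vj; have v0 : v != 0 by apply: contraNneq vj => ->; rewrite mxE.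
have [a a0 E] := hcoord_hpoint v0.
apply/rowP => k; rewrite !mxE; case: unliftP => [l ->|->]; last first.
  by rewrite mulVf.
have hl : (l.*2.+1 < 4)%N by rewrite -[4%N]/(2.*2) ltn_Sdouble.
have hl' : (l.*2 < 4)%N by apply: ltn_trans hl.
rewrite !mxE E !inordK //= odd_double /= uphalf_double doubleK.
rewrite !inord_val !mxE.
have -> : a * v ord0 (lift j l) / (a * v ord0 j) =
    (v ord0 j)^-1 * v ord0 (lift j l).
  by field; rewrite a0 vj.
by case: (_ * _).
Qed.

(** The orthogonal projector, acting on rows from the right, onto the line of [v]: an invariant of
    the projective point that also determines it. *)
Definition proj v : 'M[C]_3 := (herm v v)^-1 *: (adj v *m v).

Lemma projZ a v : a != 0 -> proj (a *: v) = proj v.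
Proof.
move=> a0; rewrite /proj hermZl hermZr adjZ -scalemxAl -scalemxAr !scalerA.
have c0 : conjc a != 0 by rewrite conjc_eq0.
congr (_ *: _); rewrite !invfM; move: (herm v v)^-1 => h.
by field; rewrite a0 c0.
Qed.

Lemma proj_hcoord v : v != 0 -> proj (hcoord (hpoint v)) = proj v.
Proof. by move=> v0; have [a a0 ->] := hcoord_hpoint v0; rewrite projZ. Qed.

Lemma mul_proj v : v != 0 -> v *m proj v = v.
Proof.
move=> v0; rewrite /proj -scalemxAr mulmxA mul_adj mul_scalar_mx.
by rewrite scalerA mulVf ?scale1r // herm_neq0.
Qed.

Lemma proj_inj v w : v != 0 -> w != 0 -> proj v = proj w ->
  hpoint v = hpoint w.
Proof.
move=> v0 w0 e; apply/hpoint_eqP => //.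
have := mul_proj v0; rewrite e /proj -scalemxAr mulmxA mul_adj mul_scalar_mx.
rewrite scalerA => E; exists ((herm w w)^-1 * herm v w) => //.
by apply: contraNneq v0 => E0; rewrite -E E0 scale0r.
Qed.

Definition hproj p := proj (hcoord p).

Definition hmap (W : 'M[C]_3) p : CP2 R := hpoint (hcoord p *m W).

Lemma mulmx_unit_neq0 (W : 'M[C]_3) v : W *m adj W = 1%:M -> v != 0 ->
  v *m W != 0.
Proof.
move=> WW; apply: contraNneq => vW.
by rewrite -[v]mulmx1 -WW mulmxA vW mul0mx.
Qed.

Lemma hmap_hpoint (W : 'M[C]_3) v : W *m adj W = 1%:M -> v != 0 ->
  hmap W (hpoint v) = hpoint (v *m W).
Proof.
move=> WW v0; rewrite /hmap; have [a a0 ->] := hcoord_hpoint v0.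
by rewrite -scalemxAl hpointZ // mulmx_unit_neq0.
Qed.

Lemma hmapK (W : 'M[C]_3) : W *m adj W = 1%:M ->
  cancel (hmap W) (hmap (adj W)).
Proof.
move=> WW p; rewrite -[p in RHS]hcoordK -{1}[p]hcoordK.
have W'W : adj W *m adj (adj W) = 1%:M by rewrite adjK; exact: mulmx1C.
rewrite !hmap_hpoint // ?mulmx_unit_neq0 ?hcoord_neq0 //.
by rewrite -mulmxA WW mulmx1.
Qed.

Lemma proj_mulmx (W : 'M[C]_3) v : W *m adj W = 1%:M ->
  proj (v *m W) = adj W *m proj v *m W.
Proof.
move=> WW; rewrite /proj herm_mulmx // adjM -scalemxAr -scalemxAl.
by rewrite !mulmxA.
Qed.

Lemma hproj_inj p q : hproj p = hproj q -> p = q.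
Proof.
by move=> /proj_inj; rewrite !hcoordK; apply; exact: hcoord_neq0.
Qed.

Lemma hproj_hmap (W : 'M[C]_3) p : W *m adj W = 1%:M ->
  hproj (hmap W p) = adj W *m hproj p *m W.
Proof.
move=> WW; rewrite /hproj proj_hcoord ?proj_mulmx //.
by rewrite mulmx_unit_neq0 ?hcoord_neq0.
Qed.

End HomogeneousCoordinates.

(** * The generator of a conformal geodesic *)

Section ConservedGenerator.
Context (R : realType).
Local Notation C := R[i].
Local Notation row := 'rV[C]_3.
Implicit Types (X Y Z U A : R -> row) (k : R -> C) (s t : R).

Definition outer (z v w : row) : 'M[C]_3 := (herm z z)^-1 *: (adj v *m w).

(* [z^* u - u^* z + u^* a - a^* u - i alpha (1 - z^* z)] for the normalised
   lifts, where [i alpha = <a, u>]; a curve with this generator at each time is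
   the orbit of a one-parameter group. *)
Definition generator (z u a : row) : 'M[C]_3 :=
  outer z z u - outer z u z + outer z u a - outer z a u
  - (herm a u / herm z z) *: (1%:M - outer z z z).

Lemma outerDr (z v w w' : row) :
  outer z v (w + w') = outer z v w + outer z v w'.
Proof. by rewrite /outer mulmxDr scalerDr. Qed.

Lemma outerZr (z v w : row) a : outer z v (a *: w) = a *: outer z v w.
Proof. by rewrite /outer -scalemxAr !scalerA mulrC. Qed.

Lemma outerNr (z v w : row) : outer z v (- w) = - outer z v w.
Proof. by rewrite -scaleN1r outerZr scaleN1r. Qed.

Lemma outerDl (z v v' w : row) :
  outer z (v + v') w = outer z v w + outer z v' w.
Proof. by rewrite /outer adjD mulmxDl scalerDr. Qed.

Lemma outerZl (z v w : row) a : outer z (a *: v) w = conjc a *: outer z v w.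
Proof. by rewrite /outer adjZ -scalemxAl !scalerA mulrC. Qed.

Lemma outerNl (z v w : row) : outer z (- v) w = - outer z v w.
Proof. by rewrite -scaleN1r outerZl rmorphN rmorph1 scaleN1r. Qed.

Lemma outer_mul (z v w v' w' : row) :
  outer z v w *m outer z v' w' = (herm w v' / herm z z) *: outer z v w'.
Proof.
rewrite /outer -scalemxAl -scalemxAr mulmxA -(mulmxA (adj v)) mul_adj.
rewrite mul_mx_scalar -scalemxAl !scalerA; congr (_ *: _); ring.
Qed.

Lemma cderiv_norm_lift Z U k t :
  mxderiv Z t 1 (k t *: Z t + U t) -> herm (U t) (Z t) = 0 ->
  cderiv (fun t => herm (Z t) (Z t)) t 1
    ((k t + conjc (k t)) * herm (Z t) (Z t)).
Proof.
move=> dZ UZ; apply: cderiv_eq (cderiv_herm dZ dZ) _.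
rewrite hermDl hermDr hermZl hermZr UZ [herm (Z t) (U t)]hermC UZ conjc0.
by ring.
Qed.

(** The terms in k and its conjugate cancel against the derivative of 1 / <Z, Z>, so [outer] is
    differentiated as if the lift had no connection form. *)
Lemma mxderiv_outer Z U k t X Y (X1 Y1 : row) :
  Z t != 0 -> mxderiv Z t 1 (k t *: Z t + U t) -> herm (U t) (Z t) = 0 ->
  mxderiv X t 1 (k t *: X t + X1) -> mxderiv Y t 1 (k t *: Y t + Y1) ->
  mxderiv (fun t => outer (Z t) (X t) (Y t)) t 1
    (outer (Z t) X1 (Y t) + outer (Z t) (X t) Y1).
Proof.
move=> Z0 dZ UZ dX dY; apply: mxderiv_eq.
  exact: mxderivZ (cderivV (herm_neq0 Z0) (cderiv_norm_lift dZ UZ))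
    (mxderivM (mxderiv_adj dX) dY).
rewrite /outer adjD adjZ mulmxDl mulmxDr -!scalemxAl -!scalemxAr.
have N0 := herm_neq0 Z0.
move: (herm _ _) N0 (_ *m _) (_ *m _) (_ *m _) => N N0 p q r.
by apply/matrixP => i l; rewrite !mxE; field.
Qed.

Lemma cderiv_herm_quot Z U k t X Y (X1 Y1 : row) :
  Z t != 0 -> mxderiv Z t 1 (k t *: Z t + U t) -> herm (U t) (Z t) = 0 ->
  mxderiv X t 1 (k t *: X t + X1) -> mxderiv Y t 1 (k t *: Y t + Y1) ->
  cderiv (fun t => herm (X t) (Y t) / herm (Z t) (Z t)) t 1
    ((herm X1 (Y t) + herm (X t) Y1) / herm (Z t) (Z t)).
Proof.
move=> Z0 dZ UZ dX dY; apply: cderiv_eq.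
  exact: cderivM (cderiv_herm dX dY)
    (cderivV (herm_neq0 Z0) (cderiv_norm_lift dZ UZ)).
rewrite !(hermDl, hermDr, hermZl, hermZr).
have N0 := herm_neq0 Z0.
by move: (herm _ (Z t)) N0 => N N0; field.
Qed.

(** For a unit z and P = z^* z, orthogonality leaves P K = z^* u and K P = - u^* z, and the scalar
    correction carried by 1 - P is annihilated by P. The commutator is thus z^* u + u^* z, the
    derivative of z^* z. *)
Lemma mxderiv_proj Z U A k t : moving_frame Z U A k t ->
  mxderiv (fun t => proj (Z t)) t 1
    (proj (Z t) *m generator (Z t) (U t) (A t)
     - generator (Z t) (U t) (A t) *m proj (Z t)).
Proof.
move=> [Z0 dZ dU [UZ AZ] UU].
have h := mxderiv_outer Z0 dZ UZ dZ dZ.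
have e : (fun t => proj (Z t)) = fun t => outer (Z t) (Z t) (Z t) by [].
rewrite e; apply: (mxderiv_eq h).
have N1 : herm (Z t) (Z t) / herm (Z t) (Z t) = 1 by rewrite divff // herm_neq0.
have ZU : herm (Z t) (U t) = 0 by rewrite hermC UZ conjc0.
have ZA : herm (Z t) (A t) = 0 by rewrite hermC AZ conjc0.
rewrite -[proj (Z t)]/(outer (Z t) (Z t) (Z t)) /generator.
have m0 (v w v' w' : row) : herm w v' = 0 ->
    outer (Z t) v w *m outer (Z t) v' w' = 0.
  by move=> hw; rewrite outer_mul hw mul0r scale0r.
have m1 (v w' : row) : outer (Z t) v (Z t) *m outer (Z t) (Z t) w' =
    outer (Z t) v w' by rewrite outer_mul N1 scale1r.
have := m1 (Z t) (U t); have := m0 (Z t) _ _ (Z t) ZU.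
have := m0 (Z t) _ _ (A t) ZU; have := m0 (Z t) _ _ (U t) ZA.
have := m1 (Z t) (Z t); have := m0 (Z t) _ _ (Z t) UZ.
have := m1 (U t) (Z t); have := m0 (U t) _ _ (Z t) AZ.
have := m0 (A t) _ _ (Z t) UZ.
move: (herm _ _ / _) (outer _ (Z t) (Z t)) (outer _ (Z t) (U t))
  (outer _ (U t) (Z t)) (outer _ (U t) (A t)) (outer _ (A t) (U t)).
move=> al zz zu uz ua au e1 e2 e3 e4 e5 e6 e7 e8 e9.
rewrite !(mulmxBr, mulmxDr, mulmxBl, mulmxDl) -scalemxAr -scalemxAl.
rewrite !(mulmxBr, mulmxBl) mulmx1 mul1mx.
rewrite e1 e2 e3 e4 e5 e6 e7 e8 e9 subrr scaler0 !subr0 addr0 sub0r addr0.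
by rewrite opprK addrC.
Qed.

(** Differentiating the speed condition <U, U> = <Z, Z> shows that the real part of <A, U>
    vanishes. *)
Lemma herm_accel_speed Z U A k t : (\near t, moving_frame Z U A k t) ->
  conjc (herm (A t) (U t)) = - herm (A t) (U t).
Proof.
move=> fr; have [Z0 dZ dU [UZ AZ] UU] := nbhs_singleton fr.
have E : \near t, herm (Z t) (Z t) = herm (U t) (U t).
  by apply: filterS fr => r [].
have := cderiv_uniq (cderiv_near E (cderiv_norm_lift dZ UZ))
  (cderiv_herm dU dU).
rewrite !(hermDl, hermDr, hermNl, hermNr, hermZl, hermZr) UU.
rewrite [herm (Z t) (U t)]hermC UZ conjc0 -hermC.
move=> e; apply/eqP; rewrite -addr_eq0; apply/eqP.
apply: (addrI ((k t + conjc (k t)) * herm (Z t) (Z t))).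
by rewrite addr0 [in RHS]e; ring.
Qed.

(** First <A, U> / <Z, Z> is constant, the contributions of |A|^2 from A' and U' being opposite. The
    Z-component of A' then leaves multiples of z^* u and u^* z, and the correction - i alpha (1 -
    z^* z) is there to absorb them. *)
Lemma generator_constant Z U A k s : circle_frame Z U A k s ->
  mxderiv (fun t => generator (Z t) (U t) (A t)) s 1 0.
Proof.
move=> [fr dA]; have := herm_accel_speed fr.
have [Z0 dZ dU [UZ AZ] UU] := nbhs_singleton fr.
set al := herm (A s) (U s); set n := herm (Z s) (Z s) => alC.
have nC : conjc n = n by rewrite -hermC.
set p := herm (A s) (A s) / n.
have pC : conjc p = p by rewrite rmorphM fmorphV /= nC -hermC.
have dZ' : mxderiv Z s 1 (k s *: Z s + U s) by [].
have dU' : mxderiv U s 1 (k s *: U s + (A s - Z s)) by rewrite addrA.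
have dA' : mxderiv A s 1 (k s *: A s + (- (p *: U s) - (al / n) *: Z s)).
  by rewrite addrA.
have D := mxderiv_outer Z0 dZ UZ.
have h := mxderivB (mxderivB (mxderivD (mxderivB (D _ _ _ _ dZ' dU')
  (D _ _ _ _ dU' dZ')) (D _ _ _ _ dU' dA')) (D _ _ _ _ dA' dU'))
  (mxderivZ (cderiv_herm_quot Z0 dZ UZ dA' dU')
     (mxderivB (mxderiv_const 1%:M s 1) (D _ _ _ _ dZ' dZ'))).
apply: (mxderiv_eq h); rewrite -/al -/n.
rewrite !(hermDl, hermDr, hermNl, hermNr, hermZl, hermZr) AZ UU.
rewrite [herm (Z s) (U s)]hermC UZ conjc0 -/n.
rewrite !(outerDl, outerDr, outerNl, outerNr, outerZl, outerZr).
have -> : conjc (al / n) = - (al / n) by rewrite rmorphM fmorphV /= alC nC mulNr.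
rewrite pC.
have -> : (- (p * n) - al / n * 0 + (herm (A s) (A s) - 0)) / n = 0.
  by rewrite /p divfK ?herm_neq0 // mulr0 !subr0 addNr mul0r.
move: (al / n) (p) (1%:M - _) => q p1 W.
move: (outer _ _ _) (outer _ _ _) (outer _ _ _) (outer _ _ _) (outer _ _ _).
move: (outer _ _ _) (outer _ _ _) => X1 X2 X3 X4 X5 X6 X7.
by apply/matrixP => i l; rewrite !mxE; ring.
Qed.

(** Projecting Z' on Z determines k, hence U; agreement of U near [s] then determines A from U'. *)
Lemma moving_frame_unique Z U A k U' A' k' s :
  (\near s, moving_frame Z U A k s) -> (\near s, moving_frame Z U' A' k' s) ->
  [/\ U s = U' s, A s = A' s & k s = k' s].
Proof.
move=> fr fr'.
have first t : moving_frame Z U A k t -> moving_frame Z U' A' k' t ->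
    U t = U' t /\ k t = k' t.
  move=> [Z0 dZ _ [UZ _] _] [_ dZ' _ [UZ' _] _].
  have e := mxderiv_uniq dZ dZ'.
  have ek : k t = k' t.
    have := congr1 (fun v => herm v (Z t)) e.
    by rewrite !hermDl !hermZl UZ UZ' !addr0 => /(mulIf (herm_neq0 Z0)).
  by split=> //; move: e; rewrite ek => /addrI.
have E : \near s, U s = U' s by apply: filterS2 fr fr' => t /first h /h [].
have [Us ks] := first s (nbhs_singleton fr) (nbhs_singleton fr').
split=> //.
have [_ _ dU _ _] := nbhs_singleton fr.
have [_ _ dU' _ _] := nbhs_singleton fr'.
have := mxderiv_uniq (mxderiv_near E dU) dU'.
by rewrite Us ks => /addIr /addrI.
Qed.

Lemma generatorZ (a : C) (z u w : row) : a != 0 ->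
  generator (a *: z) (a *: u) (a *: w) = generator z u w.
Proof.
move=> a0; have ca0 : conjc a != 0 by rewrite conjc_eq0.
have oZ (v v' : row) : outer (a *: z) (a *: v) (a *: v') = outer z v v'.
  rewrite /outer hermZl hermZr adjZ -scalemxAl -scalemxAr !scalerA.
  congr (_ *: _); rewrite !invfM; move: (herm z z)^-1 => h.
  by field; rewrite a0 ca0.
rewrite /generator (oZ z u) (oZ u z) (oZ u w) (oZ w u) (oZ z z).
suff -> : herm (a *: w) (a *: u) / herm (a *: z) (a *: z) = herm w u / herm z z.
  by [].
rewrite !hermZl !hermZr !invfM; move: (herm z z)^-1 => h.
by field; rewrite a0 ca0.
Qed.

End ConservedGenerator.

(** * Lifts of conformal geodesics and the generator common to a whole interval *)

Section GeodesicLifts.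
Context (R : realType).
Local Notation C := R[i].
Local Notation row := 'rV[C]_3.
Implicit Types (c : R -> CP2 R) (Z U A : R -> row) (k : R -> C) (s t : R).

Definition lifts c Z s : Prop := \near s, Z s != 0 /\ c s = hpoint (Z s).

Lemma affine_dom_ex (p : CP2 R) : exists j, affine_dom j p.
Proof.
apply: contrapT => /forallNP h; have := hcoord_neq0 p => /eqP; apply.
apply/rowP => j; rewrite mxE; have := h j.
by rewrite /affine_dom /= => /negP; rewrite negbK => /eqP.
Qed.

Lemma affine_lift_coordE j (p : CP2 R) : affine_dom j p ->
  affine_lift j (affine_coord j p) = (hcoord p ord0 j)^-1 *: hcoord p.
Proof. by move=> dj; rewrite -[p in LHS]hcoordK affine_lift_coord. Qed.

Lemma hpoint_affine_lift j (p : CP2 R) : affine_dom j p ->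
  hpoint (affine_lift j (affine_coord j p)) = p.
Proof.
move=> dj; rewrite affine_lift_coordE // hpointZ ?hcoordK ?hcoord_neq0 //.
by rewrite invr_eq0.
Qed.

Lemma geodesic_circle_lift (I : set R) c s j : open I ->
  conformal_geodesic I c -> I s -> affine_dom j (c s) ->
  let Z := affine_lift j \o (affine_coord j \o c) in
  lifts c Z s /\ circle_lift Z s.
Proof.
move=> oI hc Is dj Z; have [ndj der _ eqn] := hc s Is j dj.
have nI : \near s, I s by exact: open_nbhs_nbhs.
split.
  apply: filterS ndj => t djt; split; first exact: affine_lift_neq0.
  by rewrite /Z /= hpoint_affine_lift.
apply: chart_circle_frame => //; last exact: (der 2%N isT).
apply: filterS2 nI ndj => t It djt.
have [_ dert ut _] := hc t It j djt; split=> //.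
- exact: (dert 0%N isT).
- exact: (dert 1%N isT).
Qed.

(** Two lifts of one curve differ by a scalar function; written as <Z', Z> / <Z, Z>, that function
    inherits their differentiability. *)
Lemma lifts_ratio c Z Z' s (dZ dZ' : R -> row) :
  lifts c Z s -> lifts c Z' s ->
  (\near s, mxderiv Z s 1 (dZ s)) -> (\near s, mxderiv Z' s 1 (dZ' s)) ->
  exists nu dnu : R -> C, (\near s, nu s != 0 /\ cderiv nu s 1 (dnu s)) /\
    \near s, Z' s = nu s *: Z s.
Proof.
move=> lZ lZ' hZ hZ'.
exists (fun t => herm (Z' t) (Z t) / herm (Z t) (Z t)).
exists (fun t => (herm (dZ' t) (Z t) + herm (Z' t) (dZ t)) / herm (Z t) (Z t)
  + herm (Z' t) (Z t) * (- ((herm (dZ t) (Z t) + herm (Z t) (dZ t))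
       / herm (Z t) (Z t) ^+ 2))).
have E t : Z t != 0 -> Z' t != 0 -> hpoint (Z' t) = hpoint (Z t) ->
  exists2 a, a != 0 & Z' t = a *: Z t /\
    herm (Z' t) (Z t) / herm (Z t) (Z t) = a.
  move=> z0 z0' /(hpoint_eqP z0' z0) [a a0 e]; exists a => //; split=> //.
  by rewrite e hermZl mulfK // herm_neq0.
split; last first.
  by apply: filterS2 lZ lZ' => t [z0 ->] [z0' /esym e]; have [a a0 [? ->]] := E t z0 z0' e.
near=> t.
have [z0 ce] : Z t != 0 /\ c t = hpoint (Z t) by near: t.
have [z0' ce'] : Z' t != 0 /\ c t = hpoint (Z' t) by near: t.
have dZt : mxderiv Z t 1 (dZ t) by near: t.
have dZt' : mxderiv Z' t 1 (dZ' t) by near: t.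
have e : hpoint (Z' t) = hpoint (Z t) by rewrite -ce -ce'.
have [a a0 [_ ->]] := E t z0 z0' e; split=> //.
exact: cderivM (cderiv_herm dZt' dZt)
  (cderivV (herm_neq0 z0) (cderiv_herm dZt dZt)).
Unshelve. all: by end_near. Qed.

(** This allows generators found in different charts to be compared: a change of lift transports one
    frame to the other, by uniqueness of frames, and a common scalar drops out of [generator]. *)
Lemma generator_lift_unique c Z U A k Z' U' A' k' s :
  lifts c Z s -> (\near s, moving_frame Z U A k s) ->
  lifts c Z' s -> (\near s, moving_frame Z' U' A' k' s) ->
  generator (Z s) (U s) (A s) = generator (Z' s) (U' s) (A' s).
Proof.
move=> lZ fr lZ' fr'.
have dZ : \near s, mxderiv Z s 1 (k s *: Z s + U s).
  by apply: filterS fr => t [].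
have dZ' : \near s, mxderiv Z' s 1 (k' s *: Z' s + U' s).
  by apply: filterS fr' => t [].
have [nu [dnu [hnu e]]] := lifts_ratio lZ lZ' dZ dZ'.
have e1 : \near s, Z' s = nu s *: (Z s *m 1%:M).
  by apply: filterS e => t ->; rewrite mulmx1.
have W1 : (1%:M : 'M[C]_3) *m adj 1%:M = 1%:M by rewrite adj1 mulmx1.
have [Us As _] := moving_frame_unique fr' (moving_frame_gauge W1 hnu e1 fr).
have [n0 _] := nbhs_singleton hnu.
by rewrite Us As (nbhs_singleton e) !mulmx1 generatorZ.
Qed.

Lemma mxderiv_hproj c Z U A k s : lifts c Z s ->
  (\near s, moving_frame Z U A k s) ->
  let K := generator (Z s) (U s) (A s) in
  mxderiv (fun t => hproj (c t)) s 1 (hproj (c s) *m K - K *m hproj (c s)).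
Proof.
move=> lZ fr K.
have e : \near s, proj (Z s) = hproj (c s).
  by apply: filterS lZ => t [z0 ->]; rewrite /hproj proj_hcoord.
rewrite -(nbhs_singleton e); apply: (mxderiv_near e).
exact: mxderiv_proj (nbhs_singleton fr).
Qed.

(* Lifts of a point, of a unit tangent vector and of an acceleration
   orthogonal to it: [<a, u>] is imaginary. *)
Definition osculating (z u a : row) : Prop :=
  [/\ z != 0, herm u z = 0, herm a z = 0, herm u u = herm z z &
      conjc (herm a u) = - herm a u].

Theorem geodesic_generator (I : set R) c s0 : open I -> is_interval I ->
  conformal_geodesic I c -> I s0 ->
  exists z u a, [/\ c s0 = hpoint z, osculating z u a &
    forall s, I s -> let K := generator z u a in
      mxderiv (fun t => hproj (c t)) s 1 (hproj (c s) *m K - K *m hproj (c s))].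
Proof.
move=> oI itv hc Is0.
have frames s : I s -> exists Z U A k, lifts c Z s /\ circle_frame Z U A k s.
  move=> Is; have [j dj] := affine_dom_ex (c s).
  have [l [U [A [k fr]]]] := geodesic_circle_lift oI hc Is dj.
  by exists (affine_lift j \o (affine_coord j \o c)), U, A, k.
(* The chart may change along the curve, so a generator is chosen at each time separately. By
   uniqueness the choice coincides near every time with the generator of a single frame, and
   therefore has zero derivative. *)
have ex s : exists M : 'M[C]_3, I s -> exists Z U A k,
    [/\ lifts c Z s, circle_frame Z U A k s &
        M = generator (Z s) (U s) (A s)].
  have [Is|nI] := pselect (I s); last by exists 0.
  have [Z [U [A [k [l fr]]]]] := frames s Is.
  by exists (generator (Z s) (U s) (A s)) => _; exists Z, U, A, k.
have [K HK] := choice ex.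
have dK s : I s -> mxderiv K s 1 0.
  move=> Is; have [Z [U [A [k [l fr Ks]]]]] := HK s Is.
  have nI : \near s, I s by exact: open_nbhs_nbhs.
  have e : \near s, generator (Z s) (U s) (A s) = K s.
    have lt := near_join l; have frt := near_join fr.1.
    near=> t; have It : I t by near: t.
    have [Z' [U' [A' [k' [l' fr' ->]]]]] := HK t It.
    apply: (@generator_lift_unique c _ _ _ k _ _ _ k') => //; last exact: fr'.1.
      by near: t.
    by near: t.
  exact: mxderiv_near e (generator_constant fr).
have [Z [U [A [k [l fr Ks0]]]]] := HK s0 Is0.
have [z0 cz] := nbhs_singleton l.
have [_ dZ dU [UZ AZ] UU] := nbhs_singleton fr.1.
exists (Z s0), (U s0), (A s0); split=> //.
  by split=> //; exact: herm_accel_speed fr.1.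
move=> s Is /=; rewrite -Ks0 (mxderiv0_constant itv dK Is0 Is).
have [Z' [U' [A' [k' [l' fr' ->]]]]] := HK s Is.
exact: mxderiv_hproj l' fr'.1.
Unshelve. all: by end_near. Qed.

(** In chart [j] the image curve has the lift Z W / q, where q is entry j of Z W, so the gauge lemma
    applies with nu = 1 / q. Used with the inverse unitary, it makes the model curve a conformal
    geodesic because the given curve is one. *)
Lemma conformal_geodesic_hmap (I : set R) c Gamma (W : 'M[C]_3) :
  open I -> W *m adj W = 1%:M -> (forall s, I s -> Gamma s = hmap W (c s)) ->
  conformal_geodesic I c -> conformal_geodesic I Gamma.
Proof.
move=> oI WW GE hc s Is j dj x.
have nI : \near s, I s by exact: open_nbhs_nbhs.
have [i di] := affine_dom_ex (c s).
have [lZ cZ] := geodesic_circle_lift oI hc Is di.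
set Z := affine_lift i \o (affine_coord i \o c) in lZ cZ.
have [U [A [k fr]]] := cZ.
pose q t := (Z t *m W) ord0 j.
pose dq t := ((k t *: Z t + U t) *m W) ord0 j.
have GZ : \near s, Z s != 0 /\ Gamma s = hpoint (Z s *m W).
  apply: filterS2 nI lZ => t It [z0 ct]; split=> //.
  by rewrite GE // ct hmap_hpoint.
have hq : \near s, cderiv q s 1 (dq s).
  apply: filterS fr.1 => t [_ dZ _ _ _].
  have := mxderivM dZ (mxderiv_const W t 1) => /(_ ord0 j).
  by rewrite mulmx0 addr0.
have q0 : q s != 0.
  have [z0 e] := nbhs_singleton GZ; move: dj; rewrite e.
  by move/(affine_dom_hpoint j (mulmx_unit_neq0 WW z0)).
have nq0 : \near s, q s != 0.
  have [hr hi] := nbhs_singleton hq.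
  have cont (f : R -> R) d : is_derive s 1 f d -> f s != 0 -> \near s, f s != 0.
    move=> hf f0; have /differentiable_continuous cf : differentiable f s.
      by apply/derivable1_diffP.
    apply: (cf [set y | y != 0]).
    by apply: open_nbhs_nbhs; split; [exact: open_neq|].
  move: q0; rewrite eq_complex negb_and => /orP[] h0.
    apply: filterS (cont _ _ hr h0) => t ht.
    by rewrite eq_complex negb_and ht.
  apply: filterS (cont _ _ hi h0) => t ht.
  by rewrite eq_complex negb_and ht orbT.
have ndj : \near s, affine_dom j (Gamma s).
  apply: filterS2 GZ nq0 => t [z0 ->] qt.
  by apply/(affine_dom_hpoint j (mulmx_unit_neq0 WW z0)).
have hnu : \near s, (q s)^-1 != 0 /\
    cderiv (fun t => (q t)^-1) s 1 (- (dq s / q s ^+ 2)).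
  apply: filterS2 nq0 hq => t qt hqt; split; first by rewrite invr_eq0.
  exact: cderivV.
have e : \near s, (affine_lift j \o x) s = (q s)^-1 *: (Z s *m W).
  apply: filterS2 GZ nq0 => t [z0 Gt] qt.
  by rewrite /x /= Gt affine_lift_coord.
have [d1 d2 d3 us eqn] :=
  circle_frame_chart (circle_lift_gauge WW hnu e cZ).
split; [exact: ndj| |exact: us|exact: eqn].
case=> [_|[_|[_|n]]]; last by discriminate.
- exact: d1.
- exact: d2.
- exact: d3.
Qed.

End GeodesicLifts.

(** * Unitary isometries *)

Lemma near_eq_differentiable (R : realType) (V W : normedModType R)
    (f g : V -> W) (x : V) :
  (\near x, f x = g x) -> differentiable f x -> differentiable g x.
Proof.
move=> fg df; have [cf ef] := (diff_locallyP _ _).1 df.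
have E : g \o shift x = cst (g x) + 'd f x +o_ 0 id.
  apply/eqaddoP => e e0; have /eqaddoP /(_ e e0) h := ef.
  have fgs : \forall y \near (0 : V), f (y + x) = g (y + x).
    by move: fg; rewrite (near_shift 0 x); apply: filterS => y /=; rewrite subr0.
  apply: filterS2 fgs h => y; rewrite /= !fctE /= => <-.
  by rewrite (nbhs_singleton fg).
have dg := diff_unique cf E.
by apply/diff_locallyP; rewrite dg.
Qed.

(** * Rational functions over a fixed denominator, a class stable under differentiation *)

Section RationalFunctions.
Context (R : realType) (n : nat).
Local Notation V := 'rV[R]_n.+1.
Implicit Types (D f g : V -> R).

(** Polynomial expressions in the coordinates and 1 / D. As (1 / D)' = - D' / D^2 stays in the
    class, derivatives of all orders are handled by one induction. Polynomials are the case D =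
    1. *)
Inductive ratfun D : (V -> R) -> Prop :=
| RatCst c : ratfun D (fun=> c)
| RatCoord i : ratfun D (fun y => y ord0 i)
| RatAdd f g : ratfun D f -> ratfun D g -> ratfun D (fun y => f y + g y)
| RatMul f g : ratfun D f -> ratfun D g -> ratfun D (fun y => f y * g y)
| RatInv : ratfun D (fun y => (D y)^-1).

Lemma differentiable_ratfun D f x : differentiable D x -> D x != 0 ->
  ratfun D f -> differentiable f x.
Proof.
move=> dD D0; elim=> {f} [c|i|f g _ df _ dg|f g _ df _ dg|].
- exact: differentiable_cst.
- exact: differentiable_coord.
- exact: differentiableD.
- exact: differentiableM.
- exact: differentiableV.
Qed.

Lemma differentiable_polyfun f x : ratfun (fun=> 1) f -> differentiable f x.
Proof.
by apply: differentiable_ratfun; [exact: differentiable_cst|exact: oner_neq0].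
Qed.

Lemma polyfun_ratfun D f : ratfun (fun=> 1) f -> ratfun D f.
Proof.
elim=> {f} [c|i|f g _ df _ dg|f g _ df _ dg|].
- exact: RatCst.
- exact: RatCoord.
- exact: RatAdd.
- exact: RatMul.
- exact: RatCst.
Qed.

Lemma polyfun_deriv f v : ratfun (fun=> 1) f ->
  exists2 g, ratfun (fun=> 1) g & forall x, is_derive x v f (g x).
Proof.
elim=> {f} [c|i|f g rf [df rdf hf] rg [dg rdg hg]|f g rf [df rdf hf] rg [dg rdg hg]|].
- by exists (fun=> 0); [exact: RatCst|move=> x; exact: is_derive_const].
- exists (fun=> v ord0 i); [exact: RatCst|move=> x; exact: is_derive_entry].
- exists (fun y => df y + dg y); [exact: RatAdd|move=> x].
  exact: is_derive_add.
- exists (fun y => df y * g y + f y * dg y).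
    by apply: RatAdd; exact: RatMul.
  by move=> x; exact: is_derive_mul.
- by exists (fun=> 0); [exact: RatCst|move=> x; exact: is_derive_const].
Qed.

Lemma ratfun_deriv D f v : ratfun (fun=> 1) D -> ratfun D f ->
  exists2 g, ratfun D g & forall x, D x != 0 -> is_derive x v f (g x).
Proof.
move=> /(polyfun_deriv v) [dD rdD hD].
elim=> {f} [c|i|f g rf [df rdf hf] rg [dg rdg hg]|f g rf [df rdf hf] rg [dg rdg hg]|].
- by exists (fun=> 0); [exact: RatCst|move=> x _; exact: is_derive_const].
- exists (fun=> v ord0 i); [exact: RatCst|move=> x _; exact: is_derive_entry].
- exists (fun y => df y + dg y); [exact: RatAdd|move=> x D0].
  exact: is_derive_add (hf x D0) (hg x D0).
- exists (fun y => df y * g y + f y * dg y).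
    by apply: RatAdd; exact: RatMul.
  by move=> x D0; exact: is_derive_mul (hf x D0) (hg x D0).
- exists (fun y => -1 * (dD y * ((D y)^-1 * (D y)^-1))).
    apply: RatMul; first exact: RatCst.
    apply: RatMul; first exact: polyfun_ratfun.
    by apply: RatMul; exact: RatInv.
  move=> x D0; apply: (is_derive_eq (is_derive_inv D0 (hD x))).
  by field.
Qed.

Lemma open_polyfun_neq0 D : ratfun (fun=> 1) D -> open [set x | D x != 0].
Proof.
move=> rD; have cD : continuous D.
  by move=> x; apply: differentiable_continuous; exact: differentiable_polyfun.
have o : open [set y : R | y != 0] by exact: open_neq.
exact: open_comp (fun x _ => cD x) o.
Qed.

(** [F] is tied to rational functions only where D is nonzero; that set is open, so the partial
    derivatives of [F] are tied to rational functions on the same set and the induction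
    continues. *)
Lemma ratfun_smooth_on D m (F : V -> 'rV[R]_m.+1) (G : 'I_m.+1 -> V -> R) :
  ratfun (fun=> 1) D -> (forall i, ratfun D (G i)) ->
  (forall x i, D x != 0 -> F x ord0 i = G i x) ->
  smooth_on [set x | D x != 0] F.
Proof.
move=> rD rG FG k.
have diff (F' : V -> 'rV[R]_m.+1) (G' : 'I_m.+1 -> V -> R) : (forall i, ratfun D (G' i)) ->
    (forall x i, D x != 0 -> F' x ord0 i = G' i x) ->
    forall x, D x != 0 -> differentiable F' x.
  move=> rG' FG' x D0.
  have nD : \near x, D x != 0.
    by apply: open_nbhs_nbhs; split; [exact: open_polyfun_neq0|].
  have e : \near x, \sum_i G' i x *: delta_mx ord0 i = F' x.
    apply: filterS nD => y Dy; rewrite [RHS]row_sum_delta.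
    by apply: eq_bigr => i _; rewrite FG'.
  apply: (near_eq_differentiable e).
  rewrite (_ : (fun x => _) = \sum_i (fun x => G' i x *: delta_mx ord0 i)); last first.
    by apply/funext => y; rewrite fct_sumE.
  apply: differentiable_sum => i; apply: differentiableZl.
  apply: differentiable_ratfun D0 (rG' i).
  exact: differentiable_polyfun.
elim: k F G rG FG => [|k IH] F G rG FG /=.
  by move=> x D0; exact: differentiable_continuous (diff F G rG FG x D0).
split=> [x D0|i]; first exact: diff rG FG x D0.
have h l : exists g, ratfun D g /\
    forall x, D x != 0 -> is_derive x (delta_mx ord0 i) (G l) (g x).
  by have [g rg hg] := ratfun_deriv (delta_mx ord0 i) rD (rG l); exists g.
have [g hg] := choice h.
apply: (IH _ g) => [l|x l D0]; first by have [] := hg l.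
have dF : derivable F x (delta_mx ord0 i).
  exact/diff_derivable/(diff F G rG FG x D0).
have nD : \near x, D x != 0.
  by apply: open_nbhs_nbhs; split; [exact: open_polyfun_neq0|].
have e : \near x, G l x = F x ord0 l by apply: filterS nD => y Dy; rewrite FG.
have [_ hl] := hg l.
have h1 := near_eq_is_derive e (hl x D0).
rewrite -(@derive_val _ _ _ _ _ _ _ h1).
by rewrite derive_mx // mxE.
Qed.

End RationalFunctions.

Section UnitaryIsometries.
Context (R : realType) (W : 'M[R[i]]_3).
Local Notation C := R[i].
Local Notation V := 'rV[R]_4.
Context (WW : W *m adj W = 1%:M).

Definition chart_map (j k : 'I_3) (x : V) : V :=
  affine_coord k (hmap W (affine_point j x)).

Definition chart_image (j : 'I_3) (x : V) : 'rV[C]_3 := affine_lift j x *m W.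

Lemma hmap_affine_point j x :
  hmap W (affine_point j x) = hpoint (chart_image j x).
Proof. by rewrite affine_pointE hmap_hpoint ?affine_lift_neq0. Qed.

Lemma chart_domP j k x : affine_dom k (hmap W (affine_point j x)) <->
  chart_image j x ord0 k != 0.
Proof.
rewrite hmap_affine_point; apply: affine_dom_hpoint.
by rewrite mulmx_unit_neq0 ?affine_lift_neq0.
Qed.

Lemma chart_map_lift j k x : chart_image j x ord0 k != 0 ->
  affine_lift k (chart_map j k x) =
  (chart_image j x ord0 k)^-1 *: chart_image j x.
Proof. by move=> q0; rewrite /chart_map hmap_affine_point affine_lift_coord. Qed.

Lemma chart_image_poly j i :
  ratfun (fun=> 1) (fun x => complex.Re (chart_image j x ord0 i)) /\
  ratfun (fun=> 1) (fun x => complex.Im (chart_image j x ord0 i)).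
Proof.
pose cpoly (f : V -> C) := ratfun (fun=> 1) (fun x => complex.Re (f x)) /\
  ratfun (fun=> 1) (fun x => complex.Im (f x)).
have cadd f g : cpoly f -> cpoly g -> cpoly (fun x => f x + g x).
  move=> [h1 h2] [h3 h4]; split.
    have E (a b : C) : complex.Re (a + b) = complex.Re a + complex.Re b.
      by case: a b => ? ? [].
    under [X in ratfun _ X]eq_fun do rewrite E.
    exact: RatAdd.
  have E (a b : C) : complex.Im (a + b) = complex.Im a + complex.Im b.
    by case: a b => ? ? [].
  under [X in ratfun _ X]eq_fun do rewrite E.
  exact: RatAdd.
have cmul f (c : C) : cpoly f -> cpoly (fun x => f x * c).
  move=> [h1 h2]; split.
    have E (a : C) : complex.Re (a * c) =
        complex.Re a * complex.Re c + complex.Im a * - complex.Im c.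
      by case: a c => ? ? [? ?] /=; ring.
    under [X in ratfun _ X]eq_fun do rewrite E.
    by apply: RatAdd; apply: RatMul => //; exact: RatCst.
  have E (a : C) : complex.Im (a * c) =
      complex.Re a * complex.Im c + complex.Im a * complex.Re c.
    by case: a c => ? ? [? ?] /=; ring.
  under [X in ratfun _ X]eq_fun do rewrite E.
  by apply: RatAdd; apply: RatMul => //; exact: RatCst.
have lin l : cpoly (fun x => affine_lift j x ord0 l).
  have [l' ->|->] := unliftP j l; rewrite /cpoly.
    split; under [X in ratfun _ X]eq_fun do rewrite mxE liftK /=; exact: RatCoord.
  split; under [X in ratfun _ X]eq_fun do rewrite affine_lift_j /=; exact: RatCst.
have : cpoly (fun x => chart_image j x ord0 i).
  have -> : (fun x => chart_image j x ord0 i) = fun x =>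
      affine_lift j x ord0 ord0 * W ord0 i
      + (affine_lift j x ord0 (lift ord0 ord0) * W (lift ord0 ord0) i
      + (affine_lift j x ord0 (lift ord0 (lift ord0 ord0))
           * W (lift ord0 (lift ord0 ord0)) i + 0)).
    by apply/funext => x; rewrite [LHS]mxE !big_ord_recl big_ord0.
  apply: (cadd); first by apply: cmul; exact: lin.
  apply: (cadd); first by apply: cmul; exact: lin.
  apply: (cadd); first by apply: cmul; exact: lin.
  by split; exact: RatCst.
by [].
Qed.

(** Between charts the map is a quotient p / q of complex polynomials. Writing it as p conj(q) /
    |q|^2 gives real polynomial numerators over D = |q|^2, and D is nonzero exactly on the
    domain. *)
Lemma smooth_hmap : smooth_map (hmap W).
Proof.
move=> j k U.
pose q x := chart_image j x ord0 k.
pose D x := complex.Re (q x) * complex.Re (q x) + complex.Im (q x) * complex.Im (q x).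
have [qr qi] := chart_image_poly j k.
have rD : ratfun (fun=> 1) D by apply: RatAdd; exact: RatMul.
have Dq x : (D x != 0) = (q x != 0).
  rewrite /D -!expr2 paddr_eq0 ?sqr_ge0 // !expf_eq0 /= eq_complex.
  by [].
have -> : U = [set x | D x != 0].
  apply/seteqP; split=> x; rewrite /U /= Dq => h.
    exact/(chart_domP j k x).1.
  exact/(chart_domP j k x).2.
split; first exact: open_polyfun_neq0.
pose p (m : 'I_4) x := chart_image j x ord0 (lift k (inord m./2 : 'I_2)).
pose G (m : 'I_4) x := if odd m
  then (complex.Im (p m x) * complex.Re (q x)
        + -1 * (complex.Re (p m x) * complex.Im (q x))) * (D x)^-1
  else (complex.Re (p m x) * complex.Re (q x)
        + complex.Im (p m x) * complex.Im (q x)) * (D x)^-1.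
apply: (ratfun_smooth_on (G := G) rD) => [m|x m].
  have [pr pi] := chart_image_poly j (lift k (inord m./2 : 'I_2)).
  have P := @polyfun_ratfun _ _ D.
  rewrite /G; case: odd; apply: RatMul; try exact: RatInv.
    apply: RatAdd; first by apply: RatMul; exact: P.
    by apply: RatMul; [exact: RatCst|apply: RatMul; exact: P].
  by apply: RatAdd; apply: RatMul; exact: P.
rewrite Dq => q0.
have hm : (m./2 < 2)%N by rewrite ltn_half_double.
have E : Complex (chart_map j k x ord0 (inord m./2.*2))
    (chart_map j k x ord0 (inord m./2.*2.+1)) = (q x)^-1 * p m x.
  have := congr1 (fun v : 'rV[C]_3 => v ord0 (lift k (inord m./2 : 'I_2)))
    (chart_map_lift q0).
  by rewrite [LHS]mxE [X in _ = X -> _]mxE liftK inordK.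
have hl : (m./2.*2.+1 < 4)%N by rewrite -[4%N]/(2.*2) ltn_Sdouble.
have em : m = if odd m then inord m./2.*2.+1 else inord m./2.*2.
  apply/val_inj; rewrite /= -[in LHS](odd_double_half m).
  by case: odd; rewrite !inordK // ltnW.
have em' (y : V) : y ord0 m =
    y ord0 (if odd m then inord m./2.*2.+1 else inord m./2.*2).
  by congr (y _ _).
rewrite -[LHS]/(chart_map j k x ord0 m) em'.
move: E; rewrite /G /D; case: (p m x) (q x) q0 => a b [c d] _ /= [E1 E2].
have z : c * c + d * d = c ^+ 2 + d ^+ 2 by rewrite !expr2.
by case: odd; rewrite ?E1 ?E2 z; ring.
Qed.

(** The horizontal lift of the image of v is q^-1 times the horizontal lift of v moved by W; the
    factor |q|^-2 appears in both the numerator and the denominator of [pairing_hlift]. *)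
Lemma hmap_preserves_metric : preserves_metric (hmap W).
Proof.
move=> j k x /(chart_domP j k x).1 q0 f v w.
have hor v' : hlift k (f x) ('D_v' f x) =
    (chart_image j x ord0 k)^-1 *: (hlift j x v' *m W).
  pose q y := chart_image j y ord0 k.
  have [qr qi] := chart_image_poly j k.
  have nq : \near x, q x != 0.
    have op := open_polyfun_neq0 (RatAdd (RatMul qr qr) (RatMul qi qi)).
    have e y : (complex.Re (q y) * complex.Re (q y)
      + complex.Im (q y) * complex.Im (q y) != 0) = (q y != 0).
      by rewrite -!expr2 paddr_eq0 ?sqr_ge0 // !expf_eq0 /= eq_complex.
    have h : nbhs x [set y | complex.Re (q y) * complex.Re (q y)
      + complex.Im (q y) * complex.Im (q y) != 0].
      by apply: open_nbhs_nbhs; split; [exact: op|rewrite /= e].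
    by apply: filterS h => y /=; rewrite e.
  have dI : mxderiv (chart_image j) x v' (affine_lin j v' *m W).
    have dl : mxderiv (fun y => affine_lift j y) x v' (affine_lin j v').
      under [X in mxderiv X]eq_fun do rewrite affine_liftE.
      rewrite -[affine_lin _ _]add0r; apply: mxderivD; first exact: mxderiv_const.
      have := mxderiv_affine_lin j (@derivable_id _ _ x v').
      by rewrite derive_id.
    apply: mxderiv_eq; first exact: mxderivM dl (mxderiv_const W x v').
    by rewrite mulmx0 addr0.
  have [dnu hnu] : exists dnu, cderiv (fun y => (q y)^-1) x v' dnu.
    by eexists; apply: cderivV => //; exact: dI.
  have e : \near x, (q x)^-1 *: chart_image j x = affine_lift k (f x).
    by apply: filterS nq => y q0y; rewrite /f /= -/(chart_map j k y) chart_map_lift.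
  have := mxderiv_near e (mxderivZ hnu dI).
  move=> h; have := mxderivB h (mxderiv_const (delta_mx ord0 k) x v').
  rewrite subr0.
  under [X in mxderiv X]eq_fun do rewrite affine_liftE addrC addKr.
  move=> /affine_lin_mxderiv [_ E].
  rewrite /hlift /hcoef E.
  have -> : affine_lift k (f x) = (q x)^-1 *: chart_image j x.
    by rewrite (nbhs_singleton e).
  have Z0 : herm (affine_lift j x) (affine_lift j x) != 0 by exact: herm_lift_neq0.
  have cq0 : conjc (q x)^-1 != 0 by rewrite conjc_eq0 invr_eq0.
  have q0' : (q x)^-1 != 0 by rewrite invr_eq0.
  rewrite !hermDl !hermZl !hermZr /chart_image !herm_mulmx // mulmxBl -scalemxAl.
  move: (herm (affine_lift j x) (affine_lift j x)) Z0
    (herm (affine_lin j v') (affine_lift j x)) => N N0 a.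
  move: (affine_lin _ _ *m _) (affine_lift _ _ *m _) (q x)^-1 (conjc _) q0' cq0.
  move=> X Y nu cnu nu0 cnu0.
  by apply/rowP => i; rewrite !mxE; field; rewrite ?nu0 ?cnu0 ?N0.
have P k' (y v1 v2 : V) : pairing (fubini_study y) v1 v2 = complex.Re
    (herm (hlift k' y v1) (hlift k' y v2)
      / herm (affine_lift k' y) (affine_lift k' y)).
  rewrite (pairing_hlift k') herm_lift; move: (fsN_neq0 y).
  by case: (herm _ _) => a b n0 /=; field.
rewrite [LHS](P k) [RHS](P j); congr (complex.Re _).
have nu0 : (chart_image j x ord0 k)^-1 != 0 by rewrite invr_eq0.
have EN := congr2 (@herm R 3) (chart_map_lift q0) (chart_map_lift q0).
have EH := congr2 (@herm R 3) (hor v) (hor w).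
apply: etrans (congr2 (fun a b => a / b) EH EN) _.
move: (chart_image j x ord0 k)^-1 nu0 => nu nu0.
rewrite -[chart_image j x]/(affine_lift j x *m W) !(herm_gauge _ _ _ WW).
by rewrite -mulf_div divff ?mul1r // mulf_neq0 ?conjc_eq0.
Qed.

End UnitaryIsometries.

Lemma hmap_isometry (R : realType) (W : 'M[R[i]]_3) :
  W *m adj W = 1%:M -> fs_isometry (hmap W).
Proof.
move=> WW; have W'W : adj W *m adj (adj W) = 1%:M by rewrite adjK; exact: mulmx1C.
split; [exact: hmap_preserves_metric|split; first exact: smooth_hmap].
exists (hmap (adj W)); split; [exact: hmapK| |exact: smooth_hmap].
by have := hmapK W'W; rewrite adjK.
Qed.

(** * Osculating frames and congruence *)

Section OsculatingFrame.
Context (R : realType).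
Local Notation C := R[i].
Local Notation vec := 'rV[C]_3.
Implicit Types (z u a b : vec) (F W K : 'M[C]_3).

Definition rows3 z u b : 'M[C]_3 := \matrix_(i < 3) nth 0 [:: z; u; b] i.

Lemma rows3_adj z u b v w c :
  rows3 z u b *m adj (rows3 v w c) = \matrix_(i < 3, j < 3)
    herm (nth 0 [:: z; u; b] i) (nth 0 [:: v; w; c] j).
Proof.
apply/matrixP => i j; rewrite !mxE hermE; apply: eq_bigr => k _.
by rewrite adjE !mxE.
Qed.

Lemma rows3_unitary z u b : herm z z = 1 -> herm u u = 1 -> herm b b = 1 ->
  herm u z = 0 -> herm b z = 0 -> herm b u = 0 ->
  rows3 z u b *m adj (rows3 z u b) = 1%:M.
Proof.
move=> zz uu bb uz bz bu; rewrite rows3_adj.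
have zu : herm z u = 0 by rewrite hermC uz conjc0.
have zb : herm z b = 0 by rewrite hermC bz conjc0.
have ub : herm u b = 0 by rewrite hermC bu conjc0.
apply/matrixP => i j; rewrite !mxE.
by case: i j => [[|[|[|//]]] hi] [[|[|[|//]]] hj] /=;
  rewrite ?zz ?uu ?bb ?uz ?bz ?bu ?zu ?zb ?ub.
Qed.

(* The witness is the conjugate of the cross product of [z] and [u]. *)
Lemma orthonormal_complement z u : herm z z = 1 -> herm u u = 1 ->
  herm u z = 0 -> exists b, [/\ herm b b = 1, herm b z = 0 & herm b u = 0].
Proof.
move=> zz uu uz.
pose z_ k := z ord0 (inord k); pose u_ k := u ord0 (inord k).
have sum3 (f : 'I_3 -> C) : \sum_i f i = f (inord 0) + f (inord 1) + f (inord 2).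
  rewrite !big_ord_recl big_ord0 addr0 addrA.
  by congr (_ + _ + _); congr f; apply/val_inj; rewrite /= inordK.
pose b : vec := \row_k nth 0 [:: conjc (z_ 1%N * u_ 2%N - z_ 2%N * u_ 1%N);
  conjc (z_ 2%N * u_ 0%N - z_ 0%N * u_ 2%N);
  conjc (z_ 0%N * u_ 1%N - z_ 1%N * u_ 0%N)] k.
have hb (v : vec) : herm b v =
    conjc ((z_ 1%N * u_ 2%N - z_ 2%N * u_ 1%N) * v ord0 (inord 0)
    + (z_ 2%N * u_ 0%N - z_ 0%N * u_ 2%N) * v ord0 (inord 1)
    + (z_ 0%N * u_ 1%N - z_ 1%N * u_ 0%N) * v ord0 (inord 2)).
  by rewrite hermE sum3 !mxE !inordK //= -!rmorphM -!rmorphD.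
exists b; split.
- have h (v w : vec) : herm v w = v ord0 (inord 0) * conjc (w ord0 (inord 0))
      + v ord0 (inord 1) * conjc (w ord0 (inord 1))
      + v ord0 (inord 2) * conjc (w ord0 (inord 2)) by rewrite hermE sum3.
  have zu : herm z u = 0 by rewrite hermC uz conjc0.
  transitivity (herm z z * herm u u - herm z u * herm u z); last first.
    by rewrite zz uu zu mul0r subr0 mulr1.
  rewrite !h !mxE !inordK //= !conjcK !rmorphB !rmorphM /=.
  rewrite -!/(z_ 0%N) -!/(z_ 1%N) -!/(z_ 2%N) -!/(u_ 0%N) -!/(u_ 1%N) -!/(u_ 2%N).
  move: (conjc (z_ _)) (conjc (z_ _)) (conjc (z_ _)).
  move: (conjc (u_ _)) (conjc (u_ _)) (conjc (u_ _)).
  move: (z_ _) (z_ _) (z_ _) (u_ _) (u_ _) (u_ _) => ? ? ? ? ? ? ? ? ? ? ? ?.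
  by ring.
- by rewrite hb -!/(z_ _) (_ : _ + _ = 0) ?conjc0 //; ring.
- by rewrite hb -!/(u_ _) (_ : _ + _ = 0) ?conjc0 //; ring.
Qed.

(** For osculating data <a, u> is purely imaginary, so its imaginary part alpha retains all of
    it. *)
Definition torsion z u a : R := complex.Im (herm a u / herm z z).
Definition curvature2 z a : R := complex.Re (herm a a / herm z z).

Lemma real_complex_eq0 (x : R) : (x%:C%C == 0) = (x == 0).
Proof. by rewrite eq_complex /= eqxx andbT. Qed.

(** Gram-Schmidt applied to z, u, a: the part of a orthogonal to u over the complex numbers has
    squared length |a|^2 - alpha^2. If it vanishes, the third vector is any unit complement. The
    final inequality is the Cauchy-Schwarz inequality for a and u. *)
Lemma osculating_frame z u a : osculating z u a ->
  exists (n : C) (b : vec), [/\ n != 0,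
    rows3 (n *: z) (n *: u) b *m adj (rows3 (n *: z) (n *: u) b) = 1%:M,
    n *: a = ('i * (torsion z u a)%:C)%C *: (n *: u)
      + (Num.sqrt (curvature2 z a - torsion z u a ^+ 2))%:C%C *: b &
    torsion z u a ^+ 2 <= curvature2 z a].
Proof.
move=> [z0 uz az uu au]; pose n := (Num.sqrt (norm2 z))%:C%C.
set al := torsion z u a; set m := Num.sqrt _.
have N0 : 0 < norm2 z by rewrite lt0r norm2_eq0 z0 norm2_ge0.
have n0 : n != 0 by rewrite /n real_complex_eq0 gt_eqF // sqrtr_gt0.
have nn : n * n = herm z z.
  by rewrite /n -rmorphM -expr2 sqr_sqrtr ?ltW // herm_norm2.
have nC : conjc n^-1 = n^-1 by rewrite fmorphV /= oppr0.
have hs (v w : vec) : herm (n^-1 *: v) (n^-1 *: w) = herm v w / herm z z.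
  by rewrite hermZl hermZr nC -nn invfM; ring.
have zz1 : herm (n^-1 *: z) (n^-1 *: z) = 1 by rewrite hs divff // herm_neq0.
have uu1 : herm (n^-1 *: u) (n^-1 *: u) = 1 by rewrite hs uu divff // herm_neq0.
have uz0 : herm (n^-1 *: u) (n^-1 *: z) = 0 by rewrite hs uz mul0r.
have az0 : herm (n^-1 *: a) (n^-1 *: z) = 0 by rewrite hs az mul0r.
have auE : herm (n^-1 *: a) (n^-1 *: u) = ('i * al%:C)%C.
  rewrite hs /al /torsion.
  have : conjc (herm a u / herm z z) = - (herm a u / herm z z).
    by rewrite rmorphM fmorphV /= au -hermC mulNr.
  case: (_ / _) => x y [] /= /eqP; rewrite -addr_eq0 -mulr2n mulrn_eq0 /=.
  by move=> /eqP ->; apply/eqP; rewrite eq_complex /=; apply/andP; split;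
    apply/eqP; ring.
have aaE : herm (n^-1 *: a) (n^-1 *: a) = (curvature2 z a)%:C%C.
  rewrite hs /curvature2 !herm_norm2 -fmorphV -rmorphM.
  by [].
suff [b [h1 h2 h3]] : exists b, [/\ rows3 (n^-1 *: z) (n^-1 *: u) b *m
      adj (rows3 (n^-1 *: z) (n^-1 *: u) b) = 1%:M,
    n^-1 *: a = ('i * al%:C)%C *: (n^-1 *: u) + (m%:C)%C *: b &
    0 <= curvature2 z a - al ^+ 2].
  by exists n^-1, b; rewrite invr_eq0 -subr_ge0.
move: (n^-1 *: z) (n^-1 *: u) (n^-1 *: a) zz1 uu1 uz0 az0 auE aaE.
move=> {uz az uu au hs z0 N0 n0 nn nC} z1 u1 a1 zz uu uz az au aa.
pose d := a1 - ('i * al%:C)%C *: u1.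
have iC : conjc ('i * al%:C)%C = - ('i * al%:C)%C.
  by apply/eqP; rewrite eq_complex /=; apply/andP; split; apply/eqP; ring.
have dz : herm d z1 = 0 by rewrite /d hermDl hermNl hermZl az uz mulr0 subr0.
have du : herm d u1 = 0 by rewrite /d hermDl hermNl hermZl au uu mulr1 subrr.
have dd : herm d d = (curvature2 z a - al ^+ 2)%:C%C.
  rewrite {2}/d hermDr hermNr hermZr du mulr0 subr0 /d hermDl hermNl hermZl aa.
  rewrite hermC au iC.
  by apply/eqP; rewrite eq_complex /=; apply/andP; split; apply/eqP; ring.
have ge0 : 0 <= curvature2 z a - al ^+ 2.
  have := norm2_ge0 d; rewrite -[norm2 d]/(complex.Re (norm2 d)%:C%C).
  by rewrite -herm_norm2 dd.
have m2 : m * m = curvature2 z a - al ^+ 2 by rewrite -expr2 sqr_sqrtr.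
have [m0|m0] := eqVneq m 0.
  have d0 : d = 0.
    by apply/eqP; rewrite -norm2_eq0 /norm2 dd -m2 m0 mul0r.
  have [b [bb bz bu]] := orthonormal_complement zz uu uz.
  exists b; split; [exact: rows3_unitary| |exact: ge0].
  have -> : (m%:C)%C = 0 :> C by rewrite m0.
  rewrite [X in _ + X](_ : _ = 0) ?addr0; last first.
    by apply/rowP => i; rewrite !mxE mul0r.
  by apply/eqP; rewrite -subr_eq0 -/d d0.
have mc0 : (m%:C)%C != 0 :> C by rewrite real_complex_eq0.
have mC : conjc (m%:C)^-1%C = (m%:C)^-1%C by rewrite fmorphV /= oppr0.
exists ((m%:C)^-1%C *: d); split; last exact: ge0.
  apply: rows3_unitary => //; rewrite ?hermZl ?dz ?du ?mulr0 //.
  by rewrite hermZr mC dd -m2 rmorphM; field.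
by rewrite scalerA divff // scale1r /d addrC subrK.
Qed.

Lemma generator_mulmx W z u a : W *m adj W = 1%:M ->
  generator (z *m W) (u *m W) (a *m W) = adj W *m generator z u a *m W.
Proof.
move=> WW; have W'W : adj W *m W = 1%:M by exact: mulmx1C.
have o (v w : vec) : outer (z *m W) (v *m W) (w *m W) =
    adj W *m outer z v w *m W.
  rewrite /outer herm_mulmx // adjM -scalemxAr -scalemxAl.
  by rewrite !mulmxA.
rewrite /generator (o z u) (o u z) (o u a) (o a u) (o z z).
rewrite (herm_mulmx _ _ WW) (herm_mulmx _ _ WW).
move: (herm a u / _) (outer z z z) (outer _ z u) (outer _ u z) (outer _ u a)
  (outer _ a u) => q zz zu uz ua au.
rewrite !(mulmxBr, mulmxDr, mulmxBl, mulmxDl) -scalemxAr -scalemxAl.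
by rewrite !mulNmx mulmxBr mulmxBl mulmx1 W'W.
Qed.

(** With equal invariants the accelerations have the same coefficients in their unitary frames, so
    the matrix taking one frame to the other also takes one acceleration to the other, up to the
    scale factors that [proj] and [generator] ignore. *)
Lemma osculating_match z u a z1 u1 a1 :
  osculating z u a -> osculating z1 u1 a1 ->
  torsion z u a = torsion z1 u1 a1 -> curvature2 z a = curvature2 z1 a1 ->
  exists W, [/\ W *m adj W = 1%:M, proj z = adj W *m proj z1 *m W &
    generator z u a = adj W *m generator z1 u1 a1 *m W].
Proof.
move=> o o1 et ec.
have [n [b [n0 FF E _]]] := osculating_frame o.
have [n1 [b1 [n10 F1 E1 _]]] := osculating_frame o1.
rewrite et ec in E.
set G1 := rows3 _ _ b1 in F1; set G := rows3 _ _ b in FF.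
pose W := adj G1 *m G.
have WW : W *m adj W = 1%:M.
  rewrite /W adjM adjK mulmxA -(mulmxA (adj G1)) FF mulmx1.
  exact: mulmx1C.
have GW : G1 *m W = G by rewrite /W mulmxA F1 mul1mx.
have rE (i : 'I_3) : row i G1 *m W = row i G by rewrite -row_mul GW.
have r3 (x y c : vec) (i : 'I_3) : row i (rows3 x y c) = nth 0 [:: x; y; c] i.
  by apply/rowP => j; rewrite !mxE.
have ez : n1 *: z1 *m W = n *: z by have := rE (inord 0); rewrite !r3 inordK.
have eu : n1 *: u1 *m W = n *: u by have := rE (inord 1); rewrite !r3 inordK.
have eb : b1 *m W = b by have := rE (inord 2); rewrite !r3 inordK.
have ea : n1 *: a1 *m W = n *: a by rewrite E1 E mulmxDl -!scalemxAl eb scalemxAl eu.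
exists W; split; first exact: WW.
  have e := congr1 (fun X => adj W *m X *m W) (projZ z1 n10).
  have e' := etrans (proj_mulmx (n1 *: z1) WW) e.
  exact: etrans (esym (projZ z n0)) (etrans (congr1 _ (esym ez)) e').
have e := congr1 (fun X => adj W *m X *m W) (generatorZ z1 u1 a1 n10).
have e' := etrans (generator_mulmx (n1 *: z1) (n1 *: u1) (n1 *: a1) WW) e.
rewrite ez eu ea in e'.
exact: etrans (esym (generatorZ z u a n0)) e'.
Qed.

Lemma adj_proj z : adj (proj z) = proj z.
Proof.
rewrite /proj adjZ adjM adjK; congr (_ *: _).
by rewrite fmorphV /= -hermC.
Qed.

Lemma adj_hproj (p : CP2 R) : adj (hproj p) = hproj p.
Proof. exact: adj_proj. Qed.

Lemma mulmx_generator z u a (x : vec) : let n := herm z z in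
  x *m generator z u a = (herm x z / n) *: u - (herm x u / n) *: z
    + (herm x u / n) *: a - (herm x a / n) *: u
    - (herm a u / n) *: (x - (herm x z / n) *: z).
Proof.
move=> n.
have mo (v w : vec) : x *m outer z v w = (herm x v / n) *: w.
  by rewrite /outer -scalemxAr mulmxA mul_adj mul_scalar_mx scalerA mulrC.
rewrite /generator -/n; move: (mo z u) (mo u z) (mo u a) (mo a u) (mo z z).
move: (herm a u / n) (outer z z z) (outer z z u) (outer z u z) (outer z u a)
  (outer z a u) => q x1 x2 x3 x4 x5 e1 e2 e3 e4 e5.
rewrite -e1 -e2 -e3 -e4 -e5.
by rewrite !(mulmxBr, mulmxDr) -scalemxAr mulmxBr mulmx1.
Qed.

(* A skew-Hermitian traceless matrix is determined by its values on [z] and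
   [z K], provided these are orthogonal. *)
Lemma generator_of_skew z K : adj K = - K -> \tr K = 0 -> z != 0 ->
  herm (z *m K) z = 0 -> herm (z *m K) (z *m K) = herm z z ->
  osculating z (z *m K) (z *m K *m K + z) /\
  K = generator z (z *m K) (z *m K *m K + z).
Proof.
(* Along an orbit u' = u K up to the connection form, while the frame equation reads u' = a - z;
   this dictates [a]. *)
move=> Ks Kt z0 uz uu; set u := z *m K in uz uu *; set a := u *m K + z.
have hK (v w : vec) : herm (v *m K) w = - herm v (w *m K).
  by rewrite /herm adjM Ks mulNmx mulmxN mulmxA [in RHS]mxE opprK.
have zu : herm z u = 0 by rewrite hermC uz conjc0.
have az : herm a z = 0.
  by rewrite /a hermDl hK -/u uu addNr.
have auC : conjc (herm a u) = - herm a u.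
  by rewrite /a hermDl zu addr0 -hermC (hK u u) opprK.
have osc : osculating z u a by split.
split=> //; set M := generator z u a.
have al : herm u a = - herm a u by rewrite hermC auC.
have za : herm z a = 0 by rewrite hermC az conjc0.
have N0 := herm_neq0 z0.
have N1 : herm z z / herm z z = 1 by rewrite divff.
have zM : z *m M = u.
  rewrite /M mulmx_generator zu za N1; move: (herm a u / _) => q.
  by apply/rowP => i; rewrite !mxE; ring.
have uM : u *m M = u *m K.
  have -> : u *m K = a - z by rewrite /a addrK.
  rewrite /M mulmx_generator uz uu N1 al mulNr; move: (herm a u / _) => q.
  by apply/rowP => i; rewrite !mxE; ring.
have adjo (v w : vec) : adj (outer z v w) = outer z w v.
  by rewrite /outer adjZ adjM adjK; congr (_ *: _); rewrite fmorphV /= -hermC.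
have nC : conjc (herm z z) = herm z z by rewrite -hermC.
have qC : conjc (herm a u / herm z z) = - (herm a u / herm z z).
  by rewrite rmorphM fmorphV /= auC nC mulNr.
have Ms : adj M = - M.
  have := adjo z z; have := adjo a u; have := adjo u a; have := adjo u z.
  have := adjo z u; move: qC; rewrite /M /generator.
  move: (herm a u / _) (outer z z u) (outer z u z) (outer z u a)
    (outer z a u) (outer z z z) => q x1 x2 x3 x4 x5 qC e1 e2 e3 e4 e5.
  rewrite adjB adjB adjD adjB adjZ adjB adj1 e1 e2 e3 e4 e5 qC.
  by apply/matrixP => i j; rewrite !mxE; ring.
have tro (v w : vec) : \tr (outer z v w) = herm w v / herm z z.
  by rewrite /outer mxtraceZ mxtrace_mulC mul_adj mxtrace_scalar mulr1n mulrC.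
have Mt : \tr M = 0.
  have := tro z z; have := tro a u; have := tro u a; have := tro u z.
  have := tro z u; rewrite uz zu al N1 mulNr mul0r /M /generator.
  move: (herm a u / _) (outer z z u) (outer z u z) (outer z u a)
    (outer z a u) (outer z z z) => q x1 x2 x3 x4 x5 e1 e2 e3 e4 e5.
  rewrite linearB linearB linearD linearB /= linearZ linearB /= mxtrace1.
  by rewrite e1 e2 e3 e4 e5; ring.
have [n [b [_ FF _ _]]] := osculating_frame osc; set F := rows3 _ _ _ in FF.
pose D := K - M.
suff D0 : D = 0 by apply/eqP; rewrite -subr_eq0 -/D D0.
have zD : z *m D = 0 by rewrite /D mulmxBr zM subrr.
have uD : u *m D = 0 by rewrite /D mulmxBr uM subrr.
have Ds : adj D = - D by rewrite /D adjB Ks Ms -opprD.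
have Dt : \tr D = 0 by rewrite /D raddfB /= Kt Mt subrr.
have F'F : adj F *m F = 1%:M by exact: mulmx1C.
(* In a unitary frame through z and u, the first two rows of the difference vanish; skewness then
   removes the first two columns, and the trace condition the last entry. *)
pose E := F *m D *m adj F.
have row0 (i : 'I_3) : (i < 2)%N -> row i (F *m D) = 0.
  rewrite row_mul; have -> : row i F = nth 0 [:: n *: z; n *: u; b] i.
    by apply/rowP => j; rewrite !mxE.
  by case: i => [[|[|[|//]]] hi] //= _; rewrite -scalemxAl ?zD ?uD scaler0.
have E0 (i j : 'I_3) : (i < 2)%N -> E i j = 0.
  move=> hi; have := row0 i hi => /rowP h.
  rewrite /E mxE big1 // => k _; have := h k; rewrite !mxE => ->.
  by rewrite mul0r.
have Es : adj E = - E by rewrite /E !adjM adjK Ds mulNmx mulmxN mulmxA.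
have Et : \tr E = 0.
  by rewrite /E mxtrace_mulC mulmxA F'F mul1mx.
have EE : E = 0.
  apply/matrixP => i j; rewrite [RHS]mxE.
  have [hi|hi] := ltnP i 2; first exact: E0.
  have [hj|hj] := ltnP j 2.
    have := congr1 (fun X : 'M[C]_3 => X i j) Es; rewrite adjE (E0 j i hj) conjc0 mxE.
    by move=> /esym/eqP; rewrite oppr_eq0 => /eqP.
  have e2 (k : 'I_3) : (2 <= k)%N -> k = ord_max.
    by move=> hk; apply/val_inj; apply/eqP; rewrite eqn_leq hk -ltnS ltn_ord.
  rewrite (e2 i hi) (e2 j hj).
  move: Et; rewrite /mxtrace !big_ord_recr big_ord0 /=.
  by rewrite E0 // E0 // !add0r.
by rewrite -[D]mul1mx -F'F -[_ *m D]mulmx1 -F'F -!mulmxA (mulmxA F) (mulmxA (F *m D))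
  -/E EE !(mul0mx, mulmx0).
Qed.

(** The difference D satisfies the same linear equation, so (D^2)' = [D^2, K] has trace zero and
    tr(D^2) stays at its initial value 0. For Hermitian D this trace is the sum of the squared norms
    of the rows. *)
Lemma commutator_ode_unique (I : set R) (P Q : R -> 'M[C]_3) K s0 s :
  is_interval I -> I s0 -> I s ->
  (forall t, adj (P t) = P t) -> (forall t, adj (Q t) = Q t) ->
  (forall t, I t -> mxderiv P t 1 (P t *m K - K *m P t)) ->
  (forall t, I t -> mxderiv Q t 1 (Q t *m K - K *m Q t)) ->
  P s0 = Q s0 -> P s = Q s.
Proof.
move=> itv I0 Is aP aQ dP dQ e0.
pose D t := P t - Q t.
have dD t : I t -> mxderiv D t 1 (D t *m K - K *m D t).
  move=> It; apply: mxderiv_eq (mxderivB (dP t It) (dQ t It)) _.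
  rewrite /D mulmxBl mulmxBr.
  move: (P t *m K) (K *m P t) (Q t *m K) (K *m Q t) => x1 x2 x3 x4.
  by apply/matrixP => i j; rewrite !mxE; ring.
(* The trace is packed as a 1 by 1 matrix so that [mxderiv0_constant] applies. *)
pose f t : 'M[C]_1 := (\tr (D t *m D t))%:M.
have df t : I t -> mxderiv f t 1 0.
  move=> It i j; rewrite !ord1 mxE.
  have h := mxderivM (dD t It) (dD t It).
  have tr0 (X : 'M[C]_3) :
      \tr ((X *m K - K *m X) *m X + X *m (X *m K - K *m X)) = 0.
    rewrite mulmxBl mulmxBr linearD linearB linearB /= -!mulmxA.
    have -> : \tr (K *m (X *m X)) = \tr (X *m (X *m K)).
      by rewrite mxtrace_mulC mulmxA.
    by rewrite addrC addrA subrK subrr.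
  rewrite -(tr0 (D t)) /f.
  under [X in cderiv X]eq_fun do rewrite mxE eqxx mulr1n.
  by apply: cderiv_sum => k; exact: h.
have := mxderiv0_constant itv df I0 Is => /matrixP /(_ ord0 ord0).
have D0 : D s0 = 0 by rewrite /D e0 subrr.
rewrite mxE [X in _ = X -> _]mxE eqxx !mulr1n D0 mul0mx mxtrace0 => /esym tr0.
suff : D s = 0 by move/eqP; rewrite subr_eq0 => /eqP.
have aD : adj (D s) = D s by rewrite /D adjB aP aQ.
apply/row_matrixP => i; rewrite row0; apply/eqP; rewrite -norm2_eq0.
have sum0 : \sum_k norm2 (row k (D s)) = 0.
  apply: (@complexI R); rewrite rmorph_sum /= -[RHS]tr0 -[X in _ *m X]aD /mxtrace.
  apply: eq_bigr => k _; rewrite -herm_norm2 hermE mxE.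
  by apply: eq_bigr => l _; rewrite adjE !mxE.
move: sum0 => /eqP; rewrite psumr_eq0 => [/allP h|k _]; last exact: norm2_ge0.
by have := h i (mem_index_enum _).
Qed.

End OsculatingFrame.

(** * The model curves *)

Section EulerFrame.
Context (R : realType).
Local Notation C := R[i].
Local Notation vec := 'rV[C]_3.
Implicit Types (x y r : R).

Definition cis x : C := Complex (cos x) (sin x).

Lemma cisD x y : cis (x + y) = cis x * cis y.
Proof.
by apply/eqP; rewrite eq_complex /= cosD sinD; apply/andP; split; apply/eqP; ring.
Qed.

Lemma cisN x : cis (- x) = conjc (cis x).
Proof. by rewrite /cis cosN sinN. Qed.

Lemma cis_conj x : cis x * conjc (cis x) = 1.
Proof.
apply/eqP; rewrite eq_complex /=; apply/andP; split; apply/eqP; last by ring.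
by rewrite mulrN opprK -!expr2 cos2Dsin2.
Qed.

Lemma cis_neq0 x : cis x != 0.
Proof.
by apply: contra_eq_neq (cis_conj x) => ->; rewrite mul0r eq_sym oner_eq0.
Qed.

Lemma conj_cis x : conjc (cis x) = (cis x)^-1.
Proof. by apply: (mulfI (cis_neq0 x)); rewrite cis_conj mulfV ?cis_neq0. Qed.

Lemma cisB x y : cis (x - y) = cis x / cis y.
Proof. by rewrite cisD cisN conj_cis. Qed.

Lemma polar_conj f g x y : (f%:C%C * cis x) * conjc (g%:C%C * cis y) =
  (f * g)%:C%C * cis (x - y).
Proof.
rewrite rmorphM /= oppr0 cisD cisN -[Complex g 0]/(g%:C%C) rmorphM /=.
by ring.
Qed.

Lemma cderiv_real (f : R -> R) (s d : R) :
  is_derive s 1 f d -> cderiv (fun t => (f t)%:C%C) s 1 d%:C%C.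
Proof. by move=> h; split=> //=; exact: is_derive_const. Qed.

Lemma cderiv_polar (f g : R -> R) (s df dg : R) :
  is_derive s 1 f df -> is_derive s 1 g dg ->
  cderiv (fun t => (f t)%:C%C * cis (g t)) s 1
    (Complex df (f s * dg) * cis (g s)).
Proof.
move=> hf hg.
have hcis : cderiv (fun t => cis (g t)) s 1 ('i%C * dg%:C%C * cis (g s)).
  split.
    apply: is_derive_eq (is_derive1_comp (f := cos) _ _) _ => /=.
    by ring.
  apply: is_derive_eq (is_derive1_comp (f := sin) _ _) _ => /=.
  by ring.
apply: cderiv_eq (cderivM (cderiv_real hf) hcis) _.
by apply/eqP; rewrite eq_complex /=; apply/andP; split; apply/eqP; ring.
Qed.

Definition row3 (a b c : C) : vec := \row_(k < 3) nth 0 [:: a; b; c] k.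

Lemma herm_row3 a b c a' b' c' : herm (row3 a b c) (row3 a' b' c') =
  a * conjc a' + (b * conjc b' + c * conjc c').
Proof. by rewrite hermE !big_ord_recl big_ord0 addr0 !mxE. Qed.

Definition euler_row1 (t p q : R) : vec := row3 0
  ((cos (t / 2))%:C%C * cis ((q + p) / 2))
  ((sin (t / 2))%:C%C * cis ((q - p) / 2)).

Definition euler_row2 (t p q x : R) : vec := row3 0
  ((- sin (t / 2))%:C%C * cis (x - (q - p) / 2))
  ((cos (t / 2))%:C%C * cis (x - (q + p) / 2)).

Definition base_row : vec := row3 1 0 0.

Lemma affine_lift_euler r t p q :
  affine_lift ord0 (euler_affine r t p q) = base_row + r%:C%C *: euler_row1 t p q.
Proof.
apply/rowP => k; rewrite !mxE.
case: k => [[|[|[|//]]] hk]; rewrite /=.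
- have -> : Ordinal hk = ord0 by apply/val_inj.
  by rewrite unlift_none mulr0 addr0.
- have -> : Ordinal hk = lift ord0 (ord0 : 'I_2) by apply/val_inj.
  rewrite liftK !mxE !inordK //=.
  by apply/eqP; rewrite eq_complex /=; apply/andP; split; apply/eqP; ring.
- have -> : Ordinal hk = lift ord0 (lift ord0 ord0 : 'I_2) by apply/val_inj.
  rewrite liftK !mxE !inordK //=.
  by apply/eqP; rewrite eq_complex /=; apply/andP; split; apply/eqP; ring.
Qed.

(* The phase [x] of the last row is chosen so that the frame of a model curve
   moves with constant coefficients. *)
Definition euler_frame t p q x : 'M[C]_3 :=
  rows3 base_row (euler_row1 t p q) (euler_row2 t p q x).

Lemma euler_frame_unitary t p q x :
  euler_frame t p q x *m adj (euler_frame t p q x) = 1%:M.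
Proof.
have one : cos (t / 2) * cos (t / 2) + sin (t / 2) * sin (t / 2) = 1.
  by rewrite -!expr2 cos2Dsin2.
have cis0 : cis 0 = 1 by rewrite /cis cos0 sin0.
have real1 : (1 : R)%:C%C = 1 :> C by [].
apply: rows3_unitary; rewrite herm_row3 ?polar_conj.
- by rewrite conjc0 conjc1 !mulr0 !addr0 mulr1.
- by rewrite mul0r add0r !subrr cis0 !mulr1 -rmorphD one.
- by rewrite mul0r add0r !subrr cis0 !mulr1 -rmorphD mulrNN addrC one.
- by rewrite mul0r conjc0 !mulr0 !addr0.
- by rewrite mul0r conjc0 !mulr0 !addr0.
- rewrite mul0r add0r mulNr rmorphN mulNr mulrC.
  have -> : x - (q - p) / 2 - (q + p) / 2 = x - (q + p) / 2 - (q - p) / 2 by ring.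
  by rewrite [cos _ * _]mulrC [_ * cis _]mulrC addNr.
Qed.

(** The hypotheses say sigma_1 + i sigma_2 = 2 c e^(-i x) on the velocity, and w is half of sigma_3:
    in the rotating phase x the left-invariant forms become the coefficients of the moving frame. *)
Lemma euler_row_derivatives (t p q x : R -> R) (s dt dp dq dx c : R) :
  is_derive s 1 t dt -> is_derive s 1 p dp -> is_derive s 1 q dq ->
  is_derive s 1 x dx ->
  dt = 2 * c * cos (q s - x s) -> sin (t s) * dp = 2 * c * sin (q s - x s) ->
  let w := (dq + cos (t s) * dp) / 2 in
  mxderiv (fun s => euler_row1 (t s) (p s) (q s)) s 1
    (Complex 0 w *: euler_row1 (t s) (p s) (q s)
     + c%:C%C *: euler_row2 (t s) (p s) (q s) (x s)) /\
  mxderiv (fun s => euler_row2 (t s) (p s) (q s) (x s)) s 1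
    (- c%:C%C *: euler_row1 (t s) (p s) (q s)
     + Complex 0 (dx - w) *: euler_row2 (t s) (p s) (q s) (x s)).
Proof.
move=> ht hp hq hx et ep w.
have half (f : R -> R) df : is_derive s 1 f df ->
    is_derive s 1 (fun s => f s / 2) (df / 2).
  move=> hf; apply: is_derive_eq (is_derive_mul hf (is_derive_const 2^-1 s 1)) _.
  by rewrite mulr0 addr0.
have hC : is_derive s 1 (fun s => cos (t s / 2)) (- sin (t s / 2) * (dt / 2)).
  by have h := half _ _ ht; apply: (is_derive1_comp (f := cos)).
have hS : is_derive s 1 (fun s => sin (t s / 2)) (cos (t s / 2) * (dt / 2)).
  by have h := half _ _ ht; apply: (is_derive1_comp (f := sin)).
have hA := half _ _ (is_derive_add hq hp).
have hB := half _ _ (is_derive_add hq (is_derive_opp hp)).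
have hxB := is_derive_add hx (is_derive_opp hB).
have hxA := is_derive_add hx (is_derive_opp hA).
have d11 := cderiv_polar hC hA.
have d12 := cderiv_polar hS hB.
have d21 := cderiv_polar (is_derive_opp hS) hxB.
have d22 := cderiv_polar hC hxA.
have row3D (f g h : R -> C) df dg dh : cderiv f s 1 df -> cderiv g s 1 dg ->
    cderiv h s 1 dh ->
    mxderiv (fun s => row3 (f s) (g s) (h s)) s 1 (row3 df dg dh).
  move=> hf hg hh i k; rewrite mxE.
  under [X in cderiv X]eq_fun do rewrite mxE.
  by case: k => [[|[|[|//]]] hk].
have d0 := cderiv_const (0 : C) s 1.
pose C0 := (cos (t s / 2))%:C%C : C; pose S0 := (sin (t s / 2))%:C%C : C.
have cs : C0 * C0 + S0 * S0 - 1 = 0.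
  by rewrite -!rmorphM -rmorphD -!expr2 cos2Dsin2 subrr.
have tE : t s = t s / 2 + t s / 2 by field.
have ctE : (cos (t s))%:C%C = C0 * C0 - S0 * S0 :> C.
  by rewrite [in LHS]tE cosD rmorphB !rmorphM.
have stE : (sin (t s))%:C%C = 2 * S0 * C0 :> C.
  rewrite [in LHS]tE sinD rmorphD !rmorphM /= -/C0 -/S0; ring.
pose a := cis ((q s + p s) / 2); pose b := cis ((q s - p s) / 2).
pose X := cis (x s); pose i : C := 'i%C.
have a0 : a != 0 := cis_neq0 _. have b0 : b != 0 := cis_neq0 _.
have X0 : X != 0 := cis_neq0 _.
have abE : cis (q s) = a * b by rewrite -cisD; congr cis; field.
have im (y : R) : Complex 0 y = i * y%:C%C.
  by apply/eqP; rewrite eq_complex /=; apply/andP; split; apply/eqP; ring.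
have cpx (y y' : R) : Complex y y' = y%:C%C + i * y'%:C%C.
  by apply/eqP; rewrite eq_complex /=; apply/andP; split; apply/eqP; ring.
have i2 : i * i = -1.
  by apply/eqP; rewrite eq_complex /=; apply/andP; split; apply/eqP; ring.
pose D := dt%:C%C : C; pose E := dq%:C%C : C; pose F := dp%:C%C : C.
pose G := dx%:C%C : C; pose cc := c%:C%C : C; pose W := w%:C%C : C.
(* [P1] and [P2] are the relation dt + i sin t dp = 2 c e^(i (q - x)) and its conjugate, solved for
   2 c. *)
have P1 : cc + cc = (D + i * (2 * S0 * C0 * F)) * (X / (a * b)).
  have -> : D + i * (2 * S0 * C0 * F) = (cc + cc) * (a * b / X).
    rewrite /D /F -stE -rmorphM ep et -abE -cisB /cis.
    by apply/eqP; rewrite eq_complex /=; apply/andP; split; apply/eqP; ring.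
  by field; rewrite X0 a0 b0.
have P2 : cc + cc = (D - i * (2 * S0 * C0 * F)) * (a * b / X).
  have -> : D - i * (2 * S0 * C0 * F) = (cc + cc) * (X / (a * b)).
    rewrite /D /F -stE -rmorphM ep et -abE -cisB /cis.
    have -> : x s - q s = - (q s - x s) by ring.
    rewrite cosN sinN.
    by apply/eqP; rewrite eq_complex /=; apply/andP; split; apply/eqP; ring.
  by field; rewrite X0 a0 b0.
have wE : W + W = E + (C0 * C0 - S0 * S0) * F.
  rewrite /W /E /F -ctE -rmorphM -!rmorphD /w.
  by congr (_%:C)%C; field.
have dbl (y z : C) : y + y = z + z -> y = z.
  have h (v : C) : v = (v + v) / 2 by field.
  by move=> e; rewrite (h y) e -h.
have cD (y y' : R) : Complex y y' + Complex y y' =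
    (y + y)%:C%C + i * (y' + y')%:C%C.
  by apply/eqP; rewrite eq_complex /=; apply/andP; split; apply/eqP; ring.
(* Each remaining entry is an identity modulo C0^2 + S0^2 = 1; [k] is the explicit cofactor. *)
have fin (l r k : C) : l - r = (C0 * C0 + S0 * S0 - 1) * k -> l = r.
  by rewrite cs mul0r => /eqP; rewrite subr_eq0 => /eqP.
have nz := (X0, a0, b0).
split.
  apply: (mxderiv_eq (row3D _ _ _ _ _ _ d0 d11 d12)).
  apply/rowP => k; rewrite !mxE; case: k => [[|[|[|//]]] hk] /=.
  - by rewrite !mulr0 addr0.
  - rewrite -/a cisB -/X -/b im -/W -/C0 -/cc rmorphN -/S0.
    apply: dbl; rewrite -mulrDl cD.
    have -> : (- sin (t s / 2) * (dt / 2) + - sin (t s / 2) * (dt / 2))%:C%C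
        = - S0 * D :> C.
      by rewrite -rmorphN -rmorphM; congr (_%:C)%C; field.
    have -> : (cos (t s / 2) * ((dq + dp) / 2)
        + cos (t s / 2) * ((dq + dp) / 2))%:C%C = C0 * (E + F) :> C.
      by rewrite -rmorphD -rmorphM; congr (_%:C)%C; field.
    transitivity (i * (W + W) * (C0 * a) + (cc + cc) * (- S0 * (X / b))).
      rewrite wE P2; apply: (fin _ _ (- (a * i * C0 * F))).
      by field; rewrite !nz.
    by ring.
  - rewrite -/b cisB -/X -/a im -/W -/C0 -/cc -/S0.
    apply: dbl; rewrite -mulrDl cD.
    have -> : (cos (t s / 2) * (dt / 2) + cos (t s / 2) * (dt / 2))%:C%C
        = C0 * D :> C.
      by rewrite -rmorphM; congr (_%:C)%C; field.
    have -> : (sin (t s / 2) * ((dq - dp) / 2)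
        + sin (t s / 2) * ((dq - dp) / 2))%:C%C = S0 * (E - F) :> C.
      by rewrite -rmorphB -rmorphM; congr (_%:C)%C; field.
    transitivity (i * (W + W) * (S0 * b) + (cc + cc) * (C0 * (X / a))).
      rewrite wE P2; apply: (fin _ _ (b * i * S0 * F)).
      by field; rewrite !nz.
    by ring.
apply: (mxderiv_eq (row3D _ _ _ _ _ _ d0 d21 d22)).
apply/rowP => k; rewrite !mxE; case: k => [[|[|[|//]]] hk] /=.
- by rewrite !mulr0 addr0.
- rewrite !cisB -/X -/b -/a im -/C0 -/cc !rmorphN -/S0 rmorphB -/G -/W.
  apply: dbl; rewrite -mulrDl cD.
  have -> : (- (cos (t s / 2) * (dt / 2)) + - (cos (t s / 2) * (dt / 2)))%:C%C
      = - C0 * D :> C.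
    by rewrite -rmorphN -rmorphM; congr (_%:C)%C; field.
  have -> : (- sin (t s / 2) * (dx + - ((dq - dp) / 2))
      + - sin (t s / 2) * (dx + - ((dq - dp) / 2)))%:C%C
      = - S0 * (G + G - E + F) :> C.
    rewrite /G /E -!rmorphD -rmorphB -rmorphD -rmorphN -rmorphM.
    by congr (_%:C)%C; field.
  transitivity (- (cc + cc) * (C0 * a)
    + i * (G + G - (W + W)) * (- S0 * (X / b))).
    rewrite wE P1; apply: (fin _ _ (X / b * i * S0 * F)).
    by field; rewrite !nz.
  by ring.
- rewrite !cisB -/X -/b -/a im -/C0 -/cc -/S0 rmorphB -/G -/W.
  apply: dbl; rewrite -mulrDl cD.
  have -> : (- sin (t s / 2) * (dt / 2) + - sin (t s / 2) * (dt / 2))%:C%C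
      = - S0 * D :> C.
    by rewrite -rmorphN -rmorphM; congr (_%:C)%C; field.
  have -> : (cos (t s / 2) * (dx + - ((dq + dp) / 2))
      + cos (t s / 2) * (dx + - ((dq + dp) / 2)))%:C%C
      = C0 * (G + G - E - F) :> C.
    rewrite /G /E -!rmorphD -!rmorphB -rmorphM.
    by congr (_%:C)%C; field.
  transitivity (- (cc + cc) * (S0 * b)
    + i * (G + G - (W + W)) * (C0 * (X / a))).
    rewrite wE P1; apply: (fin _ _ (X / a * i * C0 * F)).
    by field; rewrite !nz.
  by ring.
Qed.

End EulerFrame.

(** * Curves at constant r as orbits of one-parameter groups *)

Section ModelCurve.
Context (R : realType).
Local Notation C := R[i].
Local Notation vec := 'rV[C]_3.
Context (I : set R) (r g p : R) (t f q x : R -> R).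
Context (itv : is_interval I).
Context (r_gt0 : 0 < r).
Context (pE : p ^+ 2 * r ^+ 2 = (1 - g ^+ 2) * (1 + r ^+ 2)).
Context (kin : forall s, I s -> exists dt df dq,
  [/\ is_derive s 1 t dt, is_derive s 1 f df, is_derive s 1 q dq,
      is_derive s 1 x (3 * g * r) &
      [/\ dt = 2 * p * cos (q s - x s), sin (t s) * df = 2 * p * sin (q s - x s) &
      dq + cos (t s) * df = 2 * (g * (1 + r ^+ 2) / r)]]).

Let om := g * (1 + r ^+ 2) / r.
Let F s : 'M[C]_3 := euler_frame (t s) (f s) (q s) (x s).
(** The coefficients of [euler_row_derivatives] with w = [om] and c = p, less i g r on the diagonal.
    This scalar is the connection form of the lift [v *m F], since i r^2 om / (1 + r^2) = i g r; the
    frame coefficients have trace i x', so the rate x' = 3 g r is the one that leaves trace zero. *)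
Let B : 'M[C]_3 := rows3 (row3 (Complex 0 (- (g * r))) 0 0)
  (row3 0 (Complex 0 (om - g * r)) p%:C%C)
  (row3 0 (- p%:C%C) (Complex 0 (2 * g * r - om))).
Let v : vec := row3 1 r%:C%C 0.

Let r_neq0 : r != 0. Proof. by rewrite gt_eqF. Qed.

Lemma row3_mul a b c (X Y Z : vec) :
  row3 a b c *m rows3 X Y Z = a *: X + b *: Y + c *: Z.
Proof.
by apply/rowP => k; rewrite !mxE !big_ord_recl big_ord0 !mxE /= addr0 addrA.
Qed.

Lemma rows3_mul (X Y Z : vec) (M : 'M[C]_3) :
  rows3 X Y Z *m M = rows3 (X *m M) (Y *m M) (Z *m M).
Proof.
apply/matrixP => i j; rewrite !mxE.
case: i => [[|[|[|//]]] hi] /=; rewrite mxE; apply: eq_bigr => k _; by rewrite mxE.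
Qed.

Lemma mxderiv_rows3 (X Y Z : R -> vec) (s : R) X' Y' Z' :
  mxderiv X s 1 X' -> mxderiv Y s 1 Y' -> mxderiv Z s 1 Z' ->
  mxderiv (fun s => rows3 (X s) (Y s) (Z s)) s 1 (rows3 X' Y' Z').
Proof.
move=> hX hY hZ i j; rewrite mxE.
under [H in cderiv H]eq_fun do rewrite mxE.
by case: i => [[|[|[|//]]] hi] /=.
Qed.

(* The scalar [i g r] is split off so that [B] is traceless. *)
Lemma model_frame_deriv s : I s ->
  mxderiv F s 1 (B *m F s + Complex 0 (g * r) *: F s).
Proof.
move=> Is; have [dt [df [dq [ht hf hq hx [et ef eq]]]]] := kin Is.
have [h1 h2] := euler_row_derivatives ht hf hq hx et ef.
have h0 := mxderiv_const (base_row R) s 1.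
apply: (mxderiv_eq (mxderiv_rows3 h0 h1 h2)).
have -> : (dq + cos (t s) * df) / 2 = om by rewrite eq /om; field.
rewrite /B rows3_mul /F /euler_frame !row3_mul.
move: (base_row R) (euler_row1 _ _ _) (euler_row2 _ _ _ _) => X Y Z.
have [i im] : exists i : C, forall y : R, Complex 0 y = i * y%:C%C.
  exists 'i%C => y.
  by apply/eqP; rewrite eq_complex /=; apply/andP; split; apply/eqP; ring.
rewrite !im rmorphN !rmorphB /=.
have -> : (3 * g * r)%:C%C = (2 * g * r)%:C%C + (g * r)%:C%C :> C.
  by rewrite -rmorphD; congr (_%:C)%C; ring.
move: (om%:C)%C ((g * r)%:C)%C ((2 * g * r)%:C)%C (p%:C)%C => o1 o2 o3 p1.
apply/matrixP => l j; rewrite !mxE.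
by case: l => [[|[|[|//]]] hl] /=; rewrite !mxE; ring.
Qed.

Let K s : 'M[C]_3 := adj (F s) *m B *m F s.

Lemma model_matrix_skew : adj B = - B.
Proof.
apply/matrixP => i j; rewrite adjE !mxE.
case: i j => [[|[|[|//]]] hi] [[|[|[|//]]] hj] /=; rewrite !mxE /=;
  by apply/eqP; rewrite eq_complex /=; apply/andP; split; apply/eqP; ring.
Qed.

Lemma model_generator_skew s : adj (K s) = - K s.
Proof.
by rewrite /K !adjM adjK model_matrix_skew mulNmx mulmxN mulmxA.
Qed.

Let FF s : F s *m adj (F s) = 1%:M. Proof. exact: euler_frame_unitary. Qed.
Let F'F s : adj (F s) *m F s = 1%:M. Proof. exact: mulmx1C. Qed.

Lemma model_generator_trace s : \tr (K s) = 0.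
Proof.
rewrite /K mxtrace_mulC mulmxA FF mul1mx /mxtrace !big_ord_recl big_ord0 !mxE /=.
by rewrite ?mxE /=; apply/eqP; rewrite eq_complex /=; apply/andP; split;
  apply/eqP; ring.
Qed.

(** In the derivative of F^* B F the scalar part of F' cancels with its conjugate, and the skew
    constant B contributes - B B + B B. *)
Lemma model_generator_constant s s' : I s -> I s' -> K s = K s'.
Proof.
move=> Is Is'; apply: (mxderiv0_constant itv _ Is Is') => y Iy.
have h := model_frame_deriv Iy.
have hB := mxderiv_const B y 1.
have hh := mxderivM (mxderivM (mxderiv_adj h) hB) h.
apply: (mxderiv_eq hh).
have iC : conjc (Complex 0 (g * r)) = - Complex 0 (g * r).
  by apply/eqP; rewrite eq_complex /=; apply/andP; split; apply/eqP; ring.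
rewrite adjD adjM adjZ iC model_matrix_skew.
move: (Complex 0 (g * r)) (F y) (adj (F y)) => c X Y.
rewrite mulmx0 addr0 !(mulmxDl, mulmxDr) mulmxN !mulNmx -!scalemxAl -!scalemxAr.
rewrite !mulmxA; move: (Y *m B *m B *m X) (Y *m B *m X) => x1 x2.
by apply/matrixP => i j; rewrite !mxE; ring.
Qed.

Let z s : vec := v *m F s.

(** The frame coordinates of the velocity z K; [model_vBB] gives those of the acceleration z K K +
    z. All invariants of the model curve are computed from these two rows. *)
Lemma model_vB : v *m B = row3 (Complex 0 (- (g * r))) (Complex 0 g) (r * p)%:C%C.
Proof.
rewrite /v /B row3_mul; apply/rowP => i; rewrite !mxE.
case: i => [[|[|[|//]]] hi] /=; apply/eqP; rewrite eq_complex /=;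
  apply/andP; split; apply/eqP; rewrite ?/om; try ring; by field.
Qed.

Let w := 1 - g ^+ 2 * r ^+ 2.

Lemma model_vBB : v *m B *m B + v =
  row3 w%:C%C (- (w / r))%:C%C (Complex 0 (p * g * r ^+ 2)).
Proof.
have prE : r * p * p = (1 - g ^+ 2) * (1 + r ^+ 2) / r.
  by apply: (mulIf r_neq0); rewrite divfK // -pE; ring.
rewrite model_vB /v /B row3_mul; apply/rowP => i; rewrite !mxE.
case: i => [[|[|[|//]]] hi] /=; apply/eqP; rewrite eq_complex /=;
  apply/andP; split; apply/eqP.
- by rewrite /w; ring.
- by ring.
- transitivity (- (g * (om - g * r)) - r * p * p + r); first by ring.
  by rewrite prE /w /om; field.
- by ring.
- by ring.
- by rewrite /om; field.
Qed.

Lemma model_zK s : z s *m K s = v *m B *m F s.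
Proof. by rewrite /z /K -mulmxA !mulmxA -(mulmxA v) FF mulmx1. Qed.

Lemma model_zKK s : z s *m K s *m K s + z s = (v *m B *m B + v) *m F s.
Proof.
rewrite model_zK /K !mulmxA -(mulmxA (v *m B)) FF mulmx1.
by rewrite mulmxDl.
Qed.

Let N : R := 1 + r ^+ 2.
Let N_neq0 : N != 0. Proof. by rewrite gt_eqF // ltr_pwDl // sqr_ge0. Qed.

Lemma model_norm s : herm (z s) (z s) = N%:C%C.
Proof.
rewrite /z herm_mulmx // /v herm_row3 /N.
by apply/eqP; rewrite eq_complex /=; apply/andP; split; apply/eqP; ring.
Qed.

Lemma model_osculating s : I s -> exists u a,
  [/\ osculating (z s) u a, K s = generator (z s) u a,
      torsion (z s) u a = g * (1 + r ^+ 2 - 2 * g ^+ 2 * r ^+ 2) / r &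
      curvature2 (z s) a = (r ^+ 2)^-1 - 2 * g ^+ 2 + g ^+ 2 * r ^+ 2].
Proof.
move=> Is; exists (z s *m K s), (z s *m K s *m K s + z s).
have z0 : z s != 0.
  by rewrite -norm2_eq0 /norm2 model_norm.
have uz : herm (z s *m K s) (z s) = 0.
  rewrite model_zK /z herm_mulmx // model_vB herm_row3.
  by apply/eqP; rewrite eq_complex /=; apply/andP; split; apply/eqP; ring.
have uu : herm (z s *m K s) (z s *m K s) = herm (z s) (z s).
  rewrite model_norm model_zK herm_mulmx // model_vB herm_row3.
  have e : r * p * (r * p) = (1 - g ^+ 2) * N by rewrite /N -pE; ring.
  apply/eqP; rewrite eq_complex /=; apply/andP; split; apply/eqP; last by ring.
  transitivity (g ^+ 2 * r ^+ 2 + g ^+ 2 + r * p * (r * p)); first by ring.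
  by rewrite e /N; ring.
have [osc KE] := generator_of_skew (model_generator_skew s)
  (model_generator_trace s) z0 uz uu.
have rpE : r * p * (p * g * r ^+ 2) = g * r * ((1 - g ^+ 2) * N).
  by rewrite /N -pE; ring.
split=> //.
  rewrite /torsion model_norm model_zKK model_zK model_vBB model_vB.
  rewrite herm_mulmx // herm_row3 -fmorphV.
  have -> : g * (1 + r ^+ 2 - 2 * g ^+ 2 * r ^+ 2) / r =
      (w * (g * r) + w / r * g + r * p * (p * g * r ^+ 2)) / N.
    by rewrite rpE /w /N; field; rewrite r_neq0 N_neq0.
  by rewrite /=; ring.
rewrite /curvature2 model_norm model_zKK model_vBB herm_mulmx // herm_row3 -fmorphV.
have -> : (r ^+ 2)^-1 - 2 * g ^+ 2 + g ^+ 2 * r ^+ 2 =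
      (w ^+ 2 + (w / r) ^+ 2 + g ^+ 2 * r ^+ 2 * (p ^+ 2 * r ^+ 2)) / N.
  by rewrite pE -/N /w /N; field; rewrite r_neq0 N_neq0.
by rewrite /=; ring.
Qed.

Let Gamma s := euler_point r (t s) (f s) (q s).

Lemma model_point s : Gamma s = hpoint (z s).
Proof.
rewrite /Gamma /euler_point affine_pointE affine_lift_euler /z /v row3_mul.
by rewrite scale1r scale0r addr0.
Qed.

Lemma model_mxderiv s : I s ->
  mxderiv (fun s => hproj (Gamma s)) s 1
    (hproj (Gamma s) *m K s - K s *m hproj (Gamma s)).
Proof.
move=> Is; have z0 y : z y != 0 by rewrite -norm2_eq0 /norm2 model_norm.
have e y : hproj (Gamma y) = proj (z y).
  by rewrite model_point /hproj proj_hcoord.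
rewrite e; under [H in mxderiv H]eq_fun do rewrite e.
have dz : mxderiv z s 1 (Complex 0 (g * r) *: z s + z s *m K s).
  apply: mxderiv_eq.
    exact: mxderivM (mxderiv_const v s 1) (model_frame_deriv Is).
  rewrite mul0mx add0r model_zK mulmxDr -scalemxAr mulmxA addrC.
  by [].
have uz : herm (z s *m K s) (z s) = 0.
  rewrite model_zK /z herm_mulmx // model_vB herm_row3.
  by apply/eqP; rewrite eq_complex /=; apply/andP; split; apply/eqP; ring.
have D := @mxderiv_outer _ z (fun s => z s *m K s) (fun=> Complex 0 (g * r))
  s z z _ _ (z0 s) dz uz dz dz.
apply: (mxderiv_eq D).
rewrite /outer adjM model_generator_skew !mulNmx addrC.
by rewrite /proj -scalemxAl -scalemxAr scalerN !mulmxA.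
Qed.

Theorem model_curve s0 : I s0 -> exists u a,
  [/\ osculating (z s0) u a, Gamma s0 = hpoint (z s0),
      torsion (z s0) u a = g * (1 + r ^+ 2 - 2 * g ^+ 2 * r ^+ 2) / r,
      curvature2 (z s0) a = (r ^+ 2)^-1 - 2 * g ^+ 2 + g ^+ 2 * r ^+ 2 &
      forall s, I s -> let M := generator (z s0) u a in
      mxderiv (fun s => hproj (Gamma s)) s 1
        (hproj (Gamma s) *m M - M *m hproj (Gamma s))].
Proof.
move=> I0; have [u [a [osc KE et ec]]] := model_osculating I0.
exists u, a; split=> //; first exact: model_point.
move=> s Is /=; rewrite -KE (model_generator_constant I0 Is).
exact: model_mxderiv.
Qed.

End ModelCurve.

(** * The explicit solution *)

(** The fundamental theorem gives an antiderivative to the right of a base point. Base points - (n +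
    1) tending to minus infinity are used, each integral being normalised to vanish at 0, so that
    any two agree where both are available. *)
Lemma continuous_antiderivative (R : realType) (f : R -> R) : continuous f ->
  exists F : R -> R, forall x : R, is_derive x 1 F (f x).
Proof.
move=> cf.
pose P (a y : R) := (\int[lebesgue_measure]_(t in `[a, y]) f t)%R.
have dP (a y : R) : a < y -> is_derive y 1 (P a) (f y).
  move=> ay; have yu : y < y + 1 by rewrite ltrDl.
  have intf : lebesgue_measure.-integrable `[a, y + 1] (EFin \o f).
    apply: continuous_compact_integrable; first exact: segment_compact.
    by apply: continuous_subspaceT => z; exact: cf.
  have [d e] := continuous_FTC1_closed yu intf ay (cf y).
  by apply: DeriveDef; [exact: d|rewrite -derive1E; exact: e].
pose G (n : nat) y := P (- n.+1%:R) y - P (- n.+1%:R) 0.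
have dG n (y : R) : - n.+1%:R < y -> is_derive y 1 (G n) (f y).
  move=> ny; apply: is_derive_eq
    (is_derive_add (dP _ _ ny) (is_derive_const (- P (- n.+1%:R) 0) y 1)) _.
  by rewrite addr0.
have GG n m (y : R) : (n <= m)%N -> - n.+1%:R < y -> G n y = G m y.
  move=> nm ny.
  have mn : - m.+1%:R <= - n.+1%:R :> R by rewrite lerN2 ler_nat ltnS.
  have d0 (z : R) : `]- n.+1%:R, +oo[%classic z ->
      is_derive z 1 (fun y => G n y - G m y) 0.
    rewrite /= in_itv /= andbT => nz.
    apply: is_derive_eq (is_derive_add (dG n z nz)
      (is_derive_opp (dG m z (le_lt_trans mn nz)))) _.
    by rewrite subrr.
  have itv : is_interval (`]- n.+1%:R, +oo[%classic : set R).
    exact: interval_is_interval.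
  have n0 : `]- n.+1%:R, +oo[%classic (0 : R) by rewrite /= in_itv /= andbT oppr_lt0.
  have ny' : `]- n.+1%:R, +oo[%classic y by rewrite /= in_itv /= andbT.
  have := derive0_constant itv d0 ny' n0.
  by rewrite /G !subrr => /eqP; rewrite subr_eq0 => /eqP.
pose N (y : R) := Num.truncn `|y|.
have NP (y : R) : - (N y).+1%:R < y.
  by rewrite ltrNl (le_lt_trans (ler_norm _)) // normrN; exact: truncnS_gt.
exists (fun y => G (N y) y) => x.
have near1 : \forall y \near x, `|x - y| < 1.
  by apply/nbhs_ballP; exists 1; [exact: ltr01|move=> y; rewrite -ball_normE].
(* Within distance 1 of x one has y > - (N x + 2), so the single index N x + 1 is valid on a whole
   neighbourhood. *)
have e : \forall y \near x, G (N x).+1 y = G (N y) y.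
  apply: filterS near1 => y xy.
  have hy : `|y| < (N x).+2%:R.
    rewrite -(subrK x y) (le_lt_trans (ler_normD _ _)) // -[X in _ < X]natr1 addrC.
    by rewrite ltrD //; [exact: truncnS_gt|rewrite distrC].
  have [le|lt] := leqP (N y) (N x).+1.
    exact/esym/(GG _ _ _ le)/NP.
  apply: (GG _ _ _ (ltnW lt)).
  by move: hy; rewrite ltr_norml => /andP[].
apply: near_eq_is_derive e _; apply: dG.
by apply: le_lt_trans (NP x); rewrite lerN2 ler_nat.
Qed.

Section ExplicitSolution.
Context (R : realType).

Lemma sin_arccot (x : R) : 0 < sin (arccot x).
Proof.
rewrite /arccot sinB sin_pihalf cos_pihalf mul0r mul1r subr0.
by apply: cos_gt0_pihalf; rewrite atan_gtNpi2 atan_ltpi2.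
Qed.

Lemma cos_arccot (x : R) : cos (arccot x) = x * sin (arccot x).
Proof.
rewrite /arccot sinB cosB sin_pihalf cos_pihalf !mul0r !mul1r subr0 add0r.
have c0 : cos (atan x) != 0.
  by rewrite gt_eqF // cos_gt0_pihalf // atan_gtNpi2 atan_ltpi2.
by rewrite -[X in _ = X * _]atanK /tan divfK.
Qed.

Lemma sin2_arccot (x : R) : sin (arccot x) ^+ 2 * (1 + x ^+ 2) = 1.
Proof.
by rewrite mulrDr mulr1 -exprMn [_ * x]mulrC -cos_arccot addrC cos2Dsin2.
Qed.

Lemma is_derive_arccot (f : R -> R) (s d : R) : is_derive s 1 f d ->
  is_derive s 1 (fun t => arccot (f t)) (- (d * sin (arccot (f s)) ^+ 2)).
Proof.
move=> hf.
have h : is_derive s 1 (fun t => atan (f t)) (d * sin (arccot (f s)) ^+ 2).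
  apply: is_derive_eq (is_derive1_comp (f := atan) _ _) _.
  have n0 : 1 + f s ^+ 2 != 0 by rewrite gt_eqF // ltr_pwDl // sqr_ge0.
  rewrite mulrC; congr (_ * _); apply: (mulIf n0).
  by rewrite sin2_arccot mulVf.
apply: is_derive_eq
  (is_derive_add (is_derive_const (pi / 2) s 1) (is_derive_opp h)) _.
by rewrite add0r.
Qed.

(* In terms of [y = cot chi] and [M = cot theta / sin chi]; the linear equation
   for [M] is equivalent to [theta' = P cos chi]. *)
Lemma euler_angles_ode (Q P : R) (y dy M : R -> R) : P != 0 ->
  (forall s : R, is_derive s 1 y (dy s)) ->
  (forall s : R, is_derive s 1 M (- (y s * (Q * M s + P)))) ->
  (forall s, P * M s = Q * (1 + y s ^+ 2) + dy s) ->
  let chi := fun s => arccot (y s) in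
  exists theta phi : R -> R, forall s : R,
  [/\ is_derive s 1 chi (Q - cos (theta s) * (P * (sin (chi s) / sin (theta s)))),
      theta s = arccot ((Q - derive1 chi s) / (P * sin (chi s))),
      is_derive s 1 theta (P * cos (chi s)),
      is_derive s 1 phi (P * (sin (chi s) / sin (theta s))) &
      sin (theta s) != 0].
Proof.
move=> P0 hy hM PM chi.
(* The required value is cot theta = (Q - chi') / (P sin chi), and chi' = Q - P M sin^2 chi by the
   relation between y and M. *)
pose theta s := arccot (M s * sin (chi s)).
have sc0 (s : R) : sin (chi s) != 0 by rewrite gt_eqF // sin_arccot.
have st0 (s : R) : sin (theta s) != 0 by rewrite gt_eqF // sin_arccot.
have dchiE (s : R) : - (dy s * sin (chi s) ^+ 2) = Q - P * (M s * sin (chi s) ^+ 2).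
  have -> : dy s = P * M s - Q * (1 + y s ^+ 2) by rewrite PM addrC addKr.
  have e := sin2_arccot (y s); rewrite -/(chi s) in e.
  transitivity (Q * (sin (chi s) ^+ 2 * (1 + y s ^+ 2))
    - P * (M s * sin (chi s) ^+ 2)); first by ring.
  by rewrite e mulr1.
have dchi (s : R) : is_derive s 1 chi (Q - P * (M s * sin (chi s) ^+ 2)).
  by rewrite -dchiE; exact: is_derive_arccot.
have cotE (s : R) : cos (theta s) / sin (theta s) = M s * sin (chi s).
  by rewrite cos_arccot; exact: (mulfK (st0 s)).
have dtheta (s : R) : is_derive s 1 theta (P * cos (chi s)).
  have dsin : is_derive s 1 (fun t => sin (chi t))
      (cos (chi s) * (Q - P * (M s * sin (chi s) ^+ 2))).
    by have h := dchi s; apply: (is_derive1_comp (f := sin)).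
  apply: is_derive_eq (is_derive_arccot (is_derive_mul (hM s) dsin)) _.
  rewrite -/(theta s).
  have e := sin2_arccot (M s * sin (chi s)); rewrite -/(theta s) in e.
  have ce : cos (chi s) = y s * sin (chi s) by exact: cos_arccot.
  transitivity (P * cos (chi s)
    * (sin (theta s) ^+ 2 * (1 + (M s * sin (chi s)) ^+ 2))).
    by rewrite ce; ring.
  by rewrite e mulr1.
have cphi : continuous (fun s => P * (sin (chi s) / sin (theta s))).
  move=> s; apply: cvgMr.
  have cont (f : R -> R) d : is_derive s 1 f d -> {for s, continuous f}.
    move=> hf; apply: differentiable_continuous.
    by apply/derivable1_diffP.
  apply: cvgM.
    by apply: (continuous_comp (cont _ _ (dchi s))); exact: continuous_sin.
  apply: cvgV; first exact: st0.
  by apply: (continuous_comp (cont _ _ (dtheta s))); exact: continuous_sin.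
have [phi hphi] := continuous_antiderivative cphi.
exists theta, phi => s; split.
- apply: is_derive_eq (dchi s) _; congr (_ - _).
  transitivity (P * (cos (theta s) / sin (theta s) * sin (chi s))).
    by rewrite cotE; ring.
  by field; exact: st0.
- congr arccot; rewrite derive1E (@derive_val _ _ _ _ _ _ _ (dchi s)).
  by field; rewrite P0 sc0.
- exact: dtheta.
- exact: hphi.
- exact: st0.
Qed.

Lemma explicit_cot (Q P : R) : P != 0 ->
  let k := Num.sqrt (P ^+ 2 + Q ^+ 2) in
  let y := fun s => k * (0 * cos (k * s) - sin (k * s)) /
    (Q * (2 + 0 * sin (k * s) + cos (k * s))) in
  exists dy M : R -> R, forall s : R,
    [/\ is_derive s 1 y (dy s), is_derive s 1 M (- (y s * (Q * M s + P))) &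
        P * M s = Q * (1 + y s ^+ 2) + dy s].
Proof.
move=> P0 k y; have [Q0|Q0] := eqVneq Q 0.
  (* For Q = 0 the quotient is 0 by the convention on division, and M = 0 fits: chi and theta will
     both be constantly pi / 2. *)
  have -> : y = fun=> 0.
    by apply/funext => s; rewrite /y Q0 !mul0r invr0 mulr0.
  exists (fun=> 0), (fun=> 0) => s; split.
  - exact: is_derive_const.
  - by rewrite mul0r oppr0; exact: is_derive_const.
  - by rewrite Q0 !mulr0 mul0r addr0.
have k2 : k ^+ 2 = P ^+ 2 + Q ^+ 2 by rewrite sqr_sqrtr // addr_ge0 // sqr_ge0.
pose D s := 2 + cos (k * s).
have D0 (s : R) : D s != 0.
  rewrite gt_eqF // /D.
  by have := cos_geN1 (k * s); lra.
have lin (s : R) : is_derive s 1 (fun t => k * t) k.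
  apply: is_derive_eq (is_derive_mul (is_derive_const k s 1) (is_derive_id s 1)) _.
  by rewrite mul0r add0r mulr1.
have dcos (s : R) : is_derive s 1 (fun t => cos (k * t)) (- sin (k * s) * k).
  by have h := lin s; apply: (is_derive1_comp (f := cos)).
have dsin (s : R) : is_derive s 1 (fun t => sin (k * t)) (cos (k * s) * k).
  by have h := lin s; apply: (is_derive1_comp (f := sin)).
have dD (s : R) : is_derive s 1 D (- sin (k * s) * k).
  apply: is_derive_eq (is_derive_add (is_derive_const 2 s 1) (dcos s)) _.
  by rewrite add0r.
have yE : y = fun s => - (k / Q) * (sin (k * s) * (D s)^-1).
  apply/funext => s; rewrite /y !mul0r sub0r addr0 -/(D s).
  by field; rewrite D0 Q0.
exists (fun s => - (k / Q) * (cos (k * s) * k * (D s)^-1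
    + sin (k * s) * (- (- sin (k * s) * k / D s ^+ 2)))).
(* Solved from P M = Q (1 + y^2) + y': the terms in sin^2 of y^2 and y' cancel, and k^2 = P^2 + Q^2
   with cos = D - 2 gives this form. *)
exists (fun s => (k ^+ 2 * 2 * (D s)^-1 - P ^+ 2) * (Q * P)^-1) => s.
have QP0 : Q * P != 0 by rewrite mulf_neq0.
have cE : cos (k * s) = D s - 2 by rewrite /D addrC addKr.
rewrite yE; split.
- apply: is_derive_eq (is_derive_mul (is_derive_const (- (k / Q)) s 1)
    (is_derive_mul (dsin s) (is_derive_inv (D0 s) (dD s)))) _.
  by rewrite mul0r add0r.
- apply: is_derive_eq (is_derive_mul (is_derive_add
    (is_derive_mul (is_derive_const (k ^+ 2 * 2) s 1)
       (is_derive_inv (D0 s) (dD s)))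
    (is_derive_opp (is_derive_const (P ^+ 2) s 1)))
    (is_derive_const (Q * P)^-1 s 1)) _.
  by rewrite k2; field; rewrite D0 Q0 P0.
- rewrite cE; have := D0 s; move: (D s) (sin _) => d w d0.
  transitivity ((k ^+ 2 * 2 / d - P ^+ 2) / Q); first by field; rewrite d0 Q0 P0.
  transitivity (Q - k ^+ 2 * (d - 2) / (Q * d)); last by field; rewrite d0 Q0.
  by rewrite k2; field; rewrite d0 Q0.
Qed.

End ExplicitSolution.

(** * Classification *)

(** Put T = g / sqrt(1 - g^2) and u = g r. The two equations follow from al = m T + u and T (1 - 2
    u^2) = (1 + T^2) u m, and eliminating u leaves the cubic [p] in T. It is negative at 0 and
    positive at al / m, where u = 0, so it has a root strictly between, with T and u both
    positive. *)
Lemma model_parameters_pos (R : realType) (al m : R) : 0 < al -> 0 < m ->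
  exists r g, [/\ 0 < r, 0 < g < 1,
    al = g * (1 + r ^+ 2 - 2 * g ^+ 2 * r ^+ 2) / r &
    al ^+ 2 + m ^+ 2 = (r ^+ 2)^-1 - 2 * g ^+ 2 + g ^+ 2 * r ^+ 2].
Proof.
move=> al0 m0.
pose p : {poly R} := 'X - m *: ((1 + 'X ^+ 2) * (al%:P - m *: 'X))
  - 2 *: ('X * (al%:P - m *: 'X) ^+ 2).
have pE (T : R) : p.[T] =
    T - m * ((1 + T ^+ 2) * (al - m * T)) - 2 * (T * (al - m * T) ^+ 2).
  by rewrite /p !hornerE.
have mn0 : m != 0 by rewrite gt_eqF.
have a0 : 0 < al / m by rewrite divr_gt0.
have p0 : p.[0] < 0.
  rewrite pE (_ : _ - _ = - (m * al)) ?oppr_lt0 ?mulr_gt0 //; ring.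
have pa : 0 < p.[al / m].
  by rewrite pE (_ : _ - _ = al / m) //; field.
have [|T /andP[T0 Ta] /rootP pT] := poly_ivt (p := p) (ltW a0).
  by rewrite (ltW p0) (ltW pa).
have {}T0 : 0 < T.
  by rewrite lt_neqAle T0 andbT; apply/eqP => e; move: p0 pT; rewrite -e => + h; rewrite h ltxx.
have {}Ta : T < al / m.
  by rewrite lt_neqAle Ta andbT; apply/eqP => e; move: pa; rewrite -e pT ltxx.
pose u := al - m * T.
have u0 : 0 < u by rewrite subr_gt0 mulrC -ltr_pdivlMr.
have alE : al = m * T + u by rewrite /u addrC subrK.
pose S := Num.sqrt (1 + T ^+ 2).
have S0 : 0 < S by rewrite sqrtr_gt0 ltr_pwDl // sqr_ge0.
have S2 : S ^+ 2 = 1 + T ^+ 2 by rewrite sqr_sqrtr // addr_ge0 // sqr_ge0.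
have key : T * (1 - 2 * u ^+ 2) = S ^+ 2 * u * m.
  apply/eqP; rewrite -subr_eq0 -[X in _ == X]pT pE S2 -/u; apply/eqP; ring.
have Tn : T != 0 by rewrite gt_eqF. have Sn : S != 0 by rewrite gt_eqF.
have un : u != 0 by rewrite gt_eqF.
have rE : (S * u / T) ^+ 2 * (T / S) ^+ 2 = u ^+ 2.
  by field; rewrite Tn Sn.
exists (S * u / T), (T / S); split.
- by rewrite divr_gt0 // mulr_gt0.
- rewrite divr_gt0 //= ltr_pdivrMr // mul1r.
  rewrite -(ltr_pXn2r (n := 2)) ?nnegrE ?(ltW T0) ?(ltW S0) //.
  by rewrite S2 ltrDr.
- transitivity (T * (T * (1 - 2 * u ^+ 2)) / (S ^+ 2 * u) + u).
    by rewrite key alE; field; rewrite un Sn.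
  by field; rewrite un Tn Sn.
- transitivity (T * (T * (1 - 2 * u ^+ 2)) / (S ^+ 2 * u ^+ 2) + u ^+ 2); last first.
    by field; rewrite un Tn Sn.
  rewrite key alE.
  have e : T * m = m * (m * (S ^+ 2 * u) + 2 * (T * u ^+ 2)).
    by rewrite [S ^+ 2 * u * m]mulrC in key *; rewrite -key; ring.
  transitivity (T * m / u + u ^+ 2); last by field; rewrite un Sn.
  by rewrite e S2; field.
Qed.

Lemma model_parameters (R : realType) (al k2 : R) : al ^+ 2 <= k2 ->
  exists r g, [/\ 0 < r, g = 1 \/ -1 < g < 1,
    al = g * (1 + r ^+ 2 - 2 * g ^+ 2 * r ^+ 2) / r &
    k2 = (r ^+ 2)^-1 - 2 * g ^+ 2 + g ^+ 2 * r ^+ 2].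
Proof.
move=> le_k2; pose m := Num.sqrt (k2 - al ^+ 2).
have m2 : k2 = al ^+ 2 + m ^+ 2 by rewrite sqr_sqrtr ?subr_ge0 // addrC subrK.
have : 0 <= m by exact: sqrtr_ge0.
rewrite le_eqVlt => /orP[/eqP m0|m_gt0].
  (* Equality forces the Killing trajectories: for g = 1 the equation is al = (1 - r^2) / r, and r
     is the positive root of r^2 + al r = 1. *)
  pose S := Num.sqrt (al ^+ 2 + 4).
  have S2 : S ^+ 2 = al ^+ 2 + 4 by rewrite sqr_sqrtr // addr_ge0 // sqr_ge0.
  have lS : al < S.
    have S0 : 0 <= S by exact: sqrtr_ge0.
    rewrite ltNge; apply/negP => Sal.
    have : S ^+ 2 <= al ^+ 2 by rewrite ler_sqr ?nnegrE // (le_trans S0).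
    by rewrite S2; lra.
  pose r := (S - al) / 2.
  have r0 : 0 < r by rewrite divr_gt0 // subr_gt0.
  have rn : r != 0 by rewrite gt_eqF.
  have e : al = (1 - r ^+ 2) / r.
    apply: (mulIf rn); rewrite divfK // /r.
    transitivity (1 - (S ^+ 2 - 2 * S * al + al ^+ 2) / 4); last by field.
    by rewrite S2; field.
  exists r, 1; split=> //; first by left.
    by rewrite e; congr (_ / _); ring.
  by rewrite m2 -m0 e; field.
(* The formula for alpha is odd in g and the one for |a|^2 is even, so a negative alpha is reached
   by the opposite g; for alpha = 0 take g = 0 and r = 1 / m. *)
have [al0|al0|al0] := ltgtP 0 al.
- have [r [g [r0 /andP[g0 g1] e1 e2]]] := model_parameters_pos al0 m_gt0.
  exists r, g; split=> //; last by rewrite m2.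
  by right; rewrite g1 andbT; lra.
- have nal : 0 < - al by rewrite oppr_gt0.
  have [r [g [r0 /andP[g0 g1] e1 e2]]] := model_parameters_pos nal m_gt0.
  exists r, (- g); split=> //.
  + by right; apply/andP; split; lra.
  + by rewrite -[al]opprK e1; field; rewrite gt_eqF.
  + by rewrite m2 -[al ^+ 2]sqrrN e2 sqrrN.
- exists m^-1, 0; split.
  + by rewrite invr_gt0.
  + by right; apply/andP; split; lra.
  + by rewrite -al0 !mul0r.
  + by rewrite m2 -al0; field; rewrite gt_eqF.
Qed.

Section Classification.
Context (R : realType).
Implicit Types (I : set R) (c : R -> CP2 R).

(** Equal invariants at [s0] give a unitary matrix matching both the point and the generator. The
    projectors of [c] and of the moved model then solve one equation with one initial value, so the
    curves coincide on I. *)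
Lemma geodesic_of_model I c s0 z u a (r g p : R) (t f q x : R -> R) :
  open I -> is_interval I -> conformal_geodesic I c -> I s0 ->
  c s0 = hpoint z -> osculating z u a ->
  (forall s, I s -> let K := generator z u a in
    mxderiv (fun t => hproj (c t)) s 1 (hproj (c s) *m K - K *m hproj (c s))) ->
  torsion z u a = g * (1 + r ^+ 2 - 2 * g ^+ 2 * r ^+ 2) / r ->
  curvature2 z a = (r ^+ 2)^-1 - 2 * g ^+ 2 + g ^+ 2 * r ^+ 2 ->
  0 < r -> p ^+ 2 * r ^+ 2 = (1 - g ^+ 2) * (1 + r ^+ 2) ->
  (forall s, I s -> exists dt df dq,
    [/\ is_derive s 1 t dt, is_derive s 1 f df, is_derive s 1 q dq,
      is_derive s 1 x (3 * g * r) &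
      [/\ dt = 2 * p * cos (q s - x s), sin (t s) * df = 2 * p * sin (q s - x s) &
      dq + cos (t s) * df = 2 * (g * (1 + r ^+ 2) / r)]]) ->
  let Gamma := fun s => euler_point r (t s) (f s) (q s) in
  exists rho, [/\ fs_isometry rho, conformal_geodesic I Gamma &
    forall s, I s -> c s = rho (Gamma s)].
Proof.
move=> oI itv hc I0 cz osc hder et ek r0 pE kin Gamma.
have [u1 [a1 [osc1 Gz et1 ek1 hder1]]] := model_curve itv r0 pE kin I0.
rewrite -/(Gamma s0) in Gz.
have [W [WW ep eg]] := osculating_match osc osc1
  (etrans et (esym et1)) (etrans ek (esym ek1)).
have [z0 _ _ _ _] := osc; have [z10 _ _ _ _] := osc1.
have cG s : I s -> c s = hmap W (Gamma s).
  move=> Is; apply: hproj_inj; rewrite (hproj_hmap _ WW).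
  apply: (commutator_ode_unique (P := fun s => hproj (c s))
    (Q := fun s => adj W *m hproj (Gamma s) *m W) itv I0 Is).
  - by move=> y; exact: adj_hproj.
  - move=> y; move: (hproj _) (adj_hproj (Gamma y)) => X aX.
    by rewrite adjM adjM adjK aX mulmxA.
  - exact: hder.
  - move=> y Iy; have h := hder1 y Iy.
    have d := mxderivM (mxderivM (mxderiv_const (adj W) y 1) h)
      (mxderiv_const W y 1).
    apply: (mxderiv_eq d); rewrite eg mul0mx add0r mulmx0 addr0.
    move: (hproj (Gamma y)) (generator _ _ _) => X M.
    rewrite mulmxBr mulmxBl !mulmxA; congr (_ - _).
      by rewrite -(mulmxA _ W (adj W)) WW mulmx1.
    by rewrite -(mulmxA _ W (adj W)) WW mulmx1.
  - by rewrite cz Gz /hproj !proj_hcoord.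
have W'W : adj W *m adj (adj W) = 1%:M by rewrite adjK; exact: mulmx1C.
exists (hmap W); split; [exact: hmap_isometry| |exact: cG].
apply: (conformal_geodesic_hmap oI W'W _ hc) => s Is.
by rewrite cG // hmapK.
Qed.

Lemma explicit_solution (r g : R) : 0 < r -> -1 < g < 1 ->
  exists t f q : R -> R,
  (forall s : R, exists dt df dq,
    [/\ is_derive s 1 t dt, is_derive s 1 f df, is_derive s 1 q dq,
      is_derive s 1 (fun s => 3 * g * r * s) (3 * g * r) &
      let p := Num.sqrt ((1 + r ^+ 2) * (1 - g ^+ 2)) / r in
      [/\ dt = 2 * p * cos (q s - 3 * g * r * s),
          sin (t s) * df = 2 * p * sin (q s - 3 * g * r * s) &
          dq + cos (t s) * df = 2 * (g * (1 + r ^+ 2) / r)]]) /\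
  forall I, explicit_family r I (fun s => euler_point r (t s) (f s) (q s)).
Proof.
move=> r0 /andP[g1 g2].
pose Q := 2 * g / r - g * r.
pose P := 2 * Num.sqrt ((1 + r ^+ 2) * (1 - g ^+ 2)) / r.
have rn : r != 0 by rewrite gt_eqF.
have P0 : P != 0.
  rewrite gt_eqF // /P divr_gt0 // mulr_gt0 // sqrtr_gt0 mulr_gt0 //.
    by rewrite ltr_pwDl // sqr_ge0.
  have -> : 1 - g ^+ 2 = (1 - g) * (1 + g) by ring.
  by rewrite mulr_gt0 //; lra.
have [dy [M h]] := explicit_cot Q P0.
set y := fun s => _ in h.
have hy (s : R) : is_derive s 1 y (dy s) by have [] := h s.
have hM (s : R) : is_derive s 1 M (- (y s * (Q * M s + P))) by have [] := h s.
have PM s : P * M s = Q * (1 + y s ^+ 2) + dy s by have [] := h s.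
have [t [f sol]] := euler_angles_ode P0 hy hM PM.
set chi := fun s => arccot (y s) in sol.
have lin (s : R) : is_derive s 1 (fun s => 3 * g * r * s) (3 * g * r).
  apply: is_derive_eq
    (is_derive_mul (is_derive_const (3 * g * r) s 1) (is_derive_id s 1)) _.
  by rewrite mul0r add0r mulr1.
exists t, f, (fun s => chi s + 3 * g * r * s); split.
  move=> s; have [h1 h2 h3 h4 st0] := sol s.
  have P2 : 2 * (Num.sqrt ((1 + r ^+ 2) * (1 - g ^+ 2)) / r) = P.
    by rewrite /P mulrA.
  eexists _, _, _; split; [exact: h3|exact: h4|exact: is_derive_add h1 (lin s)
    |exact: lin|].
  rewrite /= P2 addrK; split=> //.
    by rewrite mulrCA; congr (_ * _); rewrite mulrC divfK.
  by rewrite addrAC subrK /Q; field.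
(* With c1 = 0, chi is psi less the drift 3 gamma r s already built into the third function. *)
move=> I; exists g, 0, 0, 2; split; first by rewrite g1 g2.
exists t, f, (fun s => chi s + 3 * g * r * s) => Q' P' kappa chi' s Is.
have chiE : chi' = chi.
  by apply/funext => v; rewrite /chi' addrK addr0.
have [h1 h2 h3 h4 st0] := sol s.
by rewrite chiE; split.
Qed.

End Classification.

Theorem theorem6p2 (R : realType) (I : set R) (c : R -> CP2 R) :
  open I -> is_interval I -> conformal_geodesic I c ->
  exists (rho : CP2 R -> CP2 R) (Gamma : R -> CP2 R) (r : R),
    [/\ fs_isometry rho,
        conformal_geodesic I Gamma,
        forall s, I s -> c s = rho (Gamma s),
        0 < r &
        killing_psi_trajectory r I Gamma \/ explicit_family r I Gamma].
Proof.
move=> oI itv hc.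
have [[s0 I0]|nI] := pselect (exists s, I s); last first.
  have I1 : (1%:M : 'M[R[i]]_3) *m adj 1%:M = 1%:M by rewrite adj1 mulmx1.
  have no s : ~ I s by move=> Is; apply: nI; exists s.
  (* On an empty interval every pointwise condition is vacuous, so the curve itself and arbitrary
     constants serve. *)
  exists (hmap 1%:M), c, 1; split.
  - exact: hmap_isometry.
  - exact: hc.
  - by move=> s /no.
  - exact: ltr01.
  left; exists 0, 0, 0, 0; split; first by rewrite lexx pi_ge0.
  by move=> s /no.
have [z [u [a [cz osc hder]]]] := geodesic_generator oI itv hc I0.
have le_k2 : torsion z u a ^+ 2 <= curvature2 z a.
  by have [n [b []]] := osculating_frame osc.
have [r [g [r0 hg et ek]]] := model_parameters le_k2.
case: hg => [g1|hg].
  rewrite g1 in et ek.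
  (* For gamma = 1 one has p = 0, and theta = phi = 0 is allowed; what remains is psi' = 2 (1 + r^2)
     / r, the unit-speed rate along the Killing field. *)
  pose l := 2 * ((1 + r ^+ 2) / r).
  have lin (k s : R) : is_derive s 1 (fun s => k * s) k.
    apply: is_derive_eq (is_derive_mul (is_derive_const k s 1) (is_derive_id s 1)) _.
    by rewrite mul0r add0r mulr1.
  have [||rho [iso geo e]] := geodesic_of_model (p := 0) (t := fun=> 0)
    (f := fun=> 0) (q := fun s => l * s) (x := fun s => 3 * 1 * r * s)
    oI itv hc I0 cz osc hder et ek r0.
  - by ring.
  - move=> s _; exists 0, 0, l; split.
    + exact: is_derive_const.
    + exact: is_derive_const.
    + exact: lin.
    + exact: lin.
    + by split; rewrite ?mulr0 ?mul0r ?addr0 // /l mul1r.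
  exists rho, (fun s => euler_point r 0 0 (l * s)), r; split=> //.
  left; exists 0, 0, 0, l; split; first by rewrite lexx pi_ge0.
  by move=> s _; rewrite add0r.
have [t [f [q [kin expl]]]] := explicit_solution r0 hg.
pose p := Num.sqrt ((1 + r ^+ 2) * (1 - g ^+ 2)) / r.
have pE : p ^+ 2 * r ^+ 2 = (1 - g ^+ 2) * (1 + r ^+ 2).
  have ge0 : 0 <= (1 + r ^+ 2) * (1 - g ^+ 2).
    apply: mulr_ge0; first by rewrite addr_ge0 ?sqr_ge0.
    have -> : 1 - g ^+ 2 = (1 - g) * (1 + g) by ring.
    by move: hg => /andP[g1 g2]; rewrite mulr_ge0 //; lra.
  by rewrite /p expr_div_n sqr_sqrtr // divfK 1?mulrC // expf_neq0 // gt_eqF.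
have [|rho [iso geo e]] := geodesic_of_model (p := p) (t := t) (f := f) (q := q)
  (x := fun s => 3 * g * r * s) oI itv hc I0 cz osc hder et ek r0 pE.
  by move=> s _; exact: kin.
exists rho, (fun s => euler_point r (t s) (f s) (q s)), r; split=> //.
by right; exact: expl.
Qed.
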